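(* Let $f\in \mathcal{D}'^*(\mathbb{R}^d)$. Then $f$ belongs to $\mathcal{S}'^*(\mathbb{R}^d)$ if and only if there exists $\lambda>0$ (there exists $(l_p)\in\mathfrak{R}$) such that for every $\varphi \in \mathcal{D}^*(\mathbb{R}^d)$ $$\sup_{x\in\mathbb{R}^{d}} e^{-M(\lambda |x|)} |(f*\varphi)(x)|<\infty\qquad \left(\sup_{x\in\mathbb{R}^{d}} e^{-N_{l_p}(|x|)} |(f*\varphi)(x)|<\infty\right).$$
   Context: $\mathbb N=\{0,1,2,\dots\}$. $(M_p)_{p\in\mathbb N}$ is a fixed sequence of positive numbers with $M_0=1$ satisfying, for some $c_0,H\ge 1$: (M.1) $M_p^2\le M_{p-1}M_{p+1}$, $p\ge1$; (M.2) $M_p\le c_0H^p\min_{0\le q\le p}M_{p-q}M_q$, $p\in\mathbb N$; (M.3) $\sum_{p=q+1}^{\infty}M_{p-1}/M_p\le c_0qM_q/M_{q+1}$, $q\ge1$. For a multi-index $\alpha$, $M_\alpha:=M_{|\alpha|}$ and $D^\alpha=i^{-|\alpha|}\partial^\alpha$. The associated function is $M(\rho)=\sup_{p\in\mathbb N}\ln_+(\rho^p/M_p)$, $\rho>0$. $\mathfrak R$ is the set of positive sequences $(r_p)_{p\ge1}$ that monotonically increase to infinity; for $(r_p)\in\mathfrak R$, $N_{r_p}(\rho)=\sup_{p\in\mathbb N}\ln_+\frac{\rho^p}{M_p\prod_{j=1}^pr_j}$. The symbol $*$ stands for either $(M_p)$ (Beurling case) or $\{M_p\}$ (Roumieu case);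 statements are made for the Beurling case first, followed by the Roumieu version in parentheses. For $K\subset\mathbb R^d$ compact and $h>0$, $\mathcal D^{\{M_p\}}_{K,h}$ is the Banach space of $\varphi\in C^\infty(\mathbb R^d)$ supported in $K$ with norm $\sup_{\alpha}\sup_{x\in K}|D^\alpha\varphi(x)|/(h^{|\alpha|}M_\alpha)<\infty$. $\mathcal D^{(M_p)}_K=\varprojlim_{h\to0}\mathcal D^{\{M_p\}}_{K,h}$, $\mathcal D^{\{M_p\}}_K=\varinjlim_{h\to\infty}\mathcal D^{\{M_p\}}_{K,h}$, $\mathcal D^*(\mathbb R^d)=\varinjlim_{K}\mathcal D^*_K$, and $\mathcal D'^*(\mathbb R^d)$ is its strong dual. For $m>0$, $\mathcal S^{\{M_p\},m}_\infty(\mathbb R^d)$ is the Banach space of $\varphi\in C^\infty(\mathbb R^d)$ with norm $\sup_\alpha m^{|\alpha|}\|e^{M(m|\cdot|)}D^\alpha\varphi\|_{L^\infty}/M_\alpha<\infty$; $\mathcal S^{(M_p)}(\mathbb R^d)=\varprojlim_{m\to\infty}\mathcal S^{\{M_p\},m}_\infty(\mathbb R^d)$, $\mathcal S^{\{M_p\}}(\mathbb R^d)=\varinjlim_{m\to0}\mathcal S^{\{M_p\},m}_\infty(\mathbb R^d)$, and $\mathcal S'^*(\mathbb R^d)$ is the strong dual of $\mathcal S^*(\mathbb R^d)$, regarded as a subspace of $\mathcal D'^*(\mathbb R^d)$. For $f\in\mathcal D'^*(\mathbb R^d)$ and $\varphi\in\mathcal D^*(\mathbb R^d)$, $(f*\varphi)(x)=\langle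 f(t),\varphi(x-t)\rangle$. *)

(* Defs.v *)
From HB Require Import structures.
From mathcomp Require Import all_boot all_order all_algebra.
From mathcomp Require Import complex.
From mathcomp Require Import all_classical all_reals all_analysis.

Set Implicit Arguments.
Unset Strict Implicit.
Unset Printing Implicit Defensive.

Import Order.TTheory GRing.Theory Num.Theory.
Import numFieldNormedType.Exports.

Local Open Scope classical_set_scope.
Local Open Scope ring_scope.

Section weight_sequences.
Variable R : realType.
Implicit Types (M r : nat -> R) (H rho : R).

Definition cond_M1 M :=
  forall p, (1 <= p)%N -> M p ^+ 2 <= M p.-1 * M p.+1.

(* The index q ranges over 0, ..., p; the seed of the minimum is the q = 0
   term. *)
Definition cond_M2 (c0 : R) H M :=
  forall p, M p <= c0 * H ^+ p *
    \big[Num.min/M (p - 0)%N * M 0%N]_(q < p.+1) (M (p - q)%N * M q).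

Definition cond_M3 (c0 : R) M :=
  forall q, (1 <= q)%N ->
    (\sum_(q.+1 <= p <oo) (M p.-1 / M p)%:E
       <= (c0 * (q%:R * (M q / M q.+1)))%:E)%E.

Definition weight_sequence M :=
  [/\ forall p, 0 < M p, M 0%N = 1 &
    exists c0 H, [/\ 1 <= c0, 1 <= H, cond_M1 M, cond_M2 c0 H M
                   & cond_M3 c0 M]].

(* [ln] is 0 on nonpositive reals, which gives ln_+ 0 = 0. *)
Definition ln_plus (x : R) : R := Num.max 0 (ln x).

(* The set under [sup] is bounded when M is a weight sequence, since
   M p.-1 / M p --> 0 by (M.3).  At rho = 0 the value is 0. *)
Definition assoc_fun M rho : R :=
  sup [set ln_plus (rho ^+ p / M p) | p in [set: nat]].

(* Sequences indexed by p >= 1: the value r 0 is irrelevant. *)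
Definition frakR r :=
  [/\ forall p, (1 <= p)%N -> 0 < r p,
      forall p q, (1 <= p)%N -> (p <= q)%N -> r p <= r q
    & r @ \oo --> +oo].

Definition assoc_fun_seq M r rho : R :=
  assoc_fun (fun p => M p * \prod_(1 <= j < p.+1) r j) rho.

End weight_sequences.

Section smooth_functions.
Variables (R : realType) (d : nat).
Implicit Types (g : 'rV[R]_d -> R[i]) (alpha : {ffun 'I_d -> nat}).

(* The norm carried by 'rV[R]_d in the library is the maximum norm; it induces
   the same topology. *)
Definition enorm (x : 'rV[R]_d) : R := Num.sqrt (\sum_j x 0 j ^+ 2).

Definition cabs (z : R[i]) : R := ComplexField.Normc.normc z.

Definition repart g (x : 'rV[R]_d) : R := complex.Re (g x).
Definition impart g (x : 'rV[R]_d) : R := complex.Im (g x).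

Definition unit_vec (j : 'I_d) : 'rV[R]_d := delta_mx 0 j.

(* R[i] carries no structure of normed space over R: real and imaginary parts
   are differentiated separately. *)
Definition partial (j : 'I_d) g (x : 'rV[R]_d) : R[i] :=
  ('D_(unit_vec j) (repart g) x +i* 'D_(unit_vec j) (impart g) x)%C.

Definition partials (s : seq 'I_d) g := foldr partial g s.

Definition smooth g := forall s : seq 'I_d,
  [/\ continuous (repart (partials s g)), continuous (impart (partials s g))
    & forall (j : 'I_d) x, derivable (repart (partials s g)) x (unit_vec j) /\
                           derivable (impart (partials s g)) x (unit_vec j)].

Definition mlen alpha : nat := (\sum_j alpha j)%N.

Definition partial_alpha alpha g :=
  foldr (fun j => iter (alpha j) (partial j)) g (enum 'I_d).

Definition Dalpha alpha g (x : 'rV[R]_d) : R[i] :=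
  ('i%C ^- mlen alpha) * partial_alpha alpha g x.

Definition supp g : set 'rV[R]_d := closure [set x | g x != 0].

End smooth_functions.

(* Locally convex spaces of complex functions on R^d, given by the underlying
   set of functions and the neighbourhoods of 0.  A set U of functions is put
   in [nbhs0 E] when its trace on [carrier E] is a neighbourhood of 0. *)
Record lcspace (R : realType) (d : nat) := LCSpace {
  carrier : set ('rV[R]_d -> R[i]);
  nbhs0 : set_system ('rV[R]_d -> R[i]) }.

Section locally_convex_spaces.
Variables (R : realType) (d : nat).
Local Notation F := ('rV[R]_d -> R[i]).

Definition absolutely_convex (V : set F) :=
  forall (a b : R[i]) (g h : F), V g -> V h -> cabs a + cabs b <= 1 ->
    V (a *: g + b *: h).

Definition normed_lcspace (A : set F) (nrm : F -> \bar R) : lcspace R d :=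
  let E := [set g | A g /\ (nrm g < +oo)%E] in
  LCSpace E
    [set U | exists2 e : R, 0 < e & [set g | E g /\ (nrm g < e%:E)%E] `<=` U].

(* Intersection of the E i for i in P, with the initial topology. *)
Definition proj_lim (I : eqType) (P : set I) (E : I -> lcspace R d) :
    lcspace R d :=
  let C := [set g | forall i, P i -> carrier (E i) g] in
  LCSpace C
    [set U | exists (s : seq I) (V : I -> set F),
      (forall i, i \in s -> P i /\ nbhs0 (E i) (V i)) /\
      [set g | C g /\ forall i, i \in s -> V i g] `<=` U].

(* Union of the E i for i in P, with the finest locally convex topology making
   all inclusions continuous: the absolutely convex sets whose trace on every
   E i is a neighbourhood of 0 form a base of neighbourhoods of 0. *)
Definition ind_lim (I : Type) (P : set I) (E : I -> lcspace R d) :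
    lcspace R d :=
  LCSpace [set g | exists2 i, P i & carrier (E i) g]
    [set U | exists V : set F,
      [/\ absolutely_convex V, forall i, P i -> nbhs0 (E i) V & V `<=` U]].

(* Continuous linear functionals on E, as total functions whose values outside
   [carrier E] are irrelevant. *)
Definition cdual (E : lcspace R d) (f : F -> R[i]) :=
  (forall (a : R[i]) (g h : F), carrier E g -> carrier E h ->
     f (a *: g + h) = a * f g + f h) /\
  (forall e : R, 0 < e -> nbhs0 E [set g | cabs (f g) < e]).

End locally_convex_spaces.

Variant star := Beurling | Roumieu.

Section ultradistributions.
Variables (R : realType) (d : nat) (M : nat -> R).
Local Notation F := ('rV[R]_d -> R[i]).

(* When K is empty the supremum is -oo, and the space is {0}. *)
Definition D_norm (K : set 'rV[R]_d) (h : R) (g : F) : \bar R :=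
  ereal_sup [set ereal_sup
      [set (cabs (Dalpha alpha g x) / (h ^+ mlen alpha * M (mlen alpha)))%:E
        | x in K]
    | alpha in [set: {ffun 'I_d -> nat}]].

Definition D_Kh (K : set 'rV[R]_d) (h : R) : lcspace R d :=
  normed_lcspace [set g | smooth g /\ supp g `<=` K] (D_norm K h).

Definition D_K (s : star) (K : set 'rV[R]_d) : lcspace R d :=
  match s with
  | Beurling => proj_lim [set h : R | 0 < h] (D_Kh K)
  | Roumieu => ind_lim [set h : R | 0 < h] (D_Kh K)
  end.

Definition D_space (s : star) : lcspace R d :=
  ind_lim [set K : set 'rV[R]_d | compact K] (D_K s).

(* The functions under the L^oo norm are continuous, so that this norm is the
   supremum of the modulus. *)
Definition S_norm (m : R) (g : F) : \bar R :=
  ereal_sup [set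
    ((m ^+ mlen alpha)%:E *
     ereal_sup [set (cabs ((expR (assoc_fun M (m * enorm x)))%:C%C
                             * Dalpha alpha g x))%:E | x in [set: 'rV[R]_d]] *
     ((M (mlen alpha))^-1)%:E)%E
    | alpha in [set: {ffun 'I_d -> nat}]].

Definition S_m (m : R) : lcspace R d :=
  normed_lcspace [set g | smooth g] (S_norm m).

Definition S_space (s : star) : lcspace R d :=
  match s with
  | Beurling => proj_lim [set m : R | 0 < m] S_m
  | Roumieu => ind_lim [set m : R | 0 < m] S_m
  end.

(* S'^* as a subspace of D'^*: f is the restriction to D^* of an element of
   S'^*. *)
Definition in_S' (s : star) (f : F -> R[i]) :=
  exists2 u : F -> R[i], cdual (S_space s) u &
    forall g, carrier (D_space s) g -> u g = f g.

Definition convolution (f : F -> R[i]) (phi : F) (x : 'rV[R]_d) : R[i] :=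
  f (fun t => phi (x - t)).

End ultradistributions.

(* Main.v *)
Require Import Defs.
From HB Require Import structures.
From mathcomp Require Import all_boot all_order all_algebra.
From mathcomp Require Import complex.
From mathcomp Require Import all_classical all_reals all_analysis.
From mathcomp Require Import ring lra zify.

(** Let E = e^M, the supremum of rho^p / M_p, and write e^W for the growth
    allowed in the statement: W(x) = M(lambda |x|) in the Beurling case and
    W(x) = N_(l_p)(|x|) in the Roumieu case.

    Necessity.  If u in S' extends f, then (f * phi)(x) is the value of u at
    t |-> phi(x - t).  The support of this function is a fixed ball moved to x,
    so its norm in S with parameter 1 / k is at most a constant times
    E(2 |x| / k), by [sbound_refl].  In the Beurling case u is bounded by one
    of these norms, whence lambda = 2 / k.  In the Roumieu case u is bounded by
    each of them, so |(f * phi)(x)| is at most C_k E(2 |x| / k) up to a factor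
    that depends on phi, for all large k; [common_sequence] constructs a single
    sequence (l_p) whose growth function dominates whatever satisfies all these
    bounds.

    Sufficiency.  The functionals phi |-> e^(-W(x)) (f * phi)(x) are bounded at
    each phi, so by the uniform boundedness principle, proved here by a gliding
    hump, |(f * phi)(x)| <= C A e^(W(x)) for all phi supported in a given ball
    with a norm at most A, uniformly in x ([convolution_equicontinuity]).  The
    functional f is then extended to g in S by summing f(g p_tau) over a
    partition of unity made of pieces p_tau at the integer points tau.  Each
    term is the value at tau of the convolution of f with the localized
    function (g p_tau)(tau - t), whose support lies in a ball independent of
    tau and whose norm is of the order of 1 / E(|tau| / (2h)) by the decay of
    g.  This factor beats e^(W(tau)) and leaves a power (1 + |tau|)^(-d-2):
    in the Beurling case (M.2) gives this for one small h
    ([weight_dilate]), and in the Roumieu case for every h, since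
    N_(l_p)(rho) is at most M(mu rho) plus a constant for every mu > 0
    ([seq_weight_small]).  Hence the series converges absolutely and is bounded
    by the right norms of S ([piece_estimate], [partial_value_limit]); for a
    test function g it is finite and sums to f(g).

    The partition of unity consists of products of differences of smooth steps
    in each coordinate, and a step is a primitive of a nonnegative bump derived
    from any nonzero element of D ([step_coordinate]).  If D contains only 0,
    the zero functional extends f. *)

Set Implicit Arguments.
Unset Strict Implicit.
Unset Printing Implicit Defensive.

Import Order.TTheory GRing.Theory Num.Theory.
Import numFieldNormedType.Exports.

Local Open Scope classical_set_scope.
Local Open Scope ring_scope.

(** * Associated functions of weight sequences *)

Section AssociatedFunction.
Variable R : realType.
Implicit Types (w M r l : nat -> R) (rho mu : R) (p q k n : nat).

(** The exponential of the associated function, which is what all estimates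
    contain: it is the supremum of rho^p / w_p, free of logarithms. *)
Definition assoc_exp w rho : R := expR (assoc_fun w rho).

(** What makes the supremum finite and at least 1.  The sequences M_p and
    M_p l_1 ... l_p are both of this kind. *)
Definition adm w := [/\ forall p, 0 < w p, w 0%N = 1
  & forall rho, 0 <= rho -> exists B, forall p, rho ^+ p / w p <= B].

Lemma adm_has_sup w rho : adm w -> 0 <= rho ->
  has_sup [set ln_plus (rho ^+ p / w p) | p in [set: nat]].
Proof.
case=> w0 _ wb r0; split; first by exists (ln_plus (rho ^+ 0 / w 0%N)); exists 0%N.
have [B HB] := wb _ r0; exists (ln_plus (Num.max 1 B)) => _ [p _ <-].
rewrite /ln_plus ge_max le_max lexx /= le_max.
have [x0|x0] := lerP (rho ^+ p / w p) 0; first by rewrite (ln0 x0) lexx.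
rewrite ler_ln ?posrE // ?lt_max ?ltr01 //.
by rewrite le_max HB !orbT.
Qed.

Lemma assoc_exp_ge w rho p : adm w -> 0 <= rho -> rho ^+ p / w p <= assoc_exp w rho.
Proof.
move=> aw r0; have [x0|x0] := lerP (rho ^+ p / w p) 0.
  exact: le_trans x0 (expR_ge0 _).
rewrite -[leLHS]lnK ?posrE // ler_expR.
have [_ hs] := adm_has_sup aw r0.
apply: (@le_trans _ _ (ln_plus (rho ^+ p / w p))); first by rewrite le_max lexx orbT.
by apply: ub_le_sup => //; exists p.
Qed.

Lemma assoc_exp_le w rho B : adm w -> 0 <= rho ->
  (forall p, rho ^+ p / w p <= B) -> assoc_exp w rho <= B.
Proof.
move=> aw r0 HB; have B1 : 1 <= B.
  by have := HB 0%N; case: aw => _ -> _; rewrite expr0 divr1.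
have B0 : 0 < B by exact: lt_le_trans B1.
rewrite -[leRHS]lnK ?posrE // ler_expR.
have [hs _] := adm_has_sup aw r0.
apply: ge_sup => // _ [p _ <-]; rewrite ge_max ln_ge0 //=.
have [x0|x0] := lerP (rho ^+ p / w p) 0; first by rewrite ln0 // ln_ge0.
by rewrite ler_ln.
Qed.

Lemma assoc_exp_ge1 w rho : adm w -> 0 <= rho -> 1 <= assoc_exp w rho.
Proof.
by move=> aw r0; have := @assoc_exp_ge _ _ 0%N aw r0; case: aw => _ -> _; rewrite expr0 divr1.
Qed.

Lemma assoc_exp_gt0 w rho : 0 < assoc_exp w rho. Proof. exact: expR_gt0. Qed.

Lemma assoc_exp_mono w rho mu : adm w -> 0 <= rho -> rho <= mu ->
  assoc_exp w rho <= assoc_exp w mu.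
Proof.
move=> aw r0 rm; have m0 := le_trans r0 rm.
apply: assoc_exp_le => // p; apply: le_trans (assoc_exp_ge p aw m0).
by case: aw => w0 _ _; rewrite ler_pM2r ?invr_gt0 // lerXn2r.
Qed.

(** Splits a weight at |x + y| <= 2 max(|x|, |y|) into a weight at x and one
    at y; the larger factor alone would do, as the other is at least 1. *)
Lemma assoc_exp_max w rho mu : adm w -> 0 <= rho -> 0 <= mu ->
  assoc_exp w (Num.max rho mu) <= assoc_exp w rho * assoc_exp w mu.
Proof.
move=> aw r0 m0; have r1 := assoc_exp_ge1 aw r0; have m1 := assoc_exp_ge1 aw m0.
have [a0 b0] := (ltW (assoc_exp_gt0 w rho), ltW (assoc_exp_gt0 w mu)).
by rewrite /Num.max; case: ifP => _; [exact: ler_peMl b0 r1|exact: ler_peMr a0 m1].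
Qed.

#[local] Opaque assoc_exp.

Section Weight.
Variable M : nat -> R.
Hypothesis hM : weight_sequence M.

Lemma weight_gt0 p : 0 < M p. Proof. by case: hM. Qed.
Lemma weight0 : M 0%N = 1. Proof. by case: hM. Qed.
Hint Resolve weight_gt0 : core.

Lemma weight_M1 p : M p.+1 / M p <= M p.+2 / M p.+1.
Proof.
case: hM => _ _ [c0 [H [_ _ m1 _ _]]]; have := m1 p.+1 isT => /=.
by rewrite ler_pdivrMr // mulrAC ler_pdivlMr // -expr2 mulrC.
Qed.

Lemma weight_ratio_le p q : (p <= q)%N -> M p.+1 / M p <= M q.+1 / M q.
Proof.
move=> /subnK <-; elim: (q - p)%N => [|n IH] //=.
by rewrite addSn; apply: le_trans IH (weight_M1 _).
Qed.

(** By (M.1) the quotient M_(p+q+1) / M_(p+q) is at least M_(q+1) / M_q, and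
    M_0 = 1 starts the induction.  Products of functions and the loss of one
    derivative are controlled by this inequality. *)
Lemma weight_supermul p q : M p * M q <= M (p + q)%N.
Proof.
elim: q => [|q IH]; first by rewrite addn0 weight0 mulr1.
rewrite addnS.
have -> : M (p + q).+1 = M (p + q)%N * (M (p + q).+1 / M (p + q)%N).
  by rewrite mulrCA mulfV ?mulr1 // gt_eqF.
have -> : M p * M q.+1 = M p * M q * (M q.+1 / M q).
  by rewrite -!mulrA [M q * _]mulrCA mulfV ?mulr1 // gt_eqF.
apply: ler_pM => //; first by rewrite mulr_ge0 ?ltW.
  by rewrite divr_ge0 ?ltW.
by apply: weight_ratio_le; exact: leq_addl.
Qed.

(** The quotients increase, so if they stayed below B the series in (M.3)
    would have infinitely many terms of size at least 1 / B. *)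
Lemma weight_ratio_unbounded (B : R) : exists P, forall p, (P <= p)%N -> B <= M p.+1 / M p.
Proof.
case: (hM) => _ _ [c0 [H [_ _ _ _ m3]]].
have := m3 1%N isT; set C := (c0 * _) => hC.
pose n := (Num.trunc (Num.max 0 (B * C))).+1.
exists (n.+1) => p np; rewrite leNgt; apply/negP => lt.
have nB : B * C < n%:R.
  have := truncnS_gt (Num.max 0 (B * C)); apply: le_lt_trans; first by rewrite le_max lexx orbT.
have x0 : 0 < M p.+1 / M p by rewrite divr_gt0.
have B0 : 0 < B by exact: lt_trans lt.
have sub : n%:R * B^-1 <= C.
  rewrite -lee_fin; apply: le_trans hC.
  apply: (@le_trans _ _ (\sum_(2 <= i < n.+2) (M i.-1 / M i)%:E)%E); last first.
    rewrite [leRHS]/=. apply: (nneseries_lim_ge (P := predT)) => i _ _.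
    by rewrite lee_fin divr_ge0 // ltW.
  rewrite sumEFin lee_fin.
  have -> : n%:R * B^-1 = \sum_(2 <= i < n.+2) B^-1.
    by rewrite sumr_const_nat subn2 /= mulr_natl.
  rewrite !big_nat; apply: ler_sum => i /andP[i2 iN].
  case: i i2 iN => // i i2 iN /=.
  rewrite -[leRHS]invrK invf_div lef_pV2 ?posrE ?divr_gt0 //.
  apply: le_trans (ltW lt); apply: weight_ratio_le; lia.
by move: sub; rewrite ler_pdivrMr // leNgt mulrC nB.
Qed.

Lemma weight_step rho p : 0 <= rho -> rho <= M p.+1 / M p ->
  rho ^+ p.+1 / M p.+1 <= rho ^+ p / M p.
Proof.
move=> r0 rM; rewrite exprS ler_pdivrMr // [rho * _]mulrC -[leRHS]mulrA [_^-1 * _]mulrC.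
by rewrite ler_wpM2l // exprn_ge0.
Qed.

(** Once M_(p+1) / M_p exceeds b, the terms rho^p / M_p with rho <= b decrease
    in p.  The supremum is thus reached on a range of p that serves all
    rho <= b at once. *)
Lemma weight_finite_sup b : 0 <= b -> exists P, forall rho B, 0 <= rho -> rho <= b ->
  (forall p, (p <= P)%N -> rho ^+ p / M p <= B) -> forall p, rho ^+ p / M p <= B.
Proof.
move=> b0; have [P HP] := weight_ratio_unbounded b.
exists P => rho B r0 rb HB p; have [/HB //|/ltnW] := leqP p P.
move=> /subnK <-; elim: (p - P)%N => [|n IH] //=; first exact: HB.
rewrite addSn; apply: le_trans IH.
by apply: weight_step => //; apply: le_trans rb _; apply: HP; rewrite leq_addl.
Qed.

Lemma weight_adm : adm M.
Proof.
split; [by []|exact: weight0|move=> rho r0].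
have [P HP] := weight_finite_sup r0.
exists (\sum_(i < P.+1) rho ^+ i / M i); apply: HP => // p pP.
rewrite (bigD1 (Ordinal (pP : (p < P.+1)%N))) //= lerDl sumr_ge0 // => i _.
by rewrite divr_ge0 ?exprn_ge0 // ltW.
Qed.

Lemma weight_M2 : exists c0 H, [/\ 1 <= c0, 1 <= H &
  forall p q, M (p + q)%N <= c0 * H ^+ (p + q) * (M p * M q)].
Proof.
case: (hM) => _ _ [c0 [H [c01 H1 _ m2 _]]]; exists c0, H; split => // p q.
apply: le_trans (m2 _) _.
rewrite ler_wpM2l //; first by rewrite mulr_ge0 ?exprn_ge0 // (le_trans ler01).
have pq : (q < (p + q).+1)%N by rewrite ltnS leq_addl.
by apply: le_trans (bigmin_le _ (Ordinal pq) _) _; rewrite /= addnK.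
Qed.

(** The form in which (M.2) is used: e^M absorbs any power of rho at the cost
    of a dilation of its argument.  Indeed rho^k (mu rho)^p / M_p is compared
    with the term of index p + k of the dilated supremum, and
    M_(p+k) <= c0 H^(p+k) M_p M_k. *)
Lemma weight_dilate : exists2 H, 1 <= H & forall k mu, 0 < mu -> exists2 C, 0 < C &
  forall rho, 0 <= rho -> (1 + rho) ^+ k * assoc_exp M (mu * rho) <= C * assoc_exp M (H * mu * rho).
Proof.
have [c0 [H [c01 H1 m2]]] := weight_M2; exists H => // k mu mu0.
have c00 : 0 < c0 by exact: lt_le_trans c01.
have H0 : 0 < H by exact: lt_le_trans H1.
have ad := weight_adm.
pose D := c0 * M k / mu ^+ k.
have D0 : 0 < D by rewrite divr_gt0 ?mulr_gt0 // exprn_gt0.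
exists (2 ^+ k * (1 + D)); first by rewrite mulr_gt0 ?exprn_gt0 // addr_gt0.
move=> rho r0; have mr0 : 0 <= mu * rho by rewrite mulr_ge0 // ltW.
have hmr0 : 0 <= H * mu * rho by rewrite !mulr_ge0 // ltW.
have dil : assoc_exp M (mu * rho) <= assoc_exp M (H * mu * rho).
  by apply: assoc_exp_mono => //; rewrite -mulrA ler_peMl.
have step : rho ^+ k * assoc_exp M (mu * rho) <= D * assoc_exp M (H * mu * rho).
  have [->|rn0] := eqVneq rho 0.
    case: (k) @D D0 => [|j] D D0; last first.
      by rewrite expr0n /= mul0r; apply: mulr_ge0 (ltW D0) (ltW (assoc_exp_gt0 _ _)).
    rewrite !mulr0 expr0 ler_pM2r ?assoc_exp_gt0 // /D weight0 expr0; lra.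
  have rk0 : 0 < rho ^+ k by rewrite exprn_gt0 // lt_neqAle eq_sym rn0.
  rewrite mulrC -ler_pdivlMr //; apply: assoc_exp_le => // p.
  rewrite ler_pdivlMr //.
  apply: le_trans (_ : D * ((H * mu * rho) ^+ (p + k) / M (p + k)%N) <= _); last first.
    by rewrite ler_pM2l //; exact: assoc_exp_ge.
  rewrite [leRHS]mulrA ler_pdivlMr //.
  apply: le_trans (ler_wpM2l _ (m2 p k)) _.
    by rewrite mulr_ge0 ?exprn_ge0 // divr_ge0 ?exprn_ge0 // ltW.
  rewrite le_eqVlt; apply/orP; left; apply/eqP.
  rewrite /D !exprMn !exprD; field.
  by rewrite !gt_eqF ?exprn_gt0 //.
apply: le_trans (_ : 2 ^+ k * (1 + rho ^+ k) * assoc_exp M (mu * rho) <= _).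
  rewrite ler_pM2r ?assoc_exp_gt0 //.
  have [r1|r1] := lerP rho 1.
    apply: le_trans (_ : 2 ^+ k * 1 <= _).
      by rewrite mulr1; apply: lerXn2r; rewrite ?nnegrE ?addr_ge0 ?ler0n // lerD2l.
    by rewrite ler_pM2l ?exprn_gt0 // lerDl exprn_ge0.
  apply: le_trans (_ : 2 ^+ k * rho ^+ k <= _).
    rewrite -exprMn; apply: lerXn2r; rewrite ?nnegrE ?addr_ge0 ?mulr_ge0 ?ler0n //.
    by rewrite mulr_natl mulr2n lerD2r ltW.
  by rewrite ler_pM2l ?exprn_gt0 // lerDr.
move: dil step; set a := assoc_exp M _; set b := assoc_exp M _ => dil step.
rewrite -!mulrA ler_pM2l ?exprn_gt0 // !mulrDl !mul1r; exact: (lerD dil step).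
Qed.

End Weight.
End AssociatedFunction.

#[local] Opaque assoc_exp.

(** * Directional derivatives of real functions *)

Section DirectionalDerivatives.
Variable R : realType.

Lemma is_deriveP (V : normedModType R) (x v : V) (f : V -> R) (l : R) :
  is_derive x v f l <->
  forall e : R, 0 < e -> exists2 dl : R, 0 < dl & forall h : R, `|h| < dl ->
    `|f (h *: v + x) - f x - h * l| <= e * `|h|.
Proof.
split=> [[df <-] e e0|H].
- have /cvgrPdist_le/(_ _ e0) := df; rewrite -[lim _]/('D_v f x).
  move=> /nbhs_norm0P [dl /= dl0 Hd].
  exists dl => // h hd; have [->|h0] := eqVneq h 0.
    by rewrite scale0r add0r subrr mul0r subrr normr0 mulr0.
  have /= := Hd h hd h0; rewrite distrC => le.
  have -> : f (h *: v + x) - f x - h * 'D_v f x =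
    (h^-1 *: (f (h *: v + x) - f x) - 'D_v f x) * h.
    by rewrite mulrBl /GRing.scale /= mulrAC mulVf // mul1r [h * _]mulrC.
  by rewrite normrM ler_wpM2r.
- have c : (fun h => h^-1 *: (f (h *: v + x) - f x)) @ 0^' --> l.
    apply/cvgrPdist_le => e e0.
    have [dl dl0 Hd] := H e e0.
    apply/(@nbhs_norm0P R R^o); exists dl => // h hd h0 /=.
    rewrite distrC -(ler_pM2r (_ : 0 < `|h|)) ?normr_gt0 // -normrM.
    rewrite mulrBl /GRing.scale /= mulrAC mulVf // mul1r [l * _]mulrC.
    exact: Hd.
  have dv : derivable f x v by apply/cvg_ex; exists l.
  by apply: DeriveDef => //; apply/cvg_lim.
Qed.

Lemma continuous_distP (V : normedModType R) (f : V -> R) : continuous f <->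
  forall x (e : R), 0 < e -> exists2 dl : R, 0 < dl & forall y, `|x - y| < dl -> `|f x - f y| <= e.
Proof.
split=> H x.
- move=> e e0; have /cvgrPdist_le/(_ _ e0) := H x.
  by move=> /nbhs_normP[dl /= dl0 Hd]; exists dl.
- apply/cvgrPdist_le => e e0.
  by apply/nbhs_normP; have [dl dl0 Hd] := H x e e0; exists dl.
Qed.

(** The chain rule needed for translations, reflections and coordinate
    projections: L maps the line through x along v to a line along w, run
    through at speed k. *)
Lemma is_derive_affine (V W : normedModType R) (L : V -> W) (f : W -> R) x v w (k l : R) :
  (forall h : R, L (h *: v + x) = (k * h) *: w + L x) ->
  is_derive (L x) w f l -> is_derive x v (f \o L) (k * l).
Proof.
move=> HL /is_deriveP H; apply/is_deriveP => e e0.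
have k1 : 0 < 1 + `|k| by rewrite ltr_pwDl.
have [dl dl0 Hd] := H (e / (1 + `|k|)) (divr_gt0 e0 k1).
exists (dl / (1 + `|k|)) => [|h]; first exact: divr_gt0.
rewrite ltr_pdivlMr // => hd; rewrite /= HL [h * _]mulrA [h * k]mulrC.
have kh : `|k * h| <= `|h| * (1 + `|k|).
  by rewrite normrM mulrC ler_wpM2l // lerDr.
apply: le_trans (Hd _ (le_lt_trans kh hd)) _.
by rewrite -mulrA ler_wpM2l ?(ltW e0) // mulrC ler_pdivrMr.
Qed.

Lemma is_derive_cont1 (f df : R -> R) :
  (forall t : R, is_derive t 1 f (df t)) -> continuous f.
Proof.
move=> H t; apply: differentiable_continuous; apply/derivable1_diffP.
by have [] := H t.
Qed.

Lemma mean_value1 (f df : R -> R) (h : R) : (forall t : R, is_derive t 1 f (df t)) ->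
  exists2 c : R, `|c| <= `|h| & f h - f 0 = h * df c.
Proof.
move=> H; have cf := is_derive_cont1 H.
have [h0|h0] := lerP 0 h.
  have [c] := MVT_segment h0 (fun x _ => H x) (continuous_subspaceT cf).
  rewrite in_itv /= => /andP[c0 ch] ->; exists c; last by rewrite subr0 mulrC.
  by rewrite !ger0_norm.
have [c] := MVT_segment (ltW h0) (fun x _ => H x) (continuous_subspaceT cf).
rewrite in_itv /= => /andP[c0 ch] E; exists c.
  by rewrite !ler0_norm ?lerN2 // ltW.
by rewrite -opprB E sub0r mulrN opprK mulrC.
Qed.

Section Vector.
Variable V : normedModType R.
Implicit Types (x v w : V) (f : V -> R).

Lemma is_derive_line f (df : V -> R) x v :
  (forall y, is_derive y v f (df y)) ->
  forall t : R, is_derive t (1 : R) (fun s => f (s *: v + x)) (df (t *: v + x)).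
Proof.
move=> H t; rewrite -[df _]mul1r.
apply: (@is_derive_affine R V (fun s : R => s *: v + x) f t 1 v) => h.
by rewrite mul1r [h *: 1]mulr1 scalerDl addrA.
Qed.

Lemma mean_value f (df : V -> R) x v (h : R) : (forall y, is_derive y v f (df y)) ->
  exists2 c : R, `|c| <= `|h| & f (h *: v + x) - f x = h * df (c *: v + x).
Proof.
move=> H; have [c ch] := mean_value1 h (is_derive_line x H).
by rewrite scale0r add0r => E; exists c.
Qed.

(** Schwarz: two applications of the mean value theorem, in either order, make
    the same second difference equal to h^2 times either mixed derivative at a
    point near x. *)
Lemma mixed_derivatives f (fv fw fvw fwv : V -> R) v w :
  (forall x, is_derive x v f (fv x)) -> (forall x, is_derive x w f (fw x)) ->
  (forall x, is_derive x w fv (fvw x)) -> (forall x, is_derive x v fw (fwv x)) ->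
  continuous fvw -> continuous fwv -> fvw = fwv.
Proof.
move=> Hv Hw Hvw Hwv /continuous_distP c1 /continuous_distP c2.
apply/funext => x; apply/eqP; rewrite -subr_eq0 -normr_eq0 -[_ == _]negbK.
apply/negP => n0; set e := `|_| in n0.
have e0 : 0 < e by rewrite lt_neqAle eq_sym n0 /=; exact: normr_ge0.
have e4 : 0 < e / 4 by lra.
have [d1 d10 H1] := c1 x _ e4; have [d2 d20 H2] := c2 x _ e4.
pose N := 1 + `|v| + `|w|; have N0 : 0 < N by rewrite /N -addrA ltr_pwDl // addr_ge0.
pose h := Num.min d1 d2 / 2 / N.
have m0 : 0 < Num.min d1 d2 by rewrite lt_min d10.
have h0 : 0 < h by rewrite !divr_gt0.
have near (a b : R) : `|a| <= `|h| -> `|b| <= `|h| ->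
    `|x - (a *: v + (b *: w + x))| < Num.min d1 d2.
  rewrite (ger0_norm (ltW h0)) => ah bh.
  rewrite addrA opprD addrCA subrr addr0 normrN.
  apply: le_lt_trans (ler_normD _ _) _; rewrite !normrZ.
  apply: (@le_lt_trans _ _ (h * N)); last by rewrite /h divfK ?gt_eqF //; lra.
  rewrite /N !mulrDr mulr1 -addrA.
  apply: (@le_trans _ _ (h * `|v| + h * `|w|)); last by rewrite lerDr ltW.
  by apply: lerD; exact: ler_wpM2r.
have D1 : exists a b : R, [/\ `|a| <= `|h|, `|b| <= `|h| &
   (f (h *: v + (h *: w + x)) - f (h *: w + x)) - (f (h *: v + x) - f x)
     = h * (h * fvw (a *: v + (b *: w + x)))].
  pose g y := f (h *: w + y) - f y.
  have dg y : is_derive y v g (fv (h *: w + y) - fv y).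
    have d' : is_derive y v (f \o (fun y => h *: w + y)) (1 * fv (h *: w + y)).
      apply: (is_derive_affine (w := v)) => k.
      by rewrite mul1r addrCA.
    by rewrite -[fv (h *: w + y)]mul1r; apply: (is_deriveB d' (Hv y)).
  have [a ah Ea] := mean_value x h dg.
  have [b bh Eb] := mean_value (a *: v + x) h Hvw.
  exists a, b; split => //; rewrite [a *: v + _]addrCA -Eb -Ea /g [h *: w + (h *: v + x)]addrCA.
  by ring.
have D2 : exists a b : R, [/\ `|a| <= `|h|, `|b| <= `|h| &
   (f (h *: v + (h *: w + x)) - f (h *: w + x)) - (f (h *: v + x) - f x)
     = h * (h * fwv (a *: v + (b *: w + x)))].
  pose g y := f (h *: v + y) - f y.
  have dg y : is_derive y w g (fw (h *: v + y) - fw y).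
    have d' : is_derive y w (f \o (fun y => h *: v + y)) (1 * fw (h *: v + y)).
      apply: (is_derive_affine (w := w)) => k.
      by rewrite mul1r addrCA.
    by rewrite -[fw (h *: v + y)]mul1r; apply: (is_deriveB d' (Hw y)).
  have [b bh Eb] := mean_value x h dg.
  have [a ah Ea] := mean_value (b *: w + x) h Hwv.
  by exists a, b; split => //; rewrite -Ea -Eb /g.
have [a [b [ah bh E1]]] := D1; have [a' [b' [ah' bh' E2]]] := D2.
have hn : h != 0 by rewrite gt_eqF.
have E : fvw (a *: v + (b *: w + x)) = fwv (a' *: v + (b' *: w + x)).
  by apply: (mulfI hn); apply: (mulfI hn); rewrite -E1 -E2.
have n1 : `|fvw x - fvw (a *: v + (b *: w + x))| <= e / 4.
  by apply: H1; have := near a b ah bh; rewrite lt_min => /andP[].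
have n2 : `|fwv x - fwv (a' *: v + (b' *: w + x))| <= e / 4.
  by apply: H2; have := near a' b' ah' bh'; rewrite lt_min => /andP[].
have : e <= e / 4 + e / 4.
  have E3 : fvw x - fwv x = (fvw x - fvw (a *: v + (b *: w + x)))
     - (fwv x - fwv (a' *: v + (b' *: w + x))) by rewrite E; ring.
  by rewrite {1}/e E3; apply: le_trans (ler_normB _ _) _; exact: lerD.
lra.
Qed.

Lemma uniform_limit_continuous (u : nat -> V -> R) f (eps : nat -> R) :
  (forall n, continuous (u n)) -> (forall n x, `|u n x - f x| <= eps n) ->
  (forall e : R, 0 < e -> exists n, eps n <= e) -> continuous f.
Proof.
move=> cu hu he; apply/continuous_distP => x e e0.
have e3 : 0 < e / 3 by lra.
have [n hn] := he _ e3; have /continuous_distP/(_ x _ e3)[dl dl0 Hd] := cu n.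
exists dl => // y /Hd H.
have := le_trans (hu n x) hn; have := le_trans (hu n y) hn.
by move: H; rewrite !ler_norml => /andP[? ?] /andP[? ?] /andP[? ?]; apply/andP; split; lra.
Qed.

(** The mean value theorem makes the difference quotients of the u n uniformly
    close to g near x, so that the estimate passes to the limit. *)
Lemma uniform_limit_derive (u du : nat -> V -> R) f g (eps : nat -> R) v :
  (forall n x, is_derive x v (u n) (du n x)) ->
  (forall n x, `|u n x - f x| <= eps n) -> (forall n x, `|du n x - g x| <= eps n) ->
  (forall e : R, 0 < e -> exists n, eps n <= e) -> continuous g ->
  forall x, is_derive x v f (g x).
Proof.
move=> du_ hu hdu he /continuous_distP cg x; apply/is_deriveP => e e0.
have e2 : 0 < e / 2 by lra.
have [dl dl0 Hd] := cg x _ e2.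
have v1 : 0 < 1 + `|v| by rewrite ltr_pwDl.
exists (dl / (1 + `|v|)) => [|h]; first exact: divr_gt0.
rewrite ltr_pdivlMr // => hd.
have [->|h0] := eqVneq h 0.
  by rewrite scale0r add0r subrr mul0r subrr normr0 mulr0.
have hp : 0 < `|h| by rewrite normr_gt0.
(* s is chosen so that the errors s + s of u n and `|h| * s of du n add up to
   e / 2 * `|h|, the other half being left to the continuity of g *)
pose s := e / 2 * `|h| / (2 + `|h|).
have s0 : 0 < s by rewrite divr_gt0 // ?mulr_gt0 // addr_gt0.
have [n hn] := he _ s0.
have [c ch E] := mean_value x h (du_ n).
have A : `|g (c *: v + x) - g x| <= e / 2.
  rewrite distrC; apply: Hd; rewrite opprD addrCA subrr addr0 normrN normrZ.
  apply: le_lt_trans hd; apply: ler_pM => //; lra.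
have -> : f (h *: v + x) - f x - h * g x =
   (f (h *: v + x) - u n (h *: v + x)) + (u n x - f x)
   + h * ((du n (c *: v + x) - g (c *: v + x)) + (g (c *: v + x) - g x)).
  have -> : u n (h *: v + x) = u n x + h * du n (c *: v + x) by rewrite -E; ring.
  by ring.
apply: le_trans (ler_normD _ _) _; rewrite normrM.
have B1 : `|f (h *: v + x) - u n (h *: v + x) + (u n x - f x)| <= s + s.
  apply: le_trans (ler_normD _ _) _; rewrite distrC.
  by apply: lerD; apply: le_trans (hu _ _) hn.
have B2 : `|du n (c *: v + x) - g (c *: v + x) + (g (c *: v + x) - g x)| <= s + e / 2.
  by apply: le_trans (ler_normD _ _) _; apply: lerD => //; apply: le_trans (hdu _ _) hn.
apply: (@le_trans _ _ (s + s + `|h| * (s + e / 2))).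
  by apply: lerD => //; rewrite ler_pM2l.
have -> : s + s + `|h| * (s + e / 2) = s * (2 + `|h|) + e / 2 * `|h| by ring.
rewrite /s divfK; first by rewrite le_eqVlt; apply/orP; left; apply/eqP; field.
by rewrite gt_eqF // addr_gt0.
Qed.

End Vector.
End DirectionalDerivatives.

(** * The modulus of complex numbers *)

Section ComplexModulus.
Variable R : realType.
Implicit Types z w : R[i].

Lemma ReD z w : complex.Re (z + w) = complex.Re z + complex.Re w.
Proof. by case: z; case: w. Qed.
Lemma ImD z w : complex.Im (z + w) = complex.Im z + complex.Im w.
Proof. by case: z; case: w. Qed.
Lemma ReM z w : complex.Re (z * w)
  = complex.Re z * complex.Re w - complex.Im z * complex.Im w.
Proof. by case: z; case: w. Qed.
Lemma ImM z w : complex.Im (z * w)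
  = complex.Re z * complex.Im w + complex.Im z * complex.Re w.
Proof. by case: z; case: w. Qed.
Lemma ReN z : complex.Re (- z) = - complex.Re z. Proof. by case: z. Qed.
Lemma ImN z : complex.Im (- z) = - complex.Im z. Proof. by case: z. Qed.

Lemma complex_eq z w : complex.Re z = complex.Re w -> complex.Im z = complex.Im w -> z = w.
Proof. by case: z => a b; case: w => c e /= -> ->. Qed.

Lemma cabsD z w : cabs (z + w) <= cabs z + cabs w. Proof. exact: le_normcD. Qed.
Lemma cabsM z w : cabs (z * w) = cabs z * cabs w.
Proof. exact: ComplexField.Normc.normcM. Qed.
Lemma cabsN z : cabs (- z) = cabs z. Proof. exact: normcN. Qed.
Lemma cabsB z w : cabs (z - w) <= cabs z + cabs w.
Proof. by rewrite -(cabsN w) cabsD. Qed.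
Lemma cabsBC z w : cabs (z - w) = cabs (w - z).
Proof. by rewrite -cabsN opprB. Qed.
Lemma cabs0 : cabs (0 : R[i]) = 0. Proof. exact: ComplexField.Normc.normc0. Qed.
Lemma cabs1 : cabs (1 : R[i]) = 1. Proof. exact: ComplexField.Normc.normc1. Qed.
Lemma cabs_ge0 z : 0 <= cabs z. Proof. by case: z => a b; exact: sqrtr_ge0. Qed.
Lemma cabs_eq0 z : cabs z = 0 -> z = 0. Proof. exact: ComplexField.Normc.eq0_normc. Qed.
Lemma cabsV z : cabs z^-1 = (cabs z)^-1.
Proof. exact: ComplexField.Normc.normcV. Qed.
Lemma cabsX z n : cabs (z ^+ n) = cabs z ^+ n.
Proof. by elim: n => [|n IH]; rewrite ?expr0 ?cabs1 // !exprS cabsM IH. Qed.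
Lemma cabsR (a : R) : cabs (a%:C)%C = `|a|.
Proof. by rewrite /cabs /= expr0n addr0 sqrtr_sqr. Qed.
Lemma cabsi : cabs ('i%C : R[i]) = 1.
Proof. by rewrite /cabs /= expr0n expr1n add0r sqrtr1. Qed.

Lemma Re_le_cabs z : `|complex.Re z| <= cabs z.
Proof.
case: z => a b; rewrite /cabs /= -(sqrtr_sqr a).
by apply: ler_wsqrtr; rewrite lerDl sqr_ge0.
Qed.
Lemma Im_le_cabs z : `|complex.Im z| <= cabs z.
Proof.
case: z => a b; rewrite /cabs /= -(sqrtr_sqr b).
by apply: ler_wsqrtr; rewrite lerDr sqr_ge0.
Qed.
Lemma cabs_le_ReIm z : cabs z <= `|complex.Re z| + `|complex.Im z|.
Proof.
have -> : z = ((complex.Re z)%:C + 'i * (complex.Im z)%:C)%C by case: z => a b /=; simpc.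
by apply: le_trans (cabsD _ _) _; rewrite cabsM !cabsR cabsi mul1r /= ; simpc.
Qed.

Lemma cabs_sum (I : Type) (r : seq I) (P : pred I) (f : I -> R[i]) :
  cabs (\sum_(i <- r | P i) f i) <= \sum_(i <- r | P i) cabs (f i).
Proof.
elim/big_rec2: _ => [|i x y _ h]; first by rewrite cabs0.
by apply: le_trans (cabsD _ _) _; rewrite lerD2l.
Qed.

End ComplexModulus.

(** * Smooth complex functions *)

Section SmoothFunctions.
Variables (R : realType) (d : nat).
Local Notation V := 'rV[R]_d.
Local Notation F := (V -> R[i]).
Implicit Types (g h : F) (i j : 'I_d) (s t : seq 'I_d) (x y : V).

(** Being differentiable with derivative z, as one relation: unlike [partial],
    which is total, it carries the existence of the derivative. *)
Definition isd j g x (z : R[i]) :=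
  is_derive x (unit_vec R j) (repart g) (complex.Re z) /\
  is_derive x (unit_vec R j) (impart g) (complex.Im z).

Definition contC g := continuous (repart g) /\ continuous (impart g).

Definition C1 g := contC g /\ forall j x, isd j g x (partial j g x).

Lemma partialE j g x z : isd j g x z -> partial j g x = z.
Proof. by case: z => a b [H1 H2]; rewrite /partial !derive_val. Qed.

Lemma smoothE g : smooth g <-> forall s, C1 (partials s g).
Proof.
split=> H s; have := H s.
  by case=> c1 c2 D; split => // j x; have [d1 d2] := D j x; split; apply: derivableP.
by case=> -[c1 c2] D; split => // j x; have [[? _] [? _]] := D j x.
Qed.

Lemma smooth_C1 g : smooth g -> C1 g. Proof. by move/smoothE/(_ [::]). Qed.

Lemma partials_cat s t g : partials (s ++ t) g = partials s (partials t g).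
Proof. exact: foldr_cat. Qed.

Lemma smooth_partials s g : smooth g -> smooth (partials s g).
Proof. by move=> /smoothE H; apply/smoothE => t; rewrite -partials_cat. Qed.

Lemma smooth_partial j g : smooth g -> smooth (partial j g).
Proof. exact: (@smooth_partials [:: j]). Qed.

(** Smoothness without computing iterated derivatives: it suffices to find a
    class of C^1 functions that contains g and that partial derivatives do not
    leave. *)
Lemma smooth_stable (P : F -> Prop) :
  (forall g, P g -> C1 g /\ forall j, P (partial j g)) -> forall g, P g -> smooth g.
Proof.
move=> HP g Pg; apply/smoothE => s; suff : P (partials s g) by case/HP.
by elim: s => //= j s /HP[].
Qed.

Lemma smooth_first g : C1 g -> (forall j, smooth (partial j g)) -> smooth g.
Proof.
move=> c1 H; apply/smoothE; elim/last_ind => // s j _.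
by rewrite -cats1 partials_cat; move: (H j) => /smoothE.
Qed.

(** * Rules of differentiation *)

Lemma isdD j g h x z w : isd j g x z -> isd j h x w -> isd j (g + h) x (z + w).
Proof.
move=> [a1 b1] [a2 b2]; rewrite /isd ReD ImD; split.
  have -> : repart (g + h) = repart g + repart h by apply/funext => y; rewrite /repart !fctE ReD.
  exact: is_deriveD.
have -> : impart (g + h) = impart g + impart h by apply/funext => y; rewrite /impart !fctE ImD.
exact: is_deriveD.
Qed.

Lemma isdM j g h x z w : isd j g x z -> isd j h x w ->
  isd j (g \* h) x (z * h x + g x * w).
Proof.
move=> [a1 b1] [a2 b2]; rewrite /isd ReD ImD !ReM !ImM; split.
  have -> : repart (g \* h) = repart g * repart h - impart g * impart h.
    by apply/funext => y; rewrite /repart /impart !fctE ReM.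
  have D1 := @is_deriveM _ _ _ _ _ _ _ _ a1 a2; have D2 := @is_deriveM _ _ _ _ _ _ _ _ b1 b2.
  apply: (is_derive_eq (@is_deriveB _ _ _ _ _ _ _ _ _ D1 D2)).
  by rewrite /GRing.scale /= /repart /impart; ring.
have -> : impart (g \* h) = repart g * impart h + impart g * repart h.
  by apply/funext => y; rewrite /repart /impart !fctE ImM.
have D1 := @is_deriveM _ _ _ _ _ _ _ _ a1 b2; have D2 := @is_deriveM _ _ _ _ _ _ _ _ b1 a2.
apply: (is_derive_eq (@is_deriveD _ _ _ _ _ _ _ _ _ D1 D2)).
by rewrite /GRing.scale /= /repart /impart; ring.
Qed.

Lemma isd_cst j (c : R[i]) x : isd j (fun=> c) x 0.
Proof. by split; exact: is_derive_cst. Qed.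

Lemma isdZ j (a : R[i]) g x z : isd j g x z -> isd j (a *: g) x (a * z).
Proof.
by move=> dg; have := isdM (isd_cst j a x) dg; rewrite mul0r add0r.
Qed.

Lemma isd_affine i j g (L : V -> V) x (k : R) z :
  (forall c : R, L (c *: unit_vec R i + x) = (k * c) *: unit_vec R j + L x) ->
  isd j g (L x) z -> isd i (g \o L) x (k%:C%C * z).
Proof.
move=> HL [a b]; rewrite /isd ReM ImM /= !mul0r subr0 addr0.
by split; [exact: is_derive_affine HL a|exact: is_derive_affine HL b].
Qed.

Lemma contC_D g h : contC g -> contC h -> contC (g + h).
Proof.
move=> [a1 b1] [a2 b2]; split.
  have -> : repart (g + h) = repart g + repart h by apply/funext => y; rewrite /repart !fctE ReD.
  by move=> x; apply: continuousD; [exact: a1|exact: a2].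
have -> : impart (g + h) = impart g + impart h by apply/funext => y; rewrite /impart !fctE ImD.
by move=> x; apply: continuousD; [exact: b1|exact: b2].
Qed.

Lemma contC_M g h : contC g -> contC h -> contC (g \* h).
Proof.
move=> [a1 b1] [a2 b2]; split.
  have -> : repart (g \* h) = repart g * repart h - impart g * impart h.
    by apply/funext => y; rewrite /repart /impart !fctE ReM.
  by move=> x; apply: continuousB; apply: continuousM; [exact: a1|exact: a2|exact: b1|exact: b2].
have -> : impart (g \* h) = repart g * impart h + impart g * repart h.
  by apply/funext => y; rewrite /repart /impart !fctE ImM.
by move=> x; apply: continuousD; apply: continuousM; [exact: a1|exact: b2|exact: b1|exact: a2].
Qed.

Lemma contC_cst (c : R[i]) : contC (fun=> c).
Proof. by split; exact: cst_continuous. Qed.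

Lemma contC_Z (a : R[i]) g : contC g -> contC (a *: g).
Proof. exact: contC_M (contC_cst a). Qed.

Lemma contC_comp g (L : V -> V) : continuous L -> contC g -> contC (g \o L).
Proof.
move=> cL [a b]; split=> x.
  by apply: (@continuous_comp _ _ _ L (repart g)); [exact: cL|exact: a].
by apply: (@continuous_comp _ _ _ L (impart g)); [exact: cL|exact: b].
Qed.

Lemma partial_lin j a g h : C1 g -> C1 h ->
  partial j (a *: g + h) = a *: partial j g + partial j h.
Proof.
move=> [_ Dg] [_ Dh]; apply/funext => x; apply: partialE.
by apply: isdD; first apply: isdZ.
Qed.

Lemma C1_lin a g h : C1 g -> C1 h -> C1 (a *: g + h).
Proof.
move=> cg ch; split; first by apply: contC_D; [apply: contC_Z; case: cg|case: ch].
move=> j x; rewrite partial_lin //; case: cg => _ Dg; case: ch => _ Dh.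
by apply: isdD; first apply: isdZ.
Qed.

Lemma smooth_lin a g h : smooth g -> smooth h -> smooth (a *: g + h).
Proof.
move=> sg sh; pose P k := exists g h, [/\ smooth g, smooth h & k = a *: g + h].
apply: (@smooth_stable P); last by exists g, h.
move=> _ [g1 [h1 [sg1 sh1 ->]]]; have c1 := smooth_C1 sg1; have c2 := smooth_C1 sh1.
split; first exact: C1_lin.
move=> j; exists (partial j g1), (partial j h1).
by split; [exact: smooth_partial|exact: smooth_partial|exact: partial_lin].
Qed.

Lemma partials_lin s a g h : smooth g -> smooth h ->
  partials s (a *: g + h) = a *: partials s g + partials s h.
Proof.
move=> sg sh; elim: s => //= j s ->.
by apply: partial_lin; apply: smooth_C1; exact: smooth_partials.
Qed.

Lemma smooth_cst (c : R[i]) : smooth (fun _ : V => c).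
Proof.
have pc k j : partial j (fun=> k) = (fun=> 0 : R[i]) :> F.
  by apply/funext => x; apply: partialE; exact: isd_cst.
apply: (@smooth_stable (fun g => exists c, g = fun=> c)); last by exists c.
move=> _ [k ->]; split; last by move=> j; exists 0; exact: pc.
by split=> [|j x]; [exact: contC_cst|rewrite pc; exact: isd_cst].
Qed.

Lemma partials_cst s (c : R[i]) (x : V) : partials s (fun _ : V => c) x = if s is [::] then c else 0.
Proof.
case: s => // j s; suff -> : partials (j :: s) (fun=> c) = (fun=> 0 : R[i]) :> F by [].
elim: s j => [|i s IH] j /=; last first.
  by rewrite -[partial i _]/(partials (i :: s) _) IH; apply/funext => y; apply: partialE; exact: isd_cst.
by apply/funext => y; apply: partialE; exact: isd_cst.
Qed.

Lemma smooth0 : smooth (0 : F). Proof. exact: smooth_cst. Qed.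

Lemma smoothZ a g : smooth g -> smooth (a *: g).
Proof. by move=> sg; rewrite -[_ *: _]addr0; exact: (smooth_lin a sg smooth0). Qed.

Lemma partials0 s : partials s (0 : F) = 0.
Proof. by apply/funext => x; rewrite partials_cst; case: s. Qed.

Lemma partialsZ s a g : smooth g -> partials s (a *: g) = a *: partials s g.
Proof.
by move=> sg; rewrite -[a *: g]addr0 (partials_lin _ _ sg smooth0) partials0 addr0.
Qed.

Lemma partial0 j : partial j (0 : F) = 0. Proof. exact: (partials0 [:: j]). Qed.

Lemma partialZ j a g : smooth g -> partial j (a *: g) = a *: partial j g.
Proof. exact: (@partialsZ [:: j]). Qed.

Lemma smoothB g h : smooth g -> smooth h -> smooth (g - h).
Proof. by move=> sg sh; rewrite addrC -scaleN1r; exact: smooth_lin. Qed.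

Lemma partialsB s g h : smooth g -> smooth h -> partials s (g - h) = partials s g - partials s h.
Proof. by move=> sg sh; rewrite addrC -scaleN1r partials_lin // scaleN1r addrC. Qed.

(** * Products and the Leibniz rule *)

Lemma partial_mul j g h : C1 g -> C1 h ->
  partial j (g \* h) = (partial j g \* h) + (g \* partial j h).
Proof.
move=> [_ Dg] [_ Dh]; apply/funext => x; apply: partialE; exact: isdM.
Qed.

Lemma C1_mul g h : C1 g -> C1 h -> C1 (g \* h).
Proof.
move=> cg ch; split; first by apply: contC_M; [case: cg|case: ch].
move=> j x; rewrite partial_mul //; case: cg => _ Dg; case: ch => _ Dh; exact: isdM.
Qed.

(** The class that derivatives do not leave consists of the finite sums of
    products of smooth functions: the i-th product contributes the terms of
    indices 2i and 2i + 1 to the derivative. *)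
Lemma smooth_mul g h : smooth g -> smooth h -> smooth (g \* h).
Proof.
move=> sg sh.
pose P k := exists (n : nat) (a b : nat -> F), [/\ forall m, smooth (a m), forall m, smooth (b m)
  & k = \sum_(i < n) (a i \* b i)].
apply: (@smooth_stable P); last by exists 1%N, (fun=> g), (fun=> h); rewrite big_ord1.
move=> _ [n [a [b [sa sb ->]]]]; split.
  elim: n => [|n IH]; first by rewrite big_ord0; apply: smooth_C1; exact: smooth0.
  rewrite big_ord_recr /= addrC -[X in X + _]scale1r; apply: C1_lin => //.
  by apply: C1_mul; apply: smooth_C1; [exact: sa|exact: sb].
move=> j; pose a' (i : nat) := if odd i then a i./2 else partial j (a i./2).
pose b' (i : nat) := if odd i then partial j (b i./2) else b i./2.
exists (n.*2), a', b'; split.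
- by rewrite /a' => i; case: ifP => _; [exact: sa|apply: smooth_partial; exact: sa].
- by rewrite /b' => i; case: ifP => _; [apply: smooth_partial; exact: sb|exact: sb].
suff [-> _] : partial j (\sum_(i < n) (a i \* b i)) = \sum_(i < n.*2) (a' i \* b' i)
  /\ C1 (\sum_(i < n) (a i \* b i)) by [].
elim: n => [|n [IH c1]].
  rewrite !big_ord0; split; last by apply: smooth_C1; exact: smooth0.
  exact: (@partials0 [:: j]).
have cn : C1 (a n \* b n) by apply: C1_mul; apply: smooth_C1; [exact: sa|exact: sb].
rewrite doubleS big_ord_recr /= addrC -[X in X + _]scale1r; split; last exact: C1_lin.
rewrite partial_lin // scale1r partial_mul; [|by apply: smooth_C1; exact: sa|by apply: smooth_C1; exact: sb].
rewrite IH !big_ord_recr /= /a' /b' /= odd_double uphalf_double doubleK /=.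
set P' := _ \* b n; set Q' := _ \* partial j _; set S := \sum_(i < _) _.
by apply/funext => x; change (P' x + Q' x + S x = S x + P' x + Q' x); rewrite [LHS]addrC addrA.
Qed.

(** The ways to share out the derivatives of the word s between two factors,
    each occurrence separately.  Using words in place of multi-indices spares
    the binomial coefficients in the Leibniz rule. *)
Fixpoint splits (s : seq 'I_d) : seq (seq 'I_d * seq 'I_d) :=
  if s is j :: s' then [seq (j :: p.1, p.2) | p <- splits s'] ++
                       [seq (p.1, j :: p.2) | p <- splits s']
  else [:: ([::], [::])].

Lemma isd_sum (I : Type) (r : seq I) (f : I -> F) (z : I -> R[i]) j x :
  (forall n, isd j (f n) x (z n)) ->
  isd j (fun y => \sum_(n <- r) f n y) x (\sum_(n <- r) z n).
Proof.
move=> H; have -> : (fun y => \sum_(n <- r) f n y) = \sum_(n <- r) f n.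
  by apply/funext => y; rewrite fct_sumE.
by elim/big_rec2: _ => [|i u v _ IH]; [exact: isd_cst|exact: isdD].
Qed.

Lemma leibniz s g h x : smooth g -> smooth h ->
  partials s (g \* h) x = \sum_(p <- splits s) partials p.1 g x * partials p.2 h x.
Proof.
move=> sg sh; elim: s x => [|j s IH] x /=; first by rewrite big_seq1.
apply: partialE; rewrite (_ : partials s (g \* h) =
  fun x => \sum_(p <- splits s) (partials p.1 g \* partials p.2 h) x); last exact/funext.
rewrite big_cat !big_map /= -big_split /=; apply: isd_sum => p.
have [_ Dg] := smooth_C1 (smooth_partials p.1 sg).
have [_ Dh] := smooth_C1 (smooth_partials p.2 sh).
exact: isdM.
Qed.

Lemma splits_size s p : p \in splits s -> (size p.1 + size p.2)%N = size s.
Proof.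
elim: s p => [|j s IH] p /=; first by rewrite inE => /eqP ->.
by rewrite mem_cat => /orP[] /mapP[q /IH <- ->] /=; lia.
Qed.

(** With the Leibniz rule, bounds by a^|s| and b^|s| on the derivatives of two
    factors give (a + b)^|s| on those of their product. *)
Lemma splits_binomial (a b : R) s :
  \sum_(p <- splits s) a ^+ size p.1 * b ^+ size p.2 = (a + b) ^+ size s.
Proof.
elim: s => [|j s IH] /=; first by rewrite big_seq1 !expr0 mulr1.
rewrite big_cat !big_map /= exprS -IH mulrDl !big_distrr /=; congr (_ + _).
  by apply: eq_bigr => p _; rewrite exprS mulrA.
by apply: eq_bigr => p _; rewrite exprS mulrCA.
Qed.

(** * Affine changes of variables *)

Section Affine.
(** L multiplies the i-th direction by k i and turns it into the direction
    sg i: translations, the reflections t |-> x - t and the projections to a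
    line parallel to an axis are of this form. *)
Variables (L : V -> V) (k : 'I_d -> R) (sg : 'I_d -> 'I_d).
Hypothesis cL : continuous L.
Hypothesis affL : forall i x (c : R),
  L (c *: unit_vec R i + x) = (k i * c) *: unit_vec R (sg i) + L x.

Lemma partial_affine i g : C1 g -> partial i (g \o L) = (k i)%:C%C *: (partial (sg i) g \o L).
Proof.
move=> [_ Dg]; apply/funext => x; apply: partialE.
by apply: isd_affine (Dg _ _) => c; exact: affL.
Qed.

Lemma C1_affine g : C1 g -> C1 (g \o L).
Proof.
move=> cg; split; first by case: cg => cg _; exact: contC_comp.
move=> i x; rewrite partial_affine //; case: cg => _ Dg.
by apply: isd_affine (Dg _ _) => c; exact: affL.
Qed.

Lemma smooth_affine g : smooth g -> smooth (g \o L).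
Proof.
move=> sG; pose P f := exists (c : R[i]) g, smooth g /\ f = c *: (g \o L).
apply: (@smooth_stable P); last by exists 1, g; rewrite scale1r.
move=> _ [c [g1 [s1 ->]]]; have c1 := smooth_C1 s1.
have c0 : C1 (0 : F) by apply: smooth_C1; exact: smooth0.
split; first by rewrite -[_ *: _]addr0; apply: C1_lin => //; exact: C1_affine.
move=> j; exists (c * (k j)%:C%C), (partial (sg j) g1); split; first exact: smooth_partial.
rewrite -[c *: _]addr0 partial_lin //; last exact: C1_affine.
by rewrite partial_affine // scalerA partial0 addr0.
Qed.

Lemma partials_affine s g : smooth g ->
  partials s (g \o L) = (\prod_(i <- s) k i)%:C%C *: (partials (map sg s) g \o L).
Proof.
move=> sG; elim: s => [|j s IH] /=; first by rewrite big_nil scale1r.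
rewrite IH big_cons mulrC rmorphM /= -scalerA.
have sp := smooth_partials (map sg s) sG.
rewrite partialZ; last exact: smooth_affine.
by congr (_ *: _); rewrite /= partial_affine //; exact: smooth_C1.
Qed.

Lemma partials_affine_le s g x : (forall i, `|k i| <= 1) -> smooth g ->
  cabs (partials s (g \o L) x) <= cabs (partials (map sg s) g (L x)).
Proof.
move=> k1 sG; rewrite partials_affine // /= [_ *: _]/GRing.scale /= cabsM cabsR.
rewrite ler_piMl ?cabs_ge0 //; elim: s => [|j s IH]; first by rewrite big_nil normr1.
by rewrite big_cons normrM mulr_ile1.
Qed.

End Affine.

(** * From words of derivatives to multi-indices *)

Lemma partialC i j g : smooth g -> partial i (partial j g) = partial j (partial i g).
Proof.
move=> sg; have [_ D] := smooth_C1 sg.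
have [_ Di] := smooth_C1 (smooth_partial i sg).
have [_ Dj] := smooth_C1 (smooth_partial j sg).
have [[c1 c2] _] := smooth_C1 (smooth_partials [:: i; j] sg).
have [[c3 c4] _] := smooth_C1 (smooth_partials [:: j; i] sg).
have E1 : repart (partials [:: i; j] g) = repart (partials [:: j; i] g).
  have H1 y : is_derive y (unit_vec R j) (repart g) (repart (partial j g) y) by case: (D j y).
  have H2 y : is_derive y (unit_vec R i) (repart g) (repart (partial i g) y) by case: (D i y).
  have H3 y : is_derive y (unit_vec R i) (repart (partial j g)) (repart (partials [:: i; j] g) y).
    by exact: (Dj i y).1.
  have H4 y : is_derive y (unit_vec R j) (repart (partial i g)) (repart (partials [:: j; i] g) y).
    by exact: (Di j y).1.
  exact: mixed_derivatives H1 H2 H3 H4 c1 c3.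
have E2 : impart (partials [:: i; j] g) = impart (partials [:: j; i] g).
  have H1 y : is_derive y (unit_vec R j) (impart g) (impart (partial j g) y) by case: (D j y).
  have H2 y : is_derive y (unit_vec R i) (impart g) (impart (partial i g) y) by case: (D i y).
  have H3 y : is_derive y (unit_vec R i) (impart (partial j g)) (impart (partials [:: i; j] g) y).
    by exact: (Dj i y).2.
  have H4 y : is_derive y (unit_vec R j) (impart (partial i g)) (impart (partials [:: j; i] g) y).
    by exact: (Di j y).2.
  exact: mixed_derivatives H1 H2 H3 H4 c2 c4.
apply/funext => x; apply: complex_eq.
  exact: (congr1 (fun f => f x) E1).
exact: (congr1 (fun f => f x) E2).
Qed.

Lemma partials_move s j t g : smooth g -> partials (s ++ j :: t) g = partials (j :: s ++ t) g.
Proof.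
move=> sg; elim: s => //= i s ->; rewrite /= partialC; [by []|exact: smooth_partials].
Qed.

Lemma partials_perm s t g : smooth g -> perm_eq s t -> partials s g = partials t g.
Proof.
move=> sg; elim: s t => [|j s IH] t; first by rewrite perm_sym => /perm_nilP ->.
move=> st; have jt : j \in t by rewrite -(perm_mem st) mem_head.
case/splitPr: jt st => t1 t2 st.
rewrite partials_move //= (IH (t1 ++ t2)) //.
by rewrite -(perm_cons j) (perm_trans st) // -[j :: t2]cat1s perm_catCA.
Qed.

Definition alpha_seq (al : {ffun 'I_d -> nat}) := flatten [seq nseq (al j) j | j <- enum 'I_d].

Lemma size_alpha_seq al : size (alpha_seq al) = mlen al.
Proof.
rewrite size_flatten /shape -map_comp sumnE big_map /mlen big_enum /=.
by apply: eq_bigr => j _; rewrite size_nseq.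
Qed.

Lemma partial_alphaE al g : partial_alpha al g = partials (alpha_seq al) g.
Proof.
rewrite /partial_alpha /alpha_seq; elim: (enum 'I_d) => //= j r ->.
by rewrite partials_cat; elim: (al j) => //= n ->.
Qed.

Lemma perm_alpha_seq s : perm_eq (alpha_seq [ffun j => count_mem j s]) s.
Proof.
suff H i (r : seq 'I_d) : uniq r -> count_mem i (flatten [seq nseq ([ffun j => count_mem j s] j) j | j <- r])
    = ((i \in r) * count_mem i s)%N.
  by apply/allP => i _; rewrite /= H ?enum_uniq // mem_enum mul1n.
elim: r => //= j r IH /andP[jr ur]; rewrite count_cat IH // count_nseq /= ffunE inE.
have [->|ij] := eqVneq i j; first by rewrite (negPf jr) addn0.
by [].
Qed.

(** Since partial derivatives of smooth functions commute, the multi-indices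
    in the norms of the spaces reach the derivatives along all words. *)
Lemma partials_alpha s g : smooth g -> exists2 al : {ffun 'I_d -> nat}, size s = mlen al &
  partial_alpha al g = partials s g.
Proof.
move=> sg; exists [ffun j => count_mem j s].
  by rewrite -size_alpha_seq (perm_size (perm_alpha_seq s)).
by rewrite partial_alphaE; exact: partials_perm (perm_alpha_seq s).
Qed.

Lemma partials_vanish (U : set V) s g : open U -> smooth g ->
  (forall x, U x -> g x = 0) -> forall x, U x -> partials s g x = 0.
Proof.
move=> oU sg g0; elim: s => //= j s IH x Ux.
have sp := smooth_partials s sg; have [_ D] := smooth_C1 sp.
have [dl dl0 Hd] : exists2 dl : R, 0 < dl & forall c : R, `|c| < dl -> U (c *: unit_vec R j + x).
  have cL : {for (0 : R), continuous (fun c : R => c *: unit_vec R j + x)}.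
    by apply: continuousD; [exact: scalel_continuous|exact: cst_continuous].
  have nU : nbhs (0 *: unit_vec R j + x) U by rewrite scale0r add0r; exact: open_nbhs_nbhs.
  have /(@nbhs_norm0P R R^o)[dl /= dl0 Hd] := cL _ nU.
  by exists dl.
have E1 y : U y -> repart (partials s g) y = 0 by rewrite /repart => /IH ->.
have E2 y : U y -> impart (partials s g) y = 0 by rewrite /impart => /IH ->.
apply: partialE; split; apply/is_deriveP => e e0; exists dl => // c cd.
  rewrite !E1 //; last exact: Hd.
  by rewrite -[complex.Re 0]/0 mulr0 !subrr normr0 mulr_ge0 // ltW.
rewrite !E2 //; last exact: Hd.
by rewrite -[complex.Im 0]/0 mulr0 !subrr normr0 mulr_ge0 // ltW.
Qed.

(** * Uniform limits of smooth functions *)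

(** Gives the completeness of the spaces of test functions: the limits T s of
    all the derivatives along words s are prescribed together, so that the
    derivative of T s is found to be T (j :: s) by the one-step result. *)
Lemma smooth_uniform_limit (G : nat -> F) (T : seq 'I_d -> F) (eps : seq 'I_d -> nat -> R) :
  (forall n, smooth (G n)) ->
  (forall s n x, cabs (partials s (G n) x - T s x) <= eps s n) ->
  (forall s e, 0 < e -> exists N, forall n, (N <= n)%N -> eps s n <= e) ->
  smooth (T [::]) /\ forall s, partials s (T [::]) = T s.
Proof.
move=> sG close small.
have cT s : contC (T s).
  have sm e : 0 < e -> exists n, eps s n <= e.
    by move=> /(small s)[N HN]; exists N; exact: HN.
  split; [apply: (uniform_limit_continuous (u := fun n => repart (partials s (G n))) (eps := eps s)) => //|
    apply: (uniform_limit_continuous (u := fun n => impart (partials s (G n))) (eps := eps s)) => //].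
  - by move=> n; case: (smooth_C1 (smooth_partials s (sG n))) => -[].
  - by move=> n x; apply: le_trans (close s n x); rewrite /repart -ReN -ReD Re_le_cabs.
  - by move=> n; case: (smooth_C1 (smooth_partials s (sG n))) => -[].
  - by move=> n x; apply: le_trans (close s n x); rewrite /impart -ImN -ImD Im_le_cabs.
have dT s j x : isd j (T s) x (T (j :: s) x).
  pose ep n := Num.max (eps s n) (eps (j :: s) n).
  have sm e : 0 < e -> exists n, ep n <= e.
    move=> e0; have [N HN] := small s e e0; have [N' HN'] := small (j :: s) e e0.
    exists (maxn N N'); rewrite ge_max HN ?leq_maxl // HN' ?leq_maxr //.
  have cl1 n y : cabs (partials s (G n) y - T s y) <= ep n by rewrite le_max close.
  have cl2 n y : cabs (partials (j :: s) (G n) y - T (j :: s) y) <= ep n.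
    by rewrite le_max close orbT.
  have [c1 c2] := cT (j :: s).
  have DG n := (smooth_C1 (smooth_partials s (sG n))).2 j.
  split.
    apply: (uniform_limit_derive (u := fun n => repart (partials s (G n)))
      (du := fun n => repart (partials (j :: s) (G n))) (g := repart (T (j :: s))) (eps := ep)) => //.
    - by move=> n y; case: (DG n y).
    - by move=> n y; apply: le_trans (cl1 n y); rewrite /repart -ReN -ReD Re_le_cabs.
    - by move=> n y; apply: le_trans (cl2 n y); rewrite /repart -ReN -ReD Re_le_cabs.
  apply: (uniform_limit_derive (u := fun n => impart (partials s (G n)))
      (du := fun n => impart (partials (j :: s) (G n))) (g := impart (T (j :: s))) (eps := ep)) => //.
  - by move=> n y; case: (DG n y).
  - by move=> n y; apply: le_trans (cl1 n y); rewrite /impart -ImN -ImD Im_le_cabs.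
  - by move=> n y; apply: le_trans (cl2 n y); rewrite /impart -ImN -ImD Im_le_cabs.
have pT s : partials s (T [::]) = T s.
  by elim: s => //= j s ->; apply/funext => x; apply: partialE; exact: dT.
split=> //; apply/smoothE => s; rewrite pT; split=> // j x.
have -> : partial j (T s) = T (j :: s) by rewrite -(pT s) -(pT (j :: s)).
exact: dT.
Qed.

End SmoothFunctions.

(** * The norms of the spaces D and S *)

Section Spaces.
Variables (R : realType) (d : nat) (M : nat -> R).
Hypothesis hM : weight_sequence M.
Local Notation V := 'rV[R]_d.
Local Notation F := (V -> R[i]).
Implicit Types (g : F) (a m : R) (s t : seq 'I_d) (x y : V).

Lemma norm_leP x (a : R) : 0 <= a -> reflect (forall j, `|x 0 j| <= a) (`|x| <= a).
Proof.
move=> a0; rewrite [`|x|]mx_normrE; apply: (iffP idP) => [H j|H].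
  by apply: le_trans H; exact: (le_bigmax _ (fun ij : 'I_1 * 'I_d => `|x ij.1 ij.2|) (0, j)).
by apply/bigmax_leP; split => // -[i j] _ /=; rewrite (ord1 i).
Qed.

Lemma coord_le_norm x j : `|x 0 j| <= `|x|.
Proof. by apply/norm_leP. Qed.

Lemma enorm_ge0 x : 0 <= enorm x. Proof. exact: sqrtr_ge0. Qed.

Lemma enorm_sqr x : enorm x ^+ 2 = \sum_j x 0 j ^+ 2.
Proof. by rewrite sqr_sqrtr // sumr_ge0 // => j _; exact: sqr_ge0. Qed.

Lemma coord_le_enorm x j : `|x 0 j| <= enorm x.
Proof.
rewrite -(@ler_pXn2r _ 2) ?nnegrE ?enorm_ge0 // enorm_sqr real_normK ?num_real //.
by rewrite (bigD1 j) //= lerDl sumr_ge0 // => i _; exact: sqr_ge0.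
Qed.

Lemma enorm_le x (a : R) : 0 <= a -> `|x| <= a -> enorm x <= (1 + d%:R) * a.
Proof.
move=> a0 xa; have d0 : 0 <= d%:R :> R by [].
rewrite -(@ler_pXn2r _ 2) ?nnegrE ?enorm_ge0 ?mulr_ge0 ?addr_ge0 // enorm_sqr.
apply: (@le_trans _ _ (\sum_(j < d) a ^+ 2)).
  apply: ler_sum => j _; rewrite -real_normK ?num_real //.
  by rewrite lerXn2r ?nnegrE // (le_trans (coord_le_norm x j)).
rewrite sumr_const card_ord -[leLHS]mulr_natl exprMn ler_wpM2r ?sqr_ge0 //.
rewrite expr2; nra.
Qed.

(** The maximum on the right fits the supremum e^M, which is monotone; the
    triangle inequality would give a sum there. *)
Lemma enormD_le x y : enorm (x + y) <= 2 * Num.max (enorm x) (enorm y).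
Proof.
have [x0 y0] := (enorm_ge0 x, enorm_ge0 y).
have m0 : 0 <= Num.max (enorm x) (enorm y) by rewrite le_max x0.
rewrite -(@ler_pXn2r _ 2) ?nnegrE ?enorm_ge0 ?mulr_ge0 // enorm_sqr.
apply: (@le_trans _ _ (\sum_j (2 * x 0 j ^+ 2 + 2 * y 0 j ^+ 2))).
  apply: ler_sum => j _; rewrite mxE; have := sqr_ge0 (x 0 j - y 0 j).
  by rewrite !expr2; nra.
rewrite big_split /= -!mulr_sumr -!enorm_sqr exprMn.
have xm : enorm x ^+ 2 <= Num.max (enorm x) (enorm y) ^+ 2 by rewrite lerXn2r ?nnegrE // le_max lexx.
have ym : enorm y ^+ 2 <= Num.max (enorm x) (enorm y) ^+ 2 by rewrite lerXn2r ?nnegrE // le_max lexx orbT.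
rewrite (_ : 2 ^+ 2 = 4 :> R); last by ring.
lra.
Qed.

Lemma enormN x : enorm (- x) = enorm x.
Proof. by congr Num.sqrt; apply: eq_bigr => j _; rewrite mxE sqrrN. Qed.

(** [dbound h A g] and [sbound m A g] say that the norm of g in D_(K,h), or in
    S with parameter m, is at most A.  Working with upper bounds avoids
    suprema in the extended reals, and derivatives along words obey a simpler
    Leibniz rule than multi-indices. *)
Definition dbound (h A : R) g := forall s x, cabs (partials s g x) <= A * h ^+ size s * M (size s).

Definition sbound (m A : R) g := forall s x,
  m ^+ size s * assoc_exp M (m * enorm x) * cabs (partials s g x) <= A * M (size s).

(** Supports are measured by the maximum norm, the norm of the topology of row
    vectors: every compact set lies in one of its balls, which are compact. *)
Definition vanish a g := forall x, a < `|x| -> g x = 0.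

Lemma dbound_ge0 h A g : dbound h A g -> 0 <= A.
Proof.
move=> H; have := H [::] 0; rewrite /= expr0 (weight0 hM) !mulr1.
exact: le_trans (cabs_ge0 _).
Qed.

Lemma dbound_mono h k A B g : 0 < h -> h <= k -> A <= B -> dbound h A g -> dbound k B g.
Proof.
move=> h0 hk AB H s x; have A0 := dbound_ge0 H; apply: le_trans (H s x) _.
rewrite ler_pM2r ?(weight_gt0 hM) //.
have h0' := ltW h0; have k0 := le_trans h0' hk.
by apply: ler_pM => //; [rewrite exprn_ge0|rewrite lerXn2r].
Qed.

Lemma dboundZ h A g (c : R[i]) : smooth g -> dbound h A g -> dbound h (cabs c * A) (c *: g).
Proof.
move=> sg H s x; rewrite partialsZ // [_ x]/GRing.scale /= cabsM -!mulrA ler_wpM2l ?cabs_ge0 //.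
by rewrite mulrA.
Qed.

Lemma dboundD h A B g g' : smooth g -> smooth g' -> dbound h A g -> dbound h B g' ->
  dbound h (A + B) (g + g').
Proof.
move=> sg sg' H H' s x; rewrite -[g]scale1r partials_lin // scale1r.
by apply: le_trans (cabsD _ _) _; rewrite -mulrA mulrDl !mulrA lerD.
Qed.

Lemma dboundB h A B g g' : smooth g -> smooth g' -> dbound h A g -> dbound h B g' ->
  dbound h (A + B) (g - g').
Proof.
move=> sg sg' H H'; rewrite -scaleN1r; apply: (dboundD sg (smoothZ (-1) sg') H).
by have := dboundZ (-1) sg' H'; rewrite cabsN cabs1 mul1r.
Qed.

(** The products M_p M_q with p + q = |s| in the Leibniz rule are at most
    M_|s|, and the powers of h and k recombine by the binomial formula.  The
    bounds are only assumed at x: one of the factors will be estimated near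
    one point. *)
Lemma leibniz_bound g g' (h k A B : R) s x : 0 <= h -> 0 <= k -> 0 <= A -> 0 <= B ->
  smooth g -> smooth g' ->
  (forall s, cabs (partials s g x) <= A * h ^+ size s * M (size s)) ->
  (forall s, cabs (partials s g' x) <= B * k ^+ size s * M (size s)) ->
  cabs (partials s (g \* g') x) <= A * B * (h + k) ^+ size s * M (size s).
Proof.
move=> h0 k0 A0 B0 sg sg' H H'; rewrite leibniz // -splits_binomial.
apply: le_trans (cabs_sum _ _ _) _.
rewrite mulr_sumr mulr_suml !big_seq; apply: ler_sum => p /splits_size <-.
rewrite cabsM; apply: le_trans (ler_pM (cabs_ge0 _) (cabs_ge0 _) (H _) (H' _)) _.
rewrite [leLHS](_ : _ = A * B * (h ^+ size p.1 * k ^+ size p.2) * (M (size p.1) * M (size p.2))); last by ring.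
by rewrite ler_wpM2l ?weight_supermul // !mulr_ge0 ?exprn_ge0.
Qed.

Lemma dboundM g g' (h k A B : R) : 0 <= h -> 0 <= k -> smooth g -> smooth g' ->
  dbound h A g -> dbound k B g' -> dbound (h + k) (A * B) (g \* g').
Proof.
move=> h0 k0 sg sg' H H' s x; apply: leibniz_bound => //.
  exact: dbound_ge0 H.
exact: dbound_ge0 H'.
Qed.

Lemma dbound_affine (L : V -> V) (k : 'I_d -> R) (sg : 'I_d -> 'I_d) g h A :
  continuous L ->
  (forall i x (c : R), L (c *: unit_vec R i + x) = (k i * c) *: unit_vec R (sg i) + L x) ->
  (forall i, `|k i| <= 1) -> smooth g -> dbound h A g -> dbound h A (g \o L).
Proof.
move=> cL aL k1 sG H s x; apply: le_trans (partials_affine_le cL aL s x k1 sG) _.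
by have := H (map sg s) (L x); rewrite size_map.
Qed.

Lemma cabs_Dalpha al g x : cabs (Dalpha al g x) = cabs (partial_alpha al g x).
Proof. by rewrite /Dalpha cabsM cabsV cabsX cabsi expr1n invr1 mul1r. Qed.

Lemma D_norm_le K h A g : 0 < h -> dbound h A g -> (D_norm M K h g <= A%:E)%E.
Proof.
move=> h0 H; apply/ereal_supP => _ [al _ <-]; apply/ereal_supP => _ [x _ <-].
have p0 : 0 < h ^+ mlen al * M (mlen al) by rewrite mulr_gt0 ?exprn_gt0 ?(weight_gt0 hM).
rewrite lee_fin ler_pdivrMr // mulrA cabs_Dalpha partial_alphaE -size_alpha_seq.
exact: H.
Qed.

Lemma vanish_closed (K : set V) s g x : smooth g -> supp g `<=` K -> ~ K x ->
  partials s g x = 0.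
Proof.
move=> sg gK Kx; apply: (@partials_vanish _ _ (~` (supp g))) => //.
- by apply: closed_openC; exact: closed_closure.
- move=> y ny; apply/eqP/negPn/negP => gy; apply: ny.
  by apply: subset_closure.
- by move=> /gK.
Qed.

Lemma D_norm_bound K h A g : 0 < h -> 0 <= A -> smooth g -> supp g `<=` K ->
  (D_norm M K h g <= A%:E)%E -> dbound h A g.
Proof.
move=> h0 A0 sg gK /ereal_supP H s x.
have [al sal Eal] := partials_alpha s sg.
have p0 : 0 < h ^+ mlen al * M (mlen al) by rewrite mulr_gt0 ?exprn_gt0 ?(weight_gt0 hM).
have [Kx|nKx] := pselect (K x); last first.
  rewrite (vanish_closed _ sg gK nKx) cabs0 -mulrA mulr_ge0 // sal ltW //.
have /ereal_supP/(_ (cabs (Dalpha al g x) / (h ^+ mlen al * M (mlen al)))%:E) := H _ (ex_intro2 _ _ al I erefl).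
by move=> /(_ (ex_intro2 _ _ x Kx erefl)); rewrite lee_fin ler_pdivrMr // mulrA cabs_Dalpha Eal sal.
Qed.

Lemma D_norm_fin K h g : 0 < h -> smooth g -> supp g `<=` K ->
  (D_norm M K h g < +oo)%E -> exists A, dbound h A g.
Proof.
move=> h0 sg gK H; exists (Num.max 0 (fine (D_norm M K h g))).
apply: (@D_norm_bound K) => //; first by rewrite le_max lexx.
by case: (D_norm M K h g) H => [r _| |] //=; rewrite ?lee_fin ?leNye // le_max lexx orbT.
Qed.

Lemma sbound_ge0 m A g : 0 < m -> sbound m A g -> 0 <= A.
Proof.
move=> m0 H; have := H [::] 0; rewrite /= expr0 (weight0 hM) mulr1 mul1r; apply: le_trans.
by rewrite mulr_ge0 ?cabs_ge0 // ltW // assoc_exp_gt0.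
Qed.

Lemma S_norm_le m A g : 0 < m -> sbound m A g -> (S_norm M m g <= A%:E)%E.
Proof.
move=> m0 H; apply/ereal_supP => _ [al _ <-].
set n := mlen al; have mn : 0 < m ^+ n by rewrite exprn_gt0.
have Mn : 0 < M n by exact: weight_gt0.
have le : (ereal_sup [set (cabs ((expR (assoc_fun M (m * enorm x)))%:C%C
          * Dalpha al g x))%:E | x in [set: 'rV[R]_d]] <= (A * M n / m ^+ n)%:E)%E.
  apply/ereal_supP => _ [x _ <-]; rewrite lee_fin ler_pdivlMr // cabsM cabsR cabs_Dalpha.
  rewrite ger0_norm ?expR_ge0 // mulrC mulrA partial_alphaE /n -size_alpha_seq.
  exact: H.
apply: (@le_trans _ _ ((m ^+ n)%:E * (A * M n / m ^+ n)%:E * ((M n)^-1)%:E)%E).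
  rewrite lee_pmul2r ?lte_fin ?invr_gt0 //.
  by rewrite lee_pmul2l ?lte_fin.
rewrite -!EFinM lee_fin le_eqVlt; apply/orP; left; apply/eqP; field.
by rewrite !gt_eqF.
Qed.

Lemma S_norm_bound m A g : 0 < m -> smooth g -> (S_norm M m g <= A%:E)%E -> sbound m A g.
Proof.
move=> m0 sg /ereal_supP H s x.
have [al sal Eal] := partials_alpha s sg.
have Mn : 0 < M (mlen al) by exact: weight_gt0.
set c := cabs ((expR (assoc_fun M (m * enorm x)))%:C%C * Dalpha al g x).
have Ec : c = assoc_exp M (m * enorm x) * cabs (partials s g x).
  by rewrite /c cabsM cabsR cabs_Dalpha Eal (ger0_norm (expR_ge0 _)).
have le1 : (c%:E <= ereal_sup [set (cabs ((expR (assoc_fun M (m * enorm x)))%:C%C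
    * Dalpha al g x))%:E | x in [set: 'rV[R]_d]])%E.
  by apply: ereal_sup_ubound; exists x.
have mE : (0 <= (m ^+ mlen al)%:E)%E by rewrite lee_fin exprn_ge0 // ltW.
have ME : (0 <= ((M (mlen al))^-1)%:E)%E by rewrite lee_fin invr_ge0 ltW.
have := le_trans (lee_wpmul2r ME (lee_wpmul2l mE le1)) (H _ (ex_intro2 _ _ al I erefl)).
by rewrite -!EFinM lee_fin ler_pdivrMr // Ec mulrA sal.
Qed.

Lemma S_norm_fin m g : 0 < m -> smooth g -> (S_norm M m g < +oo)%E -> exists A, sbound m A g.
Proof.
move=> m0 sg H; exists (fine (S_norm M m g)); apply: S_norm_bound => //.
by case: (S_norm M m g) H => [r _| |] //=; rewrite leNye.
Qed.

(** * Membership in D and S by explicit bounds *)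

(** The index h of the limits defining D: every h counts in the projective
    limit of the Beurling case, some h in the inductive limit of the Roumieu
    case. *)
Definition good (b : star) (P : R -> Prop) :=
  match b with
  | Beurling => forall h, 0 < h -> P h
  | Roumieu => exists2 h, 0 < h & P h
  end.

Lemma good1 b (P Q : R -> Prop) :
  (forall h, 0 < h -> P h -> Q h) -> good b P -> good b Q.
Proof.
by case: b => /= PQ; [move=> H h h0; apply: PQ => //; exact: H|case=> h h0 Ph; exists h => //; exact: PQ].
Qed.

(** The two cases are treated at once whenever parameters add up: an arbitrary
    h is split in two halves, or two given ones are added. *)
Lemma good2 b (P Q T : R -> Prop) :
  (forall h k, 0 < h -> 0 < k -> P h -> Q k -> T (h + k)) -> good b P -> good b Q -> good b T.
Proof.
case: b => /= PQ.
  move=> HP HQ h h0; have h2 : 0 < h / 2 by lra.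
  by rewrite (splitr h); apply: PQ => //; [exact: HP|exact: HQ].
by move=> [h h0 Ph] [k k0 Qk]; exists (h + k); [exact: addr_gt0|exact: PQ].
Qed.

Definition gevrey b g := good b (fun h => exists A, dbound h A g).

Definition test b a g := [/\ smooth g, vanish a g & gevrey b g].

Lemma vanish_supp a g : vanish a g -> supp g `<=` [set x | `|x| <= a].
Proof.
move=> va x; rewrite -[X in _ -> X]/([set x | `|x| <= a] x).
have -> : [set x : V | `|x| <= a] = closure [set x | `|x| <= a].
  apply/closure_id; apply: (@closed_comp _ _ (fun x : V => `|x|) [set r | r <= a]).
    by move=> y _; exact: norm_continuous.
  exact: closed_le.
apply: closure_subset => y /= /eqP gy; rewrite leNgt; apply/negP => /va //.
Qed.

Lemma compact_ball a : compact [set x : V | `|x| <= a].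
Proof.
apply: bounded_closed_compact.
  by exists a; split; [exact: num_real|move=> b ab x /= xa; exact: le_trans xa (ltW ab)].
apply: (@closed_comp _ _ (fun x : V => `|x|) [set r | r <= a]).
  by move=> y _; exact: norm_continuous.
exact: closed_le.
Qed.

Lemma supp_vanish (K : set V) g : compact K -> supp g `<=` K -> exists2 a, 0 < a & vanish a g.
Proof.
move=> /compact_bounded [b [_ Hb]] gK; exists (`|b| + 1); first by rewrite ltr_pwDr.
move=> x xb; apply/eqP/negPn/negP => gx.
have Kx : K x by apply: gK; exact: subset_closure.
have bb : b < `|b| + 1 by rewrite (le_lt_trans (ler_norm b)) // ltrDl.
have /= := Hb _ bb x Kx.
by rewrite leNgt xb.
Qed.

Lemma D_carrierP b g : carrier (D_space d M b) g <-> exists a, test b a g.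
Proof.
split.
- case: b => -[K /= cK H].
    have [[sg gK] _] := H 1 ltr01.
    have [a a0 va] := supp_vanish cK gK; exists a; split => // h h0.
    by have [_ ?] := H h h0; exact: (@D_norm_fin K).
  have [h h0 [[sg gK] fin]] := H.
  have [a a0 va] := supp_vanish cK gK; exists a; split => //; exists h => //.
  exact: (@D_norm_fin K).
case=> a [sg va gv]; exists [set x | `|x| <= a]; first exact: compact_ball.
have gK := vanish_supp va.
case: b gv => /= gv.
  move=> h h0; split=> //; have [A HA] := gv h h0.
  exact: le_lt_trans (D_norm_le _ h0 HA) (ltry _).
have [h h0 [A HA]] := gv; exists h => //; split=> //.
exact: le_lt_trans (D_norm_le _ h0 HA) (ltry _).
Qed.

(** The parameter of S is m = 1 / h, so that the index h of D and of S runs in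
    the same direction and [good] describes both. *)
Definition sfun b g := smooth g /\ good b (fun h => exists A, sbound h^-1 A g).

Lemma S_carrierP b g : carrier (S_space d M b) g <-> sfun b g.
Proof.
case: b; split => /=.
- move=> H; have [sg _] := H 1 ltr01; split => // h h0.
  have hi : 0 < h^-1 by rewrite invr_gt0.
  by have [_ ?] := H h^-1 hi; exact: S_norm_fin.
- move=> [sg H] m m0; split => //.
  have mi : 0 < m^-1 by rewrite invr_gt0.
  have [A] := H m^-1 mi; rewrite invrK => HA.
  exact: le_lt_trans (S_norm_le m0 HA) (ltry _).
- case=> m m0 [sg fin]; split => //; exists m^-1; first by rewrite invr_gt0.
  by rewrite invrK; exact: S_norm_fin.
- case=> sg [h h0 [A HA]]; have hi : 0 < h^-1 by rewrite invr_gt0.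
  exists h^-1 => //; split => //; exact: le_lt_trans (S_norm_le hi HA) (ltry _).
Qed.

End Spaces.

(** * Linear functionals and continuity *)

Section Duality.
Variables (R : realType) (d : nat) (M : nat -> R).
Hypothesis hM : weight_sequence M.
Local Notation V := 'rV[R]_d.
Local Notation F := (V -> R[i]).
Implicit Types (g : F) (a m : R) (s t : seq 'I_d) (x y : V) (b : star).

Definition lin_closed (T : F -> Prop) :=
  T 0 /\ forall c g g', T g -> T g' -> T (c *: g + g').

Definition linear_on (T : F -> Prop) (f : F -> R[i]) :=
  forall c g g', T g -> T g' -> f (c *: g + g') = c * f g + f g'.

Section LinearOn.
Variables (T : F -> Prop) (f : F -> R[i]).
Hypotheses (cT : lin_closed T) (lf : linear_on T f).

Lemma linear_on0 : f 0 = 0.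
Proof.
have [T0 _] := cT; have := lf 1 T0 T0; rewrite scale1r addr0 mul1r => /eqP.
by rewrite addrC -subr_eq subrr eq_sym => /eqP.
Qed.

Lemma linear_onZ c g : T g -> f (c *: g) = c * f g.
Proof. by have [T0 _] := cT; move=> Tg; rewrite -[c *: g]addr0 lf // linear_on0 addr0. Qed.

Lemma linear_onD g g' : T g -> T g' -> f (g + g') = f g + f g'.
Proof. by move=> Tg Tg'; rewrite -[g]scale1r lf // scale1r mul1r. Qed.

Lemma linear_onB g g' : T g -> T g' -> f (g - g') = f g - f g'.
Proof. by move=> Tg Tg'; rewrite addrC -scaleN1r lf // mulN1r addrC. Qed.

Lemma lin_closedB g g' : T g -> T g' -> T (g - g').
Proof. by case: cT => _ H Tg Tg'; rewrite addrC -scaleN1r; exact: H. Qed.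

Lemma lin_closedZ c g : T g -> T (c *: g).
Proof. by case: cT => T0 H Tg; rewrite -[_ *: _]addr0; exact: H. Qed.

Lemma lin_closed_sum (I : Type) (r : seq I) (P : pred I) (G : I -> F) :
  (forall n, T (G n)) -> T (\sum_(n <- r | P n) G n).
Proof.
case: cT => T0 H TG; elim/big_rec: _ => // n k _ Tk.
by rewrite -[G n]scale1r; exact: H.
Qed.

Lemma linear_on_sum (I : Type) (r : seq I) (P : pred I) (G : I -> F) :
  (forall n, T (G n)) -> f (\sum_(n <- r | P n) G n) = \sum_(n <- r | P n) f (G n).
Proof.
move=> TG; elim: r => [|n r IH]; first by rewrite !big_nil linear_on0.
rewrite !big_cons; case: ifP => // _; rewrite linear_onD ?IH //.
exact: lin_closed_sum.
Qed.

(** Continuity bounds f on a ball only; rescaling g to that ball gives a bound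
    proportional to the norm.  [P A g] is read as a norm of g being at most
    A. *)
Lemma homogeneous_bound (P : R -> F -> Prop) (dl A : R) g :
  (forall c B g, T g -> P B g -> P (cabs c * B) (c *: g)) -> 0 < dl ->
  (forall B g, T g -> B <= dl -> P B g -> cabs (f g) <= 1) ->
  T g -> 0 <= A -> P A g -> cabs (f g) <= dl^-1 * A.
Proof.
move=> PZ dl0 Hf Tg A0 PA; apply/ler_addgt0Pr => e e0.
(* A may vanish, hence the rescaling by an eta slightly larger than A *)
pose eta := A + dl * e; have eta0 : 0 < eta by rewrite ltr_wpDl // mulr_gt0.
pose c := dl / eta; have c0 : 0 < c by rewrite divr_gt0.
have : cabs (f (c%:C%C *: g)) <= 1.
  apply: (Hf (cabs c%:C%C * A)); [exact: lin_closedZ| |exact: PZ].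
  rewrite cabsR gtr0_norm // /c mulrAC ler_pdivrMr // ler_pM2l // lerDl.
  by rewrite mulr_ge0 // ltW.
rewrite linear_onZ // cabsM cabsR gtr0_norm // mulrC -ler_pdivlMr // div1r invf_div.
move=> /le_trans; apply.
by rewrite /eta mulrDl mulrAC divff ?gt_eqF // mul1r mulrC.
Qed.

End LinearOn.

Lemma gevrey_lin b c g g' : smooth g -> smooth g' -> gevrey M b g -> gevrey M b g' ->
  gevrey M b (c *: g + g').
Proof.
move=> sg sg'; apply: good2 => h k h0 k0 [A HA] [B HB]; exists (cabs c * A + B).
apply: (dboundD (smoothZ c sg) sg').
  apply: (dboundZ c sg); apply: (dbound_mono hM h0 _ (lexx A) HA); rewrite lerDl; exact: ltW.
apply: (dbound_mono hM k0 _ (lexx B) HB); rewrite lerDr; exact: ltW.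
Qed.

Lemma gevrey0 b : gevrey M b (0 : F).
Proof.
have H (h : R) : dbound M h 0 (0 : F) by move=> s x; rewrite partials0 cabs0 !mul0r.
by case: b => [h h0|]; [exists 0|exists 1 => //; exists 0].
Qed.

Definition tests b g := exists a, test M b a g.

Lemma vanish_le a a' g : a <= a' -> vanish a g -> vanish a' g.
Proof. by move=> aa va x /(le_lt_trans aa)/va. Qed.

Lemma tests_closed b : lin_closed (tests b).
Proof.
split; first by exists 0; split => //; [exact: smooth0|exact: gevrey0].
move=> c g g' [a [sg va gg]] [a' [sg' va' gg']]; exists (Num.max a a'); split.
- exact: smooth_lin.
- move=> x; rewrite gt_max => /andP[xa xa']; rewrite !fctE /= va // va' //.
  by rewrite scaler0 addr0.
- exact: gevrey_lin.
Qed.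

Lemma sbound_mono m m' A B g : 0 < m -> m <= m' -> A <= B -> sbound M m' A g -> sbound M m B g.
Proof.
move=> m0 mm AB H s x; have m0' := lt_le_trans m0 mm.
have Mn := weight_gt0 hM (size s).
apply: (@le_trans _ _ (A * M (size s))); last by rewrite ler_pM2r.
apply: le_trans (H s x); apply: ler_wpM2r; first exact: cabs_ge0.
apply: ler_pM; rewrite ?exprn_ge0 ?(ltW m0) ?(ltW (assoc_exp_gt0 _ _)) //.
  by rewrite lerXn2r // nnegrE ltW.
apply: assoc_exp_mono; first exact: weight_adm.
  by rewrite mulr_ge0 ?enorm_ge0 // ltW.
by rewrite ler_wpM2r ?enorm_ge0.
Qed.

Lemma sboundZ m A g (c : R[i]) : smooth g -> sbound M m A g -> sbound M m (cabs c * A) (c *: g).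
Proof.
move=> sg H s x; rewrite partialsZ // -[(c *: _) x]/(c * partials s g x) cabsM mulrCA -[leRHS]mulrA.
by rewrite ler_wpM2l ?cabs_ge0.
Qed.

Lemma sboundD m A B g g' : 0 < m -> smooth g -> smooth g' -> sbound M m A g -> sbound M m B g' ->
  sbound M m (A + B) (g + g').
Proof.
move=> m0 sg sg' H H' s x; rewrite -[g]scale1r partials_lin // scale1r.
have w0 : 0 <= m ^+ size s * assoc_exp M (m * enorm x).
  by rewrite mulr_ge0 ?exprn_ge0 ?(ltW m0) ?(ltW (assoc_exp_gt0 _ _)).
apply: le_trans (ler_wpM2l w0 (cabsD _ _)) _.
by rewrite mulrDr mulrDl lerD.
Qed.

Lemma sfun_closed b : lin_closed (sfun M b).
Proof.
split.
  split; first exact: smooth0.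
  have H (m : R) : sbound M m 0 (0 : F) by move=> s x; rewrite partials0 cabs0 mulr0 mul0r.
  by case: b => [h h0|]; [exists 0|exists 1 => //; exists 0].
move=> c g g' [sg Hg] [sg' Hg']; split; first exact: smooth_lin.
move: Hg Hg'; apply: good2 => h k h0 k0 [A HA] [B HB]; exists (cabs c * A + B).
have hk : 0 < (h + k)^-1 by rewrite invr_gt0 addr_gt0.
apply: sboundD; [exact: hk|exact: smoothZ|exact: sg'| |].
  apply: sboundZ; first exact: sg.
  apply: (sbound_mono hk _ (lexx A) HA).
  by rewrite lef_pV2 ?posrE ?addr_gt0 // lerDl ltW.
apply: (sbound_mono hk _ (lexx B) HB).
by rewrite lef_pV2 ?posrE ?addr_gt0 // lerDr ltW.
Qed.

(** * Continuity by explicit bounds *)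

(** The quantifier dual to [good]: a functional is continuous on a projective
    limit when it is for one of the norms, on an inductive limit when it is
    for each of them. *)
Definition cogood b (P : R -> Prop) :=
  match b with
  | Beurling => exists2 h, 0 < h & P h
  | Roumieu => forall h, 0 < h -> P h
  end.

(** A neighbourhood in a projective limit restricts finitely many norms; the
    smallest of their indices serves for all of them, since the norms
    decrease in h. *)
Lemma finite_meet (s : seq R) (Q : R -> R -> R -> Prop) :
  (forall i h h' dl dl', 0 < h' -> h' <= h -> dl' <= dl -> Q i h dl -> Q i h' dl') ->
  (forall i, i \in s -> exists h dl, [/\ 0 < h, 0 < dl & Q i h dl]) ->
  exists h dl, [/\ 0 < h, 0 < dl & forall i, i \in s -> Q i h dl].
Proof.
move=> mono; elim: s => [|i s IH] H; first by exists 1, 1.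
have [h [dl [h0 dl0 Hs]]] := IH (fun j js => H j (mem_behead (s := i :: s) js)).
have [h' [dl' [h0' dl0' Hi]]] := H i (mem_head _ _).
have m0 : 0 < Num.min h h' by rewrite lt_min h0.
exists (Num.min h h'), (Num.min dl dl'); split => //; first by rewrite lt_min dl0.
move=> j; rewrite inE => /orP[/eqP ->|/Hs Qj].
  by apply: mono Hi; rewrite ?m0 // ge_min lexx orbT.
by apply: mono Qj; rewrite ?m0 // ge_min lexx.
Qed.

Lemma D_Kh_nbhs a h U : 0 < h -> nbhs0 (D_Kh M [set x : V | `|x| <= a] h) U ->
  exists2 dl : R, 0 < dl & forall g, smooth g -> vanish a g -> dbound M h dl g -> U g.
Proof.
move=> h0 [e /= e0 HU]; exists (e / 2); first lra.
move=> g sg va dg; apply: HU; have le := D_norm_le hM [set x | `|x| <= a] h0 dg.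
split; first split.
- by split => //; exact: vanish_supp.
- exact: le_lt_trans le (ltry _).
- by apply: le_lt_trans le _; rewrite lte_fin; lra.
Qed.

(** Unfolding the limit topologies, some ball of one norm (each norm, in the
    Roumieu case) is mapped into the unit disc; homogeneity turns this into a
    bound. *)
Lemma D_dual b f : cdual (D_space d M b) f -> linear_on (tests b) f /\
  forall a, cogood b (fun h => exists C, forall g A, test M b a g -> dbound M h A g ->
    cabs (f g) <= C * A).
Proof.
move=> [lf cf]; have lin : linear_on (tests b) f.
  by move=> c g g' Tg Tg'; apply: lf; apply/(D_carrierP hM).
split=> // a.
have key h dl : 0 < h -> 0 < dl ->
    (forall g, test M b a g -> dbound M h dl g -> cabs (f g) < 1) ->
    exists C, forall g A, test M b a g -> dbound M h A g -> cabs (f g) <= C * A.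
  move=> h0 dl0 H; exists dl^-1 => g A Tg dg.
  have PZ c B (k : F) : test M b a k /\ dbound M h B k -> test M b a (c *: k) /\ dbound M h (cabs c * B) (c *: k).
    move=> [[sk vk gk] dk]; split; last exact: dboundZ.
    split; [exact: smoothZ|by move=> x /vk xk; rewrite !fctE xk scaler0|].
    rewrite -[c *: k]addr0; by apply: (gevrey_lin c sk _ gk); [exact: smooth0|exact: gevrey0].
  apply: (homogeneous_bound (tests_closed b) lin (P := fun B k => test M b a k /\ dbound M h B k)) => //.
  - by move=> c B k _; exact: PZ.
  - move=> B k _ Bdl [tk dk]; apply/ltW/H => //; exact: dbound_mono dk.
  - by exists a.
  - exact: dbound_ge0 dg.
have [W [cW HW WU]] := cf 1 ltr01.
have := HW _ (@compact_ball R d a).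
case: b lf cf lin key W cW HW WU => lf cf lin key W cW HW WU /=.
  move=> [s [U [Us HU]]].
  have [h [dl [h0 dl0 Hs]]] : exists h dl, [/\ 0 < h, 0 < dl & forall i, i \in s ->
      forall g, smooth g -> vanish a g -> dbound M h dl g -> U i g].
    apply: finite_meet => [i h h' dl dl' h0 hh dd H g sg vg dg|i si].
      by apply: H => //; exact: dbound_mono dg.
    have [i0 Ui] := Us i si; have [dl dl0 H] := D_Kh_nbhs i0 Ui.
    by exists i, dl.
  exists h => //; apply: (key h dl) => // g [sg vg gg] dg.
  apply: WU; apply: HU; split=> [i i0|i si]; last exact: Hs.
  have [A HA] := gg i i0; split; first by split => //; exact: vanish_supp.
  exact: le_lt_trans (D_norm_le hM _ i0 HA) (ltry _).
move=> [W' [cW' HW' WW']] h h0.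
have [dl dl0 H] := D_Kh_nbhs h0 (HW' h h0).
apply: (key h dl) => // g [sg vg gg] dg.
by apply: WU; apply: WW'; exact: H.
Qed.

Lemma S_m_nbhs m U : 0 < m -> nbhs0 (S_m d M m) U ->
  exists2 dl : R, 0 < dl & forall g, smooth g -> sbound M m dl g -> U g.
Proof.
move=> m0 [e /= e0 HU]; exists (e / 2); first lra.
move=> g sg dg; apply: HU; have le := S_norm_le hM m0 dg.
split; first split => //.
- exact: le_lt_trans le (ltry _).
- by apply: le_lt_trans le _; rewrite lte_fin; lra.
Qed.

Lemma S_dual b u : cdual (S_space d M b) u -> linear_on (sfun M b) u /\
  cogood b (fun h => exists C, forall g A, sfun M b g -> sbound M h^-1 A g ->
    cabs (u g) <= C * A).
Proof.
move=> [lf cf]; have lin : linear_on (sfun M b) u.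
  by move=> c g g' Tg Tg'; apply: lf; apply/(S_carrierP hM).
split=> //.
have key h dl : 0 < h -> 0 < dl ->
    (forall g, sfun M b g -> sbound M h^-1 dl g -> cabs (u g) < 1) ->
    exists C, forall g A, sfun M b g -> sbound M h^-1 A g -> cabs (u g) <= C * A.
  move=> h0 dl0 H; have hi : 0 < h^-1 by rewrite invr_gt0.
  exists dl^-1 => g A Tg dg.
  apply: (homogeneous_bound (sfun_closed b) lin (P := fun B k => sbound M h^-1 B k)) => //.
  - by move=> c B k [sk _]; exact: sboundZ.
  - move=> B k tk Bdl dk; apply/ltW/H => //; exact: sbound_mono dk.
  - exact: sbound_ge0 dg.
case: b lf cf lin key => lf cf lin key /=.
  have [s [U [Us HU]]] := cf 1 ltr01.
  have [h [dl [h0 dl0 Hs]]] : exists h dl, [/\ 0 < h, 0 < dl & forall i, i \in s ->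
      forall g, smooth g -> sbound M h^-1 dl g -> U i g].
    apply: finite_meet => [i h h' dl dl' h0 hh dd H g sg dg|i si].
      apply: H => //; apply: sbound_mono dg; rewrite ?invr_gt0 ?(lt_le_trans h0) //.
      by rewrite lef_pV2 // posrE // (lt_le_trans h0).
    have [i0 Ui] := Us i si; have [dl dl0 H] := S_m_nbhs i0 Ui.
    by exists i^-1, dl; rewrite invrK invr_gt0.
  exists h => //; apply: (key h dl) => // g Tg dg.
  have [sg _] := Tg.
  apply: HU; split=> [i i0|i si]; last exact: Hs.
  by have /(S_carrierP hM) /= := Tg; apply.
move=> h h0; have [W [cW HW WU]] := cf 1 ltr01.
have hi : 0 < h^-1 by rewrite invr_gt0.
have [dl dl0 H] := S_m_nbhs hi (HW _ hi).
apply: (key h dl) => // g [sg gg] dg.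
by apply: WU; exact: H.
Qed.

(** In the Roumieu case the trace of the set where |u| < e on each step of the
    inductive limit is a neighbourhood, and the set is absolutely convex. *)
Lemma S_dual_intro b u : linear_on (sfun M b) u ->
  cogood b (fun h => exists C, forall g A, sfun M b g -> sbound M h^-1 A g ->
    cabs (u g) <= C * A) -> cdual (S_space d M b) u.
Proof.
move=> lu bu; split.
  by move=> c g g' /(S_carrierP hM) Tg /(S_carrierP hM) Tg'; exact: lu.
move=> e e0.
have small C h g : 0 < h -> smooth g -> (S_norm M h^-1 g < (e / (2 * (1 + `|C|)))%:E)%E ->
    (forall A, sbound M h^-1 A g -> cabs (u g) <= C * A) -> cabs (u g) < e.
  move=> h0 sg nrm H; have C0 : 0 < 1 + `|C| by rewrite ltr_pwDl.
  have hi : 0 < h^-1 by rewrite invr_gt0.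
  have dg := S_norm_bound hM hi sg (ltW nrm).
  apply: le_lt_trans (H _ dg) _; have A0 := sbound_ge0 hM hi dg.
  apply: (@le_lt_trans _ _ ((1 + `|C|) * (e / (2 * (1 + `|C|))))).
    by apply: ler_wpM2r => //; apply: le_trans (ler_norm C) _; rewrite lerDr.
  rewrite [ltLHS](_ : _ = e / 2); last by field; rewrite gt_eqF.
  lra.
case: b lu bu => lu bu.
  have [h h0 [C HC]] := bu; have hi : 0 < h^-1 by rewrite invr_gt0.
  exists [:: h^-1], (fun _ => [set g | smooth g /\ (S_norm M h^-1 g < (e / (2 * (1 + `|C|)))%:E)%E]).
  have e2 : 0 < e / (2 * (1 + `|C|)) by rewrite divr_gt0 // mulr_gt0 // ltr_pwDl.
  split.
    move=> i; rewrite inE => /eqP ->; split => //.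
    exists (e / (2 * (1 + `|C|))) => //= g [[sg _] nrm]; split => //.
  move=> g /= [Tg /(_ _ (mem_head _ _))[sg nrm]].
  apply: (small C h) => // A dg; apply: HC => //.
  by apply/(S_carrierP hM).
exists [set g | sfun M Roumieu g /\ cabs (u g) < e]; split.
- move=> c c' g g' [Tg ug] [Tg' ug'] cc.
  have [T0 Tl] := sfun_closed Roumieu.
  have Tc' := lin_closedZ (sfun_closed Roumieu) c' Tg'.
  split; first exact: Tl.
  rewrite lu // (linear_onZ (sfun_closed Roumieu) lu c' Tg').
  apply: le_lt_trans (cabsD _ _) _; rewrite !cabsM.
  pose mx := Num.max (cabs (u g)) (cabs (u g')).
  apply: (@le_lt_trans _ _ ((cabs c + cabs c') * mx)).
    by rewrite mulrDl; apply: lerD; apply: ler_wpM2l; rewrite ?cabs_ge0 // le_max lexx ?orbT.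
  apply: (@le_lt_trans _ _ mx); last by rewrite gt_max ug.
  by rewrite ler_piMl // le_max cabs_ge0.
- move=> m /= m0; have mi : 0 < m^-1 by rewrite invr_gt0.
  have [C HC] := bu m^-1 mi.
  have e2 : 0 < e / (2 * (1 + `|C|)) by rewrite divr_gt0 // mulr_gt0 // ltr_pwDl.
  exists (e / (2 * (1 + `|C|))) => //= g [[sg fin] nrm].
  have Tg : sfun M Roumieu g by apply/(S_carrierP hM); exists m.
  split; first exact: Tg.
  apply: (small C m^-1 g mi sg); first by rewrite invrK.
  by move=> A dg; apply: HC; [exact: Tg|exact: dg].
- by move=> g [].
Qed.

End Duality.


(** * Necessity of the growth condition *)

Section Necessity.
Variables (R : realType) (d : nat) (M : nat -> R).
Hypothesis hM : weight_sequence M.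
Local Notation V := 'rV[R]_d.
Local Notation F := (V -> R[i]).
Implicit Types (g : F) (a m : R) (s : seq 'I_d) (t x y : V) (b : star).

Definition refl x g : F := fun t => g (x - t).

Lemma refl_cont x : continuous (fun t : V => x - t).
Proof. by move=> t; apply: continuousB; [exact: cst_continuous|exact: cvg_id]. Qed.

Lemma refl_aff x (i : 'I_d) t (c : R) :
  x - (c *: unit_vec R i + t) = (-1 * c) *: unit_vec R i + (x - t).
Proof. by rewrite opprD addrCA mulN1r scaleNr. Qed.

Lemma smooth_refl x g : smooth g -> smooth (refl x g).
Proof. exact: (smooth_affine (refl_cont (x := x)) (refl_aff x)). Qed.

Lemma dbound_refl x h A g : smooth g -> dbound M h A g -> dbound M h A (refl x g).
Proof.
move=> sg; apply: (dbound_affine (refl_cont (x := x)) (refl_aff x)) => // _.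
by rewrite normrN normr1.
Qed.

Lemma vanish_refl x a g : vanish a g -> vanish (a + `|x|) (refl x g).
Proof.
move=> va t xt; apply: va; rewrite -(ltrD2r `|x|); apply: lt_le_trans xt _.
by rewrite -lerBlDr distrC; exact: lerB_dist.
Qed.

Lemma test_refl b x a g : test M b a g -> test M b (a + `|x|) (refl x g).
Proof.
move=> [sg va gg]; split; [exact: smooth_refl|exact: vanish_refl|].
by apply: good1 gg => h h0 [A HA]; exists A; exact: dbound_refl.
Qed.

Lemma partials_vanish_out a s g x : smooth g -> vanish a g -> a < `|x| -> partials s g x = 0.
Proof.
move=> sg va; apply: (@partials_vanish _ _ [set x | a < `|x|]) => //.
apply: (@open_comp _ _ (fun x : V => `|x|) [set r | a < r]).
  by move=> y _; exact: norm_continuous.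
exact: open_gt.
Qed.

(** On the support of g(x - t) one has |t| <= 2 max(|x|, r) with r the radius
    of the support of g, so the weight of S at t is at most the weight at 2|x|
    times a constant.  The factor 1 + d compares the Euclidean and the maximum
    norm. *)
Lemma sbound_refl x h k a A g : 0 < h -> h <= k -> 0 <= a -> smooth g -> vanish a g ->
  dbound M h A g ->
  sbound M k^-1 (A * assoc_exp M (2 * (1 + d%:R) * a / k) * assoc_exp M (2 / k * enorm x)) (refl x g).
Proof.
move=> h0 hk a0 sg va dg s t; have k0 := lt_le_trans h0 hk.
have ki : 0 < k^-1 by rewrite invr_gt0.
have A0 := dbound_ge0 hM dg; have Mn := weight_gt0 hM (size s).
have aM := weight_adm hM.
set E1 := assoc_exp M (_ / k); set E2 := assoc_exp M (2 / k * _).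
have E10 : 0 < E1 := assoc_exp_gt0 _ _; have E20 : 0 < E2 := assoc_exp_gt0 _ _.
have [xt|xt] := ltP a `|x - t|.
  have -> : partials s (refl x g) t = 0.
    apply: cabs_eq0; apply/eqP; rewrite eq_le cabs_ge0 andbT.
    apply: le_trans (partials_affine_le (refl_cont (x := x)) (refl_aff x) s t _ sg) _.
      by move=> _; rewrite normrN normr1.
    by rewrite (partials_vanish_out _ sg va xt) cabs0.
  apply: (@le_trans _ _ 0); first by rewrite cabs0 mulr0.
  apply: mulr_ge0 _ (ltW Mn).
  by apply: mulr_ge0 _ (ltW E20); apply: mulr_ge0 _ (ltW E10).
have et : k^-1 * enorm t <= Num.max (2 / k * enorm x) (2 * (1 + d%:R) * a / k).
  have -> : t = x + (- (x - t)) by rewrite opprB addrCA subrr addr0.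
  apply: (@le_trans _ _ (k^-1 * (2 * Num.max (enorm x) ((1 + d%:R) * a)))).
    rewrite ler_pM2l //; apply: le_trans (enormD_le _ _) _.
    rewrite ler_pM2l // enormN ge_max !le_max lexx /= enorm_le ?orbT //.
  rewrite mulrA [k^-1 * 2]mulrC; have k2 : 0 <= 2 / k by rewrite divr_ge0 // ltW.
  rewrite maxr_pMr // ge_max !le_max lexx /= -!mulrA.
  by apply/orP; right; rewrite le_eqVlt; apply/orP; left; apply/eqP; ring.
have x2 : 0 <= 2 / k * enorm x by rewrite mulr_ge0 ?enorm_ge0 // divr_ge0 // ltW.
have a2 : 0 <= 2 * (1 + d%:R) * a / k by rewrite !mulr_ge0 ?addr_ge0 // ltW.
have El : assoc_exp M (k^-1 * enorm t) <= E2 * E1.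
  apply: le_trans (assoc_exp_max aM x2 a2).
  by apply: assoc_exp_mono et => //; rewrite mulr_ge0 ?enorm_ge0 // ltW.
have D := dbound_refl x sg dg s t.
have kn : 0 < k^-1 ^+ size s by rewrite exprn_gt0.
apply: (@le_trans _ _ (k^-1 ^+ size s * (E2 * E1) * (A * h ^+ size s * M (size s)))).
  apply: ler_pM; [|exact: cabs_ge0|by rewrite ler_pM2l|exact: D].
  exact: mulr_ge0 (ltW kn) (ltW (assoc_exp_gt0 _ _)).
rewrite [leLHS](_ : _ = (k^-1 * h) ^+ size s * (A * E1 * E2 * M (size s))); last first.
  by rewrite exprMn; ring.
rewrite ler_piMl // ?mulr_ge0 ?(ltW E10) ?(ltW E20) ?(ltW Mn) // exprn_ile1 //.
  by rewrite mulr_ge0 // ltW.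
by rewrite mulrC ler_pdivrMr // mul1r.
Qed.

Lemma refl0K g : refl 0 (refl 0 g) = g.
Proof. by apply/funext => t; rewrite /refl !sub0r opprK. Qed.

Lemma vanish_nonneg a g : vanish a g -> vanish (Num.max 0 a) g.
Proof. by apply: vanish_le; rewrite le_max lexx orbT. Qed.

(** Reflecting twice at the origin makes this the case x = 0 of the estimate
    for reflected functions. *)
Lemma test_sfun b a g : test M b a g -> sfun M b g.
Proof.
move=> [sg va gg]; split => //; apply: good1 gg => h h0 [A HA].
have a0 : 0 <= Num.max 0 (a + `|0 : V|) by rewrite le_max lexx.
have sr := smooth_refl 0 sg; have dr := dbound_refl 0 sg HA.
have vr := vanish_nonneg (vanish_refl (x := 0) va).
by rewrite -[g]refl0K; eexists; exact: (sbound_refl 0 h0 (lexx h) a0 sr vr dr).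
Qed.

Lemma growth_fin (W : V -> R) (v : V -> R) (B : R) :
  (forall x, v x <= B * expR (W x)) ->
  (ereal_sup [set (expR (- W x) * v x)%:E | x in [set: V]] < +oo)%E.
Proof.
move=> H; apply: (@le_lt_trans _ _ B%:E); last exact: ltry.
apply/ereal_supP => _ [x _ <-]; rewrite lee_fin expRN mulrC ler_pdivrMr ?expR_gt0 //.
Qed.

Lemma growth_bound (W : V -> R) (v : V -> R) :
  (ereal_sup [set (expR (- W x) * v x)%:E | x in [set: V]] < +oo)%E ->
  exists B, forall x, v x <= B * expR (W x).
Proof.
move=> H; set S := ereal_sup _ in H.
have le x : ((expR (- W x) * v x)%:E <= S)%E by apply: ereal_sup_ubound; exists x.
exists (fine S) => x; rewrite -ler_pdivrMr ?expR_gt0 // -expRN mulrC.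
have := le x; move: H; case: S {le} => [r _| |] //=.
Qed.

(** (f * phi)(x) is u applied to t |-> phi(x - t), so one norm of S that
    dominates u gives the growth of the convolution. *)
Lemma necessity_Beurling f : in_S' M Beurling f ->
  exists2 lambda : R, 0 < lambda &
    forall phi, carrier (D_space d M Beurling) phi ->
      (ereal_sup [set (expR (- assoc_fun M (lambda * enorm x))
         * cabs (convolution f phi x))%:E | x in [set: V]] < +oo)%E.
Proof.
move=> [u cu uf]; have [lu [k k0 [C HC]]] := S_dual hM cu.
exists (2 / k); first by rewrite divr_gt0.
move=> phi /(D_carrierP hM)[a tphi]; have [sp vp gp] := tphi.
have [A HA] := gp k k0.
apply: (@growth_fin _ _ (C * (A * assoc_exp M (2 * (1 + d%:R) * Num.max 0 a / k)))) => x.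
rewrite /convolution -/(refl x phi) -uf; last first.
  by apply/(D_carrierP hM); eexists; exact: test_refl tphi.
rewrite -mulrA; apply: HC; first exact: test_sfun (test_refl x tphi).
apply: (sbound_refl x (a := Num.max 0 a) k0) => //; first by rewrite le_max lexx.
exact: vanish_nonneg.
Qed.

(** * One sequence dominating all dilates *)

Definition seq_weight (l : nat -> R) p := M p * \prod_(1 <= j < p.+1) l j.

Lemma frakR_adm l : frakR l -> adm (seq_weight l).
Proof.
move=> [lp lm _]; have l1 : 0 < l 1%N by exact: lp.
have prod_ge p : l 1%N ^+ p <= \prod_(1 <= j < p.+1) l j.
  elim: p => [|p IH]; first by rewrite big_geq // expr0.
  rewrite big_nat_recr //= exprSr; apply: ler_pM => //; rewrite ?exprn_ge0 //; try exact: ltW.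
  by apply: lm.
have pp p : 0 < \prod_(1 <= j < p.+1) l j by apply: lt_le_trans (prod_ge p); rewrite exprn_gt0.
split.
- by move=> p; rewrite mulr_gt0 ?(weight_gt0 hM).
- by rewrite /seq_weight big_geq // mulr1 (weight0 hM).
- move=> rho r0; have [_ _ wb] := weight_adm hM.
  have [B HB] := wb (rho / l 1%N) (divr_ge0 r0 (ltW l1)).
  exists B => p; apply: le_trans (HB p).
  rewrite /seq_weight expr_div_n -mulrA -invfM ler_wpM2l ?exprn_ge0 // lef_pV2.
  - by rewrite mulrC ler_pM2l ?(weight_gt0 hM).
  - by rewrite posrE mulr_gt0 // (weight_gt0 hM).
  - by rewrite posrE mulr_gt0 ?exprn_gt0 ?(weight_gt0 hM).
Qed.

(** The counting function of P: n j is the number of k with P k < j. *)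
Lemma slow_sequence (P : nat -> nat) : (forall k, (k <= P k)%N) ->
  (forall k k', (k <= k')%N -> (P k <= P k')%N) ->
  exists n : nat -> nat, [/\ forall j j', (j <= j')%N -> (n j <= n j')%N,
    forall k j, (j <= P k)%N -> (n j <= k)%N & forall k, exists j, (k <= n j)%N].
Proof.
move=> Pid Pmono; pose c j := [seq k <- iota 0 j | (P k < j)%N].
have cE j k : (k \in c j) = (P k < j)%N.
  rewrite mem_filter mem_iota /= add0n andb_idr // => /(leq_ltn_trans (Pid k)) //.
have cu j : uniq (c j) by rewrite filter_uniq ?iota_uniq.
exists (fun j => size (c j)); split.
- move=> j j' jj; apply: uniq_leq_size => // k; rewrite !cE => /leq_trans; exact.
- move=> k j jP; rewrite -[leqRHS](size_iota 0); apply: uniq_leq_size => // k'.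
  rewrite cE mem_iota /= add0n => Pj; rewrite ltnNge; apply/negP => /Pmono kk.
  by have := leq_trans Pj (leq_trans jP kk); rewrite ltnn.
- move=> k; exists (P k).+1; rewrite -[leqLHS](size_iota 0); apply: uniq_leq_size.
    exact: iota_uniq.
  by move=> k'; rewrite mem_iota /= add0n cE ltnS => /ltnW; exact: Pmono.
Qed.

(** The bounds C_k E(mu_k rho), for mu_k = 2 / (k + 1) and E = e^M, are merged
    into one.  The constant C_k is absorbed by a dilation as soon as rho
    passes a threshold sg k.  Between sg k and sg (k + 1) the supremum
    E(H mu_k rho) is reached at some p <= P k, and for a sequence l with
    l_j <= 1 / (H mu_k) for all j <= P k each of the terms up to p = P k is at
    most the term of rho for the weights M_p l_1 ... l_p.  Such a sequence can
    grow to infinity because only the finitely many j <= P k are constrained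
    by k. *)
Lemma common_sequence (C : nat -> R) : (forall k, 0 <= C k) ->
  exists2 l : nat -> R, frakR l & forall k0, exists2 B : R, 0 < B & forall rho v : R, 0 <= rho ->
    (forall k, (k0 <= k)%N -> v <= C k * assoc_exp M (2 / k.+1%:R * rho)) ->
    v <= B * assoc_exp (seq_weight l) rho.
Proof.
move=> C0; have aM := weight_adm hM.
have [H H1 dil] := weight_dilate hM; have H0 : 0 < H by exact: lt_le_trans H1.
pose mu k : R := 2 / k.+1%:R; have mu0 k : 0 < mu k by rewrite divr_gt0.
have /choice[D HD] : forall k, exists D, 0 < D /\ forall rho, 0 <= rho ->
    (1 + rho) * assoc_exp M (mu k * rho) <= D * assoc_exp M (H * mu k * rho).
  by move=> k; have [D D0 HD] := dil 1%N _ (mu0 k); exists D; split => // rho /HD; rewrite expr1.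
pose sg k : R := k%:R + \sum_(i < k.+1) C i * D i.
have CD0 k : 0 <= C k * D k by rewrite mulr_ge0 // ltW //; case: (HD k).
have sg_mono k : sg k <= sg k.+1.
  rewrite /sg [in leRHS]big_ord_recr /=; apply: lerD; first by rewrite ler_nat.
  by rewrite lerDl.
have sgk k : k%:R <= sg k by rewrite lerDl sumr_ge0.
have sg0 k : 0 <= sg k by apply: le_trans (sgk k).
have sgC k : C k * D k <= 1 + sg k.
  rewrite /sg big_ord_recr /= addrA addrA lerDr // !addr_ge0 // sumr_ge0 //.
have absorb k rho : sg k <= rho -> C k * assoc_exp M (mu k * rho) <= assoc_exp M (H * mu k * rho).
  move=> sr; have r0 : 0 <= rho := le_trans (sg0 k) sr.
  have r1 : 0 < 1 + rho by rewrite ltr_pwDl.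
  rewrite -(ler_pM2l r1) mulrCA.
  apply: le_trans (ler_wpM2l (C0 k) ((HD k).2 rho r0)) _; rewrite mulrA.
  by rewrite ler_pM2r ?assoc_exp_gt0 //; apply: le_trans (sgC k) _; rewrite lerD2l.
have /choice[P0 HP0] : forall k, exists P, forall rho B, 0 <= rho -> rho <= H * mu k * sg k.+1 ->
    (forall p, (p <= P)%N -> rho ^+ p / M p <= B) -> forall p, rho ^+ p / M p <= B.
  by move=> k; apply: (weight_finite_sup hM); rewrite !mulr_ge0 // ltW.
pose P k := (k + \sum_(i < k.+1) P0 i)%N.
have [n [nm nP nu]] : exists n : nat -> nat, [/\ forall j j', (j <= j')%N -> (n j <= n j')%N,
    forall k j, (j <= P k)%N -> (n j <= k)%N & forall k, exists j, (k <= n j)%N].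
  apply: slow_sequence => [k|k k' /subnK <-]; first by rewrite leq_addr.
  elim: (k' - k)%N => //= q IH; apply: leq_trans IH _.
  rewrite addSn /P; apply: leq_add; first exact: leqnSn.
  by rewrite [leqRHS]big_ord_recr /= leq_addr.
pose l j : R := (n j).+1%:R / (2 * H).
have H2 : 0 < 2 * H by rewrite mulr_gt0.
have fl : frakR l.
  split.
  - by move=> j _; rewrite divr_gt0.
  - by move=> p q _ pq; rewrite ler_pM2r ?invr_gt0 // ler_nat ltnS nm.
  - apply/cvgryPge => B; have [j hj] := nu (Num.trunc (Num.max 0 (B * (2 * H)))).
    exists j => // p /= jp; rewrite /l ler_pdivlMr //.
    apply: (@le_trans _ _ (Num.max 0 (B * (2 * H)))); first by rewrite le_max lexx orbT.
    apply: (ltW (lt_le_trans (truncnS_gt _) _)).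
    by rewrite ler_nat ltnS; exact: leq_trans hj (nm _ _ jp).
exists l => // k0; have al := frakR_adm fl.
pose B0 := C k0 * assoc_exp M (mu k0 * sg k0).
have B00 : 0 <= B0 by rewrite mulr_ge0 // ltW // assoc_exp_gt0.
exists (1 + B0); first by rewrite ltr_pwDl.
move=> rho v r0 Hv; have E1 := assoc_exp_ge1 al r0.
have [small|large] := ltP rho (sg k0).
  apply: le_trans (Hv k0 (leqnn _)) _; apply: (@le_trans _ _ B0).
    rewrite ler_wpM2l //; apply: assoc_exp_mono => //.
      by rewrite mulr_ge0 // ltW.
    by rewrite ler_pM2l ?mu0 // ltW.
  apply: (@le_trans _ _ (1 + B0)); first by rewrite lerDr.
  by rewrite ler_peMr // addr_ge0.
have ex : exists k, rho < sg (k0 + k).+1.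
  exists (Num.trunc rho); apply: lt_le_trans (truncnS_gt _) _.
  by apply: le_trans (sgk _); rewrite ler_nat ltnS leq_addl.
(* k is the index with sg k <= rho < sg k.+1 *)
case: (ex_minnP ex) => q rq qmin; pose k := (k0 + q)%N.
have sk : sg k <= rho.
  rewrite /k; case: (q) qmin => [|q'] qmin; first by rewrite addn0.
  by rewrite leNgt addnS; apply/negP => /qmin; rewrite ltnn.
apply: le_trans (Hv k (leq_addr _ _)) _; apply: le_trans (absorb k rho sk) _.
apply: (@le_trans _ _ (assoc_exp (seq_weight l) rho)); last first.
  by apply: ler_peMl; [exact: ltW (assoc_exp_gt0 _ _)|rewrite lerDl].
have hmu : 0 < H * mu k by rewrite mulr_gt0.
have hr0 : 0 <= H * mu k * rho by rewrite mulr_ge0 // ltW.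
apply: assoc_exp_le => //; apply: (HP0 k) => //; first by rewrite ler_pM2l // ltW.
move=> p pP; apply: le_trans (assoc_exp_ge p al r0).
have lk j : (j <= p)%N -> l j * (H * mu k) <= 1.
  move=> jp; have /nP nk : (j <= P k)%N.
    by apply: leq_trans jp (leq_trans pP _); rewrite /P big_ord_recr /= addnA leq_addl.
  rewrite /l /mu [leLHS](_ : _ = (n j).+1%:R / k.+1%:R); last first.
    have k1 : k.+1%:R != 0 :> R by rewrite pnatr_eq0.
    move: (k.+1%:R) k1 ((n j).+1%:R) => K1 k1 N1; field.
    by rewrite k1 gt_eqF.
  by rewrite ler_pdivrMr // mul1r ler_nat ltnS.
have lp j : 0 < l j by rewrite divr_gt0.
have prodl q' : (q' <= p)%N -> (H * mu k) ^+ q' * \prod_(1 <= j < q'.+1) l j <= 1.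
  elim: q' => [|q' IH] qp; first by rewrite big_geq // expr0 mulr1.
  have c0 : 0 < (H * mu k) ^+ q' by rewrite exprn_gt0.
  have p0 : 0 <= \prod_(1 <= j < q'.+1) l j by rewrite prodr_ge0 // => j _; exact: ltW.
  rewrite big_nat_recr //= exprSr mulrACA; apply: mulr_ile1.
  - exact: mulr_ge0 (ltW c0) p0.
  - exact: mulr_ge0 (ltW hmu) (ltW (lp _)).
  - by apply: IH; exact: ltnW.
  - by rewrite mulrC; exact: lk.
have pl0 : 0 < \prod_(1 <= j < p.+1) l j by rewrite big_seq prodr_gt0.
have Mp := weight_gt0 hM p.
rewrite ler_pdivlMr; last by rewrite /seq_weight mulr_gt0.
rewrite /seq_weight exprMn; move: pl0 (prodl p (leqnn _)); set Q := \prod_(_ <= _ < _) _ => Q0 HQ.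
rewrite [leLHS](_ : _ = rho ^+ p * ((H * mu k) ^+ p * Q)); last by field; rewrite gt_eqF.
by apply: ler_piMr HQ; rewrite exprn_ge0.
Qed.

Lemma necessity_Roumieu f : in_S' M Roumieu f ->
  exists2 l : nat -> R, frakR l &
    forall phi, carrier (D_space d M Roumieu) phi ->
      (ereal_sup [set (expR (- assoc_fun_seq M l (enorm x))
         * cabs (convolution f phi x))%:E | x in [set: V]] < +oo)%E.
Proof.
move=> [u cu uf]; have [lu bu] := S_dual hM cu.
have /choice[C HC] : forall k : nat, exists C : R, 0 <= C /\ forall g A, sfun M Roumieu g ->
    sbound M k.+1%:R^-1 A g -> cabs (u g) <= C * A.
  move=> k; have [C HC] := bu k.+1%:R (ltr0Sn _ _); exists `|C|; split => // g A Tg dg.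
  apply: le_trans (HC g A Tg dg) _; apply: ler_wpM2r; last exact: ler_norm.
  by apply: (sbound_ge0 hM _ dg); rewrite invr_gt0.
have [l fl Hl] := common_sequence (fun k => (HC k).1); exists l => //.
move=> phi /(D_carrierP hM)[a tphi]; have [sp vp [h h0 [A HA]]] := tphi.
have A0 := dbound_ge0 hM HA.
(* the norms with index k.+1 >= h are the ones that bound phi *)
pose k0 := Num.trunc h; have [B B0 HB] := Hl k0.
pose r : R := 2 * (1 + d%:R) * Num.max 0 a.
have r0 : 0 <= r by rewrite !mulr_ge0 ?addr_ge0 // le_max lexx.
pose K := (1 + A) * assoc_exp M r.
have K0 : 0 < K by rewrite mulr_gt0 ?assoc_exp_gt0 // ltr_pwDl.
apply: (@growth_fin _ _ (K * B)) => x; rewrite -mulrA mulrC -ler_pdivrMr //.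
apply: HB; first exact: enorm_ge0.
move=> k kk; rewrite ler_pdivrMr //.
have hk : h <= k.+1%:R by apply: (ltW (lt_le_trans (truncnS_gt _) _)); rewrite ler_nat ltnS.
rewrite /convolution -/(refl x phi) -uf; last first.
  by apply/(D_carrierP hM); eexists; exact: test_refl tphi.
have vp' := vanish_nonneg vp.
have m0 : 0 <= Num.max 0 a by rewrite le_max lexx.
apply: le_trans ((HC k).2 _ _ (test_sfun (test_refl x tphi)) (sbound_refl x h0 hk m0 sp vp' HA)) _.
rewrite -[leRHS]mulrA; apply: ler_wpM2l; first exact: (HC k).1.
rewrite [leLHS]mulrC ler_pM2l ?assoc_exp_gt0 //.
apply: (ler_pM A0 (ltW (assoc_exp_gt0 _ _))).
- by rewrite lerDr.
- apply: assoc_exp_mono; first exact: weight_adm.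
    by rewrite mulr_ge0.
  by rewrite -/r ler_pdivrMr // ler_peMr // ler1n.
Qed.

End Necessity.

(** * Limits of complex sequences *)

Section CauchySequences.
Variable R : realType.
Implicit Types (z : nat -> R[i]) (W : nat -> R).

Definition tends z (l : R[i]) := forall e : R, 0 < e ->
  exists N, forall n, (N <= n)%N -> cabs (z n - l) <= e.

Lemma tends_unique z l l' : tends z l -> tends z l' -> l = l'.
Proof.
move=> H H'; apply/eqP; rewrite -subr_eq0; apply/eqP/cabs_eq0/eqP.
rewrite eq_le cabs_ge0 andbT; apply/ler_addgt0Pr => e e0; rewrite add0r.
have e2 : 0 < e / 2 by lra.
have [N HN] := H _ e2; have [N' HN'] := H' _ e2.
have -> : l - l' = (z (maxn N N') - l') - (z (maxn N N') - l) by ring.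
apply: le_trans (cabsB _ _) _; rewrite (splitr e).
by apply: lerD; [apply: HN'; exact: leq_maxr|apply: HN; exact: leq_maxl].
Qed.

Lemma tends_lin (c : R[i]) z z' l l' : tends z l -> tends z' l' ->
  tends (fun n => c * z n + z' n) (c * l + l').
Proof.
move=> H H' e e0; have c0 : 0 < 1 + cabs c by rewrite ltr_pwDl // cabs_ge0.
have e1 : 0 < e / 2 / (1 + cabs c) by rewrite !divr_gt0.
have e2 : 0 < e / 2 by lra.
have [N HN] := H _ e1; have [N' HN'] := H' _ e2.
exists (maxn N N') => n; rewrite geq_max => /andP[Nn Nn'].
have -> : c * z n + z' n - (c * l + l') = c * (z n - l) + (z' n - l') by ring.
apply: le_trans (cabsD _ _) _; rewrite (splitr e); apply: lerD; last exact: HN'.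
rewrite cabsM; apply: (@le_trans _ _ ((1 + cabs c) * (e / 2 / (1 + cabs c)))).
  by apply: ler_pM; rewrite ?cabs_ge0 ?HN // lerDr.
by rewrite mulrC divfK // gt_eqF.
Qed.

Lemma tends_eventually z l N : (forall n, (N <= n)%N -> z n = l) -> tends z l.
Proof. by move=> H e e0; exists N => n /H ->; rewrite subrr cabs0 ltW. Qed.

(** u n - W n increases and u n + W n decreases, so the supremum of the former
    is squeezed between them. *)
Lemma telescoping_real (u : nat -> R) W : (forall n, 0 <= W n) ->
  (forall n, `|u n.+1 - u n| <= W n - W n.+1) -> exists l, forall n, `|u n - l| <= W n.
Proof.
move=> W0 H.
have lo n k : u n - W n <= u (n + k)%N - W (n + k)%N.
  elim: k => [|k IH]; first by rewrite addn0.
  rewrite addnS; have := H (n + k)%N; rewrite ler_norml => /andP[? ?]; lra.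
have hi n k : u (n + k)%N + W (n + k)%N <= u n + W n.
  elim: k => [|k IH]; first by rewrite addn0.
  rewrite addnS; have := H (n + k)%N; rewrite ler_norml => /andP[? ?]; lra.
have cross n m : u n - W n <= u m + W m.
  have := lo n m; have := hi m n; rewrite addnC; have := W0 (n + m)%N; lra.
pose S := [set u n - W n | n in [set: nat]].
have hS : has_sup S.
  by split; [exists (u 0%N - W 0%N); exists 0%N|exists (u 0%N + W 0%N) => _ [n _ <-]].
exists (sup S) => n; rewrite ler_norml; apply/andP; split.
- suff : sup S <= u n + W n by lra.
  by apply: ge_sup; [case: hS|move=> _ [m _ <-]].
- suff : u n - W n <= sup S by lra.
  by apply: ub_le_sup; [case: hS|exists n].
Qed.

Lemma telescoping z W : (forall n, 0 <= W n) ->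
  (forall n, cabs (z n.+1 - z n) <= W n - W n.+1) ->
  exists l, forall n, cabs (z n - l) <= 2 * W n.
Proof.
move=> W0 H.
have [a Ha] : exists l, forall n, `|complex.Re (z n) - l| <= W n.
  apply: (telescoping_real (u := fun n => complex.Re (z n))) => // n.
  by apply: le_trans (H n); rewrite -ReN -ReD Re_le_cabs.
have [b Hb] : exists l, forall n, `|complex.Im (z n) - l| <= W n.
  apply: (telescoping_real (u := fun n => complex.Im (z n))) => // n.
  by apply: le_trans (H n); rewrite -ImN -ImD Im_le_cabs.
exists (a +i* b)%C => n; apply: le_trans (cabs_le_ReIm _) _.
rewrite ReD ReN ImD ImN /=; have := Ha n; have := Hb n; lra.
Qed.

End CauchySequences.

(** * Uniform boundedness by a gliding hump *)

Section UniformBoundedness.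
Variables (R : realType) (d : nat).
Local Notation V := 'rV[R]_d.
Local Notation F := (V -> R[i]).
Variables (T : F -> Prop) (q : nat -> R -> F -> Prop).
(** [q i A g] is read as: the i-th of an increasing sequence of norms of g is
    at most A.  In [complete], the steps phi n.+1 - phi n have sizes that at
    least halve each time, so their tails sum up to a multiple of the first. *)
Hypothesis cT : lin_closed T.
Hypothesis q_ge0 : forall i A g, q i A g -> 0 <= A.
Hypothesis q_mono : forall i j A B g, (i <= j)%N -> A <= B -> q j A g -> q i B g.
Hypothesis qZ : forall i A (c : R[i]) g, T g -> q i A g -> q i (cabs c * A) (c *: g).
Hypothesis complete : forall (i : nat -> nat) (dl : nat -> R) (phi : nat -> F),
  (forall n, (i n < i n.+1)%N) -> (forall n, 0 < dl n) -> (forall n, dl n.+1 <= dl n / 2) ->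
  (forall n, T (phi n)) -> (forall n, q (i n) (dl n) (phi n.+1 - phi n)) ->
  exists g, T g /\ forall n, q (i n) (4 * dl n) (g - phi n).
Variables (X : Type) (L : X -> F -> R[i]).
Hypothesis lL : forall x, linear_on T (L x).
Hypothesis contL : forall x, exists i C, forall g A, T g -> q i A g -> cabs (L x g) <= C * A.
Hypothesis boundedL : forall g, T g -> exists B, forall x, cabs (L x g) <= B.

Section Hump.
Hypothesis unbounded : forall i (C : R), exists x g A, [/\ T g, q i A g & C * A < cabs (L x g)].

(** One of phi + psi and phi - psi has a large value under L x, since the two
    values differ by 2 L x psi.  The radius dl' is then so small that the later
    corrections change this value by at most 1. *)
Lemma hump_step n i dl phi : 0 < dl -> T phi -> exists i' dl' phi' x,
  [/\ (i < i')%N, 0 < dl' & dl' <= dl / 2] /\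
  [/\ T phi', q i dl (phi' - phi), n.+1%:R <= cabs (L x phi') &
      forall psi, T psi -> q i' (4 * dl') psi -> cabs (L x psi) <= 1].
Proof.
move=> dl0 Tphi; have n0 : 0 < n.+1%:R :> R by [].
have [x [g [A [Tg qg big]]]] := unbounded i (n.+1%:R / dl).
have A0 := q_ge0 qg.
have L0 : 0 < cabs (L x g).
  by apply: le_lt_trans big; rewrite mulr_ge0 // divr_ge0 // ltW.
pose c := n.+1%:R / cabs (L x g); have c0 : 0 < c by rewrite divr_gt0.
pose psi := (c%:C%C : R[i]) *: g; have Tpsi : T psi by exact: lin_closedZ.
have qpsi : q i dl psi.
  apply: q_mono (leqnn i) _ (qZ _ Tg qg); rewrite cabsR gtr0_norm // /c mulrAC ler_pdivrMr //.
  by rewrite -ler_pdivrMl // mulrA [dl^-1 * _]mulrC ltW.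
have Lpsi : cabs (L x psi) = n.+1%:R.
  by rewrite (linear_onZ cT (lL x)) // cabsM cabsR gtr0_norm // /c divfK // gt_eqF.
have [i1 [C HC]] := contL x.
pose dl' := Num.min (dl / 2) (1 / (4 * (1 + `|C|))).
have C1 : 0 < 1 + `|C| by rewrite ltr_pwDl.
have dl0' : 0 < dl' by rewrite lt_min !divr_gt0 // mulr_gt0.
have small k : T k -> q (maxn i.+1 i1) (4 * dl') k -> cabs (L x k) <= 1.
  move=> Tk qk; have := HC _ _ Tk (q_mono (leq_maxr _ _) (lexx _) qk).
  move=> /le_trans; apply; apply: (@le_trans _ _ ((1 + `|C|) * (4 * (1 / (4 * (1 + `|C|)))))).
    apply: (@le_trans _ _ ((1 + `|C|) * (4 * dl'))).
      apply: ler_wpM2r; first by rewrite mulr_ge0 // ltW.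
      by apply: le_trans (ler_norm C) _; rewrite lerDr.
    by rewrite ler_pM2l // ler_pM2l // ge_min lexx orbT.
  by rewrite le_eqVlt; apply/orP; left; apply/eqP; field; rewrite gt_eqF.
have [phi' [Tphi' qphi' Lphi']] : exists phi', [/\ T phi', q i dl (phi' - phi) & n.+1%:R <= cabs (L x phi')].
  have [plus|minus] := leP n.+1%:R (cabs (L x (phi + psi))).
    exists (phi + psi); split => //; last by rewrite addrAC subrr add0r.
    by rewrite addrC -[psi]scale1r; apply: cT.2.
  exists (phi - psi); split; first exact: lin_closedB.
    rewrite addrAC subrr add0r -scaleN1r.
    by apply: q_mono (leqnn i) _ (qZ (-1) Tpsi qpsi); rewrite cabsN cabs1 mul1r.
  have E : L x (phi + psi) - L x (phi - psi) = 2 * L x psi.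
    by rewrite (linear_onD (lL x)) // (linear_onB (lL x)) //; ring.
  have := cabsB (L x (phi + psi)) (L x (phi - psi)).
  rewrite E cabsM Lpsi (_ : cabs 2 = 2); first by lra.
  by rewrite (_ : 2 = (2%:R : R)%:C%C) ?cabsR ?ger0_norm // rmorph_nat.
exists (maxn i.+1 i1), dl', phi', x; split; split => //.
- exact: leq_maxl.
- by rewrite ge_min lexx.
Qed.

Lemma hump_absurd : False.
Proof.
pose St := {st : nat * R * F | 0 < st.1.2 /\ T st.2}.
have [T0 _] := cT.
have /choice[next Hnext] : forall p : nat * St, exists r : St * X,
    [/\ ((sval p.2).1.1 < (sval r.1).1.1)%N,
        (sval r.1).1.2 <= (sval p.2).1.2 / 2,
        q (sval p.2).1.1 (sval p.2).1.2 ((sval r.1).2 - (sval p.2).2),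
        p.1.+1%:R <= cabs (L r.2 (sval r.1).2) &
        forall psi, T psi -> q (sval r.1).1.1 (4 * (sval r.1).1.2) psi -> cabs (L r.2 psi) <= 1].
  move=> [n [[[i dl] phi] /= [dl0 Tphi]]].
  have [i' [dl' [phi' [x [[h1 h2 h3] [h4 h5 h6 h7]]]]]] := hump_step n i dl0 Tphi.
  by exists (exist _ (i', dl', phi') (conj h2 h4) : St, x).
pose st0 : St := exist _ (0%N, 1, 0) (conj (ltr01 : 0 < (0%N, 1 : R, 0 : F).1.2) T0).
pose st := fix st n : St := if n is m.+1 then (next (m, st m)).1 else st0.
have [g [Tg Hg]] := complete (i := fun n => (sval (st n)).1.1) (dl := fun n => (sval (st n)).1.2)
  (phi := fun n => (sval (st n)).2)
  (fun n => let: And5 h _ _ _ _ := Hnext (n, st n) in h) (fun n => (svalP (st n)).1)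
  (fun n => let: And5 _ h _ _ _ := Hnext (n, st n) in h) (fun n => (svalP (st n)).2)
  (fun n => let: And5 _ _ h _ _ := Hnext (n, st n) in h).
have [B HB] := boundedL Tg.
pose n := Num.trunc (Num.max 0 B); pose x := (next (n.+1, st n.+1)).2.
have [_ _ _ h4 h5] := Hnext (n.+1, st n.+1).
have Tn : T (sval (st n.+2)).2 by exact: (svalP (st n.+2)).2.
have r1 := h5 _ (lin_closedB cT Tg Tn) (Hg n.+2).
have : (n.+2)%:R <= B + 1.
  apply: le_trans h4 _; rewrite -/x -[(next _).1]/(st n.+2).
  have -> : (sval (st n.+2)).2 = g - (g - (sval (st n.+2)).2) by rewrite opprB addrCA subrr addr0.
  rewrite (linear_onB (lL x)) //; last exact: lin_closedB.
  by apply: le_trans (cabsB _ _) _; apply: lerD.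
have := truncnS_gt (Num.max 0 B); rewrite -/n => nB.
have : B < n.+1%:R by apply: le_lt_trans nB; rewrite le_max lexx orbT.
rewrite -[in n.+2%:R]addn1 natrD; lra.
Qed.

End Hump.

(** Were the family not equicontinuous, the limit of the humps would be sent
    beyond every bound. *)
Lemma uniform_boundedness : exists i C, forall x g A, T g -> q i A g -> cabs (L x g) <= C * A.
Proof.
apply: contrapT => H; apply: hump_absurd => i C; apply: contrapT => H'.
apply: H; exists i, C => x g A Tg qg; rewrite leNgt; apply/negP => big.
by apply: H'; exists x, g, A.
Qed.

End UniformBoundedness.

(** * Equicontinuity of the convolutions *)

Section Equicontinuity.
Variables (R : realType) (d : nat) (M : nat -> R).
Hypothesis hM : weight_sequence M.
Local Notation V := 'rV[R]_d.
Local Notation F := (V -> R[i]).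
Implicit Types (g : F) (a m : R) (s : seq 'I_d) (t x y : V) (b : star).

Section Frechet.
Variables (a : R) (h : nat -> R).
Hypothesis h0 : forall i, 0 < h i.
Hypothesis hmono : forall i j, (i <= j)%N -> h j <= h i.

(** Both a Frechet space of Beurling type, for h i tending to 0, and one Banach
    space D_(K,h), for h constant. *)
Definition frechet g := [/\ smooth g, vanish a g & forall i, exists A, dbound M (h i) A g].

Lemma frechet_closed : lin_closed frechet.
Proof.
split.
  by split=> //; [exact: smooth0|exists 0 => s x; rewrite partials0 cabs0 !mul0r].
move=> c g g' [sg vg dg] [sg' vg' dg']; split; first exact: smooth_lin.
  by move=> x xa; rewrite !fctE /= vg // vg' // scaler0 addr0.
move=> i; have [A HA] := dg i; have [B HB] := dg' i; exists (cabs c * A + B).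
exact: (dboundD (smoothZ c sg) sg' (dboundZ c sg HA) HB).
Qed.

(** All derivatives of phi n converge uniformly, at the speed of the
    prescribed sizes dl n. *)
Lemma frechet_complete (i : nat -> nat) (dl : nat -> R) (phi : nat -> F) :
  (forall n, (i n < i n.+1)%N) -> (forall n, 0 < dl n) -> (forall n, dl n.+1 <= dl n / 2) ->
  (forall n, frechet (phi n)) -> (forall n, dbound M (h (i n)) (dl n) (phi n.+1 - phi n)) ->
  exists g, frechet g /\ forall n, dbound M (h (i n)) (4 * dl n) (g - phi n).
Proof.
move=> ii dl0 dlh Tphi Dphi.
have sphi n : smooth (phi n) by case: (Tphi n).
pose w (s : seq 'I_d) n := dl n * h (i n) ^+ size s * M (size s).
have w0 s n : 0 <= w s n.
  by rewrite !mulr_ge0 ?exprn_ge0 // ?(ltW (weight_gt0 hM _)) // ltW.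
have wh s n : w s n.+1 <= w s n / 2.
  have Mk := weight_gt0 hM (size s).
  have hh : h (i n.+1) ^+ size s <= h (i n) ^+ size s.
    rewrite lerXn2r ?nnegrE ?(ltW (h0 _)) //; apply: hmono; exact: ltnW (ii n).
  apply: (@le_trans _ _ (dl n / 2 * h (i n) ^+ size s * M (size s))).
    apply: ler_wpM2r; first exact: ltW.
    by apply: ler_pM => //; [exact: ltW|rewrite exprn_ge0 // ltW].
  by rewrite /w le_eqVlt; apply/orP; left; apply/eqP; ring.
have dw s n x : cabs (partials s (phi n.+1) x - partials s (phi n) x) <= w s n.
  have := Dphi n s x; rewrite partialsB //.
have /choice[Tl HT] : forall p : seq 'I_d * V, exists l, forall n,
    cabs (partials p.1 (phi n) p.2 - l) <= 2 * (2 * w p.1 n).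
  move=> [s x] /=; apply: telescoping => n; first by rewrite mulr_ge0.
  apply: le_trans (dw s n x) _; have := wh s n; lra.
pose T s x := Tl (s, x).
have close s n x : cabs (partials s (phi n) x - T s x) <= 2 * (2 * w s n) by exact: (HT (s, x) n).
have small s e : 0 < e -> exists N, forall n, (N <= n)%N -> 2 * (2 * w s n) <= e.
  move=> e0.
  have wn n : n.+1%:R * w s n <= w s 0%N.
    elim: n => [|n IH]; first by rewrite mul1r.
    apply: le_trans IH; have := wh s n; have := w0 s n.+1; have := w0 s n.
    have : 0 <= n%:R :> R by []. rewrite -[n.+2]addn2 -[n.+1]addn1 !natrD; nra.
  exists (Num.trunc (4 * w s 0%N / e)) => n Nn.
  have nb : 4 * w s 0%N / e < n.+1%:R.
    by apply: lt_le_trans (truncnS_gt _) _; rewrite ler_nat ltnS.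
  have np : 0 < n.+1%:R :> R by [].
  rewrite -(ler_pM2l np); have := wn n; move: nb; rewrite ltr_pdivrMr //.
  move: (n.+1%:R) np => N1 N10; set u := w s n; set v := w s 0%N; nra.
have [sT pT] := smooth_uniform_limit sphi close small.
have closeT n : dbound M (h (i n)) (4 * dl n) (T [::] - phi n).
  move=> s x; rewrite partialsB // pT -[(_ - _) x]/(T s x - partials s (phi n) x) cabsBC.
  by apply: le_trans (close s n x) _; rewrite le_eqVlt; apply/orP; left; apply/eqP; rewrite /w; ring.
exists (T [::]); split=> //; split=> //.
- move=> x xa; apply: cabs_eq0; apply/eqP; rewrite eq_le cabs_ge0 andbT.
  apply/ler_addgt0Pr => e e0; rewrite add0r; have [N HN] := small [::] e e0.
  apply: le_trans (HN N (leqnn N)); have := close [::] N x.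
  have [_ vN _] := Tphi N; rewrite /= vN // sub0r cabsN //.
- move=> j; have ij : (j <= i j)%N.
    by elim: j => // j IH; exact: leq_ltn_trans IH (ii j).
  have [_ _ dj] := Tphi j; have [A HA] := dj j; exists (4 * dl j + A).
  rewrite -[T [::]](subrK (phi j)); apply: (dboundD (smoothB sT (sphi j)) (sphi j) _ HA).
  by apply: (dbound_mono hM (h0 _) _ (lexx _) (closeT j)); exact: hmono.
Qed.

Lemma frechet_equicontinuity (X : Type) (L : X -> F -> R[i]) :
  (forall k, linear_on frechet (L k)) ->
  (forall k, exists i C, forall g A, frechet g -> dbound M (h i) A g -> cabs (L k g) <= C * A) ->
  (forall g, frechet g -> exists B, forall k, cabs (L k g) <= B) ->
  exists i C, forall k g A, frechet g -> dbound M (h i) A g -> cabs (L k g) <= C * A.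
Proof.
move=> lL cL bL.
apply: (@uniform_boundedness _ _ frechet (fun i A g => dbound M (h i) A g)
  frechet_closed _ _ _ frechet_complete _ _ lL cL bL).
- by move=> i A g; exact: dbound_ge0.
- by move=> i j A B g ij; apply: dbound_mono => //; exact: hmono.
- by move=> i A c g [sg _ _]; exact: dboundZ.
Qed.

End Frechet.

Lemma refl_lin x c g g' : refl x (c *: g + g') = c *: refl x g + refl x g'.
Proof. by []. Qed.

(** The functionals phi |-> e^(-W(x)) (f * phi)(x), indexed by x, are bounded
    at each phi by hypothesis.  The uniform boundedness principle applies to
    them on the Frechet space of functions supported in a ball (Beurling), or on
    each of the Banach spaces whose union it is (Roumieu). *)
Lemma convolution_equicontinuity b f (W : V -> R) a :
  linear_on (tests M b) f ->
  (forall a, cogood b (fun h => exists C, forall g A, test M b a g -> dbound M h A g ->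
    cabs (f g) <= C * A)) ->
  (forall g, tests M b g -> exists B, forall x, cabs (f (refl x g)) <= B * expR (W x)) ->
  cogood b (fun h => exists C, forall g A, test M b a g -> dbound M h A g ->
    forall x, cabs (f (refl x g)) <= C * A * expR (W x)).
Proof.
move=> lf cf bf; pose L (x : V) (g : F) : R[i] := (expR (- W x))%:C%C * f (refl x g).
have LE x g : cabs (L x g) = expR (- W x) * cabs (f (refl x g)).
  by rewrite cabsM cabsR ger0_norm // expR_ge0.
have LEle x g (B : R) : (cabs (L x g) <= B) = (cabs (f (refl x g)) <= B * expR (W x)).
  by rewrite LE expRN mulrC ler_pdivrMr // expR_gt0.
have lin (T : F -> Prop) : (forall g, T g -> test M b a g) -> forall x, linear_on T (L x).
  move=> Tt x c g g' /Tt tg /Tt tg'; rewrite /L refl_lin lf; first by ring.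
    by exists (a + `|x|); exact: test_refl.
  by exists (a + `|x|); exact: test_refl.
have bL (T : F -> Prop) : (forall g, T g -> test M b a g) ->
    forall g, T g -> exists B, forall x, cabs (L x g) <= B.
  move=> Tt g /Tt tg; have [B HB] := bf g (ex_intro _ a tg).
  by exists B => x; rewrite LEle.
case: b lf cf bf lin bL => lf cf bf lin bL /=.
- pose h (i : nat) : R := i.+1%:R^-1.
  have h0 i : 0 < h i by rewrite invr_gt0.
  have hmono i j : (i <= j)%N -> h j <= h i.
    by move=> ij; rewrite lef_pV2 ?posrE // ler_nat.
  have hsmall (k : R) : 0 < k -> exists i, h i <= k.
    move=> k0; exists (Num.trunc k^-1); rewrite -[leRHS]invrK lef_pV2 ?posrE ?invr_gt0 //.
    exact: ltW (truncnS_gt _).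
  have Tt g : frechet a h g -> test M Beurling a g.
    move=> [sg vg dg]; split => // k k0; have [i hk] := hsmall k k0.
    by have [A HA] := dg i; exists A; exact: dbound_mono HA.
  have [|i [C HC]] := frechet_equicontinuity h0 hmono (lin _ Tt) _ (bL _ Tt).
    move=> x; have [k k0 [C HC]] := cf (a + `|x|); have [i hk] := hsmall k k0.
    exists i, (expR (- W x) * C) => g A /Tt tg dg; rewrite LE -mulrA ler_wpM2l ?expR_ge0 //.
    apply: HC; first exact: test_refl.
    by apply: dbound_refl; [case: tg|exact: dbound_mono dg].
  exists (h i) => //; exists C => g A [sg vg gg] dg x; rewrite -LEle; apply: HC => //.
  by split => // j; exact: gg.
- move=> k k0; pose h (_ : nat) := k.
  have Tt g : frechet a h g -> test M Roumieu a g.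
    by move=> [sg vg dg]; split => //; exists k => //; exact: dg 0%N.
  have [|i [C HC]] := frechet_equicontinuity (h := h) (fun _ => k0) (fun _ _ _ => lexx _)
      (lin _ Tt) _ (bL _ Tt).
    move=> x; have [C HC] := cf (a + `|x|) k k0.
    exists 0%N, (expR (- W x) * C) => g A /Tt tg dg; rewrite LE -mulrA ler_wpM2l ?expR_ge0 //.
    apply: HC; first exact: test_refl.
    by apply: dbound_refl => //; case: tg.
  exists C => g A [sg vg gg] dg x; rewrite -LEle; apply: HC => //.
  by split => // j; exists A.
Qed.

End Equicontinuity.

(** * Smooth steps *)

Section StepFunction.
Variable R : realType.
Notation mu := (@lebesgue_measure R).

Lemma antiderivative (psi : R -> R) (c : R) : continuous psi ->
  (forall t : R, t < c -> psi t = 0) -> exists Psi : R -> R, forall t : R, is_derive t 1 Psi (psi t).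
Proof.
move=> cpsi zpsi; pose Psi (x : R) : R := (\int[mu]_(t in [set` `[c - 1, x]]) psi t)%R.
have zero x : x < c -> Psi x = 0.
  move=> xc; rewrite /Psi (eq_Rintegral _ (g := cst 0)).
    by rewrite /Rintegral integral0.
  move=> t; rewrite inE /= in_itv /= => /andP[_ tx]; apply: zpsi.
  exact: le_lt_trans tx xc.
(* the integral starts at c - 1, so that every t >= c is an inner point of the
   interval of integration *)
exists Psi => t; have [tc|tc] := ltP t c.
  apply/is_deriveP => e e0; exists (c - t); first by rewrite subr_gt0.
  move=> h hd; rewrite zpsi // zero; last first.
    by rewrite [h *: 1]mulr1 -ltrBrDr; apply: le_lt_trans (ler_norm h) hd.
  by rewrite zero // mulr0 !subrr normr0 mulr_ge0 // ltW.
have int : mu.-integrable `[c - 1, t + 1] (EFin \o psi).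
  apply: continuous_compact_integrable; first exact: segment_compact.
  exact: continuous_subspaceT.
have tu : t < t + 1 by rewrite ltrDl.
have ct : c - 1 < t by lra.
have [df Ef] := continuous_FTC1_closed tu int ct (cpsi t).
by apply: DeriveDef; [exact: df|rewrite -derive1E; exact: Ef].
Qed.

(** The primitive of a nonnegative bump, divided by the total mass N of the
    bump, rises from 0 to 1. *)
Lemma step_function (psi : R -> R) (c : R) : 0 < c -> continuous psi ->
  (forall t : R, c <= `|t| -> psi t = 0) -> (forall t, 0 <= psi t) -> 0 < psi 0 ->
  exists (theta : R -> R) (N : R), [/\ 0 < N, forall t : R, is_derive t 1 theta (psi t / N),
    forall t, t <= - c -> theta t = 0, forall t, c <= t -> theta t = 1 &
    forall t, `|theta t| <= 1].
Proof.
move=> c0 cpsi zpsi pos psi0.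
have [Psi dPsi] : exists Psi : R -> R, forall t : R, is_derive t 1 Psi (psi t).
  apply: (@antiderivative psi (- c)) => // t tc; apply: zpsi.
  by rewrite ler0_norm; lra.
have cP := is_derive_cont1 dPsi.
have mvt (s t : R) : s <= t -> exists2 x, s <= x <= t & Psi t - Psi s = psi x * (t - s).
  move=> st; have [x] := MVT_segment st (fun x _ => dPsi x) (continuous_subspaceT cP).
  by rewrite in_itv /=; exists x.
have mono (s t : R) : s <= t -> Psi s <= Psi t.
  by move=> st; have [x _ E] := mvt s t st; rewrite -subr_ge0 E mulr_ge0 // subr_ge0.
have lowc t : t <= - c -> Psi t = Psi (- c).
  move=> tc; have [x /andP[tx xc] E] := mvt _ _ tc; apply/esym/eqP; rewrite -subr_eq0 E zpsi ?mul0r //.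
  by rewrite ler0_norm; lra.
have highc t : c <= t -> Psi t = Psi c.
  move=> tc; have [x /andP[tx xc] E] := mvt _ _ tc; apply/eqP; rewrite -subr_eq0 E zpsi ?mul0r //.
  by rewrite ger0_norm; lra.
pose N := Psi c - Psi (- c).
have N0 : 0 < N.
  have /is_deriveP/(_ (psi 0 / 2)) [|dl dl0 H] := dPsi 0; first lra.
  pose h := Num.min (dl / 2) c; have h0 : 0 < h by rewrite lt_min divr_gt0.
  have hd : `|h| < dl by rewrite gtr0_norm // gt_min; apply/orP; left; lra.
  have := H h hd; rewrite [h *: 1]mulr1 addr0 ler_norml gtr0_norm // => /andP[H1 _].
  have hc : h <= c by rewrite ge_min lexx orbT.
  have A1 := mono _ _ hc; have A2 : Psi (- c) <= Psi 0 by apply: mono; lra.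
  have : 0 < h * psi 0 by rewrite mulr_gt0.
  rewrite /N; move: H1; rewrite mulrAC; lra.
exists (fun t => (Psi t - Psi (- c)) / N), N; split => //.
- move=> t; have D := is_deriveB (dPsi t) (is_derive_cst (Psi (- c)) t 1).
  have := is_deriveZ N^-1 D; rewrite subr0 => D'.
  apply: is_derive_eq (_ : is_derive t 1 _ (N^-1 *: psi t)) _; last by rewrite mulrC.
  have -> : (fun t0 : R => (Psi t0 - Psi (- c)) / N) = N^-1 *: (Psi - cst (Psi (- c))).
    by apply/funext => u; rewrite !fctE [RHS]mulrC.
  exact: D'.
- by move=> t /lowc ->; rewrite subrr mul0r.
- by move=> t /highc ->; rewrite divff // gt_eqF.
- move=> t; have A1 : Psi (- c) <= Psi t.
    by have [/lowc ->//|/ltW /mono] := leP t (- c).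
  have A2 : Psi t <= Psi c.
    by have [/highc ->//|/ltW /mono] := leP c t.
  rewrite ger0_norm; last by rewrite divr_ge0 ?(ltW N0) // subr_ge0.
  by rewrite ler_pdivrMr // mul1r /N lerD2r.
Qed.

End StepFunction.

Section StepFamily.
Variables (R : realType) (d : nat) (M : nat -> R).
Hypothesis hM : weight_sequence M.
Local Notation V := 'rV[R]_d.
Local Notation F := (V -> R[i]).
Implicit Types (g : F) (a m : R) (s : seq 'I_d) (t x y : V) (b : star).

Definition reC g : F := fun x => ((complex.Re (g x))%:C)%C.

Lemma isd_reC j g x z : isd j g x z -> isd j (reC g) x ((complex.Re z)%:C)%C.
Proof. by move=> [dr _]; split; [exact: dr|exact: is_derive_cst]. Qed.

Lemma partial_reC j g : C1 g -> partial j (reC g) = reC (partial j g).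
Proof. by move=> [_ D]; apply/funext => x; apply: partialE; apply: isd_reC; exact: D. Qed.

Lemma smooth_reC g : smooth g -> smooth (reC g).
Proof.
move=> sg; apply: (@smooth_stable _ _ (fun f => exists2 g, smooth g & f = reC g)); last by exists g.
move=> _ [k sk ->]; have ck := smooth_C1 sk; split.
  split; first by split; [case: ck => -[]|exact: cst_continuous].
  by move=> j x; rewrite partial_reC //; apply: isd_reC; case: ck.
by move=> j; exists (partial j k); [exact: smooth_partial|exact: partial_reC].
Qed.

Lemma partials_reC s g : smooth g -> partials s (reC g) = reC (partials s g).
Proof.
move=> sg; elim: s => //= j s ->; apply: partial_reC; apply: smooth_C1; exact: smooth_partials.
Qed.

Lemma dbound_reC h A g : smooth g -> dbound M h A g -> dbound M h A (reC g).
Proof.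
move=> sg H s x; rewrite partials_reC //; apply: le_trans (H s x).
by rewrite /reC cabsR Re_le_cabs.
Qed.

(** The square of the real part of g / g(x0). *)
Lemma nonneg_test b a g x0 : test M b a g -> g x0 != 0 ->
  exists G, [/\ test M b a G, forall x, G x = reC G x, forall x, 0 <= complex.Re (G x) & complex.Re (G x0) = 1].
Proof.
move=> [sg vg gg] g0; pose k : F := reC ((g x0)^-1 *: g).
have sk0 : smooth ((g x0)^-1 *: g) by exact: smoothZ.
have sk : smooth k by exact: smooth_reC.
have kE x : (k \* k) x = ((complex.Re ((g x0)^-1 * g x)) ^+ 2)%:C%C.
  by rewrite /= /k /reC -rmorphM expr2.
exists (k \* k); split; first split.
- exact: smooth_mul.
- by move=> x /vg xg; rewrite kE xg mulr0 /= expr0n.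
- have gk : good b (fun h => exists A, dbound M h A k).
    apply: good1 gg => h h0 [A HA]; exists (cabs (g x0)^-1 * A).
    by apply: dbound_reC => //; exact: dboundZ.
  apply: (good2 _ gk gk) => h h' h0 h0' [A HA] [B HB]; exists (A * B).
  by apply: dboundM => //; exact: ltW.
- by move=> x; rewrite /reC kE.
- by move=> x; rewrite kE /= sqr_ge0.
- by rewrite kE mulVf //= expr1n.
Qed.

Definition coordC (th : R -> R) (j : 'I_d) : F := fun x => ((th (x 0 j))%:C)%C.

(** Any nonzero test function yields a step: its nonnegative modification G is
    restricted to the line through x0 in direction j, and the step is a
    primitive of this bump.  Its first
    derivative is G composed with the projection L to that line, so the bounds
    for G carry over with one derivative less, which M_n M_1 <= M_(n+1)
    compensates. *)
Lemma step_coordinate b a g (j : 'I_d) : test M b a g -> g <> 0 ->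
  exists (th : R -> R) (c : R), [/\ 0 < c, forall r, r <= - c -> th r = 0, forall r, c <= r -> th r = 1,
    smooth (coordC th j) & good b (fun h => exists A, dbound M h A (coordC th j))].
Proof.
move=> tg gn0.
have [x0 g0] : exists x, g x != 0.
  apply: contrapT => H; apply: gn0; apply/funext => x; apply/eqP/negPn/negP => gx.
  by apply: H; exists x.
have [G [[sG vG gG] Greal Gpos G0]] := nonneg_test tg g0.
have a0 : `|x0| <= a.
  by rewrite leNgt; apply/negP => /vG E; move: G0; rewrite E => /eqP; rewrite eq_sym oner_eq0.
pose psi (t : R) := complex.Re (G (t *: unit_vec R j + x0)).
pose c := a + `|x0| + 1.
have c0 : 0 < c by rewrite ltr_wpDl // addr_ge0 // (le_trans _ a0).
have cpsi : continuous psi.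
  move=> t; apply: (@continuous_comp _ _ _ (fun t : R => t *: unit_vec R j + x0) (repart G)).
    by apply: continuousD; [exact: scalel_continuous|exact: cst_continuous].
  by have [[cG _] _] := smooth_C1 sG; exact: cG.
have zpsi (t : R) : c <= `|t| -> psi t = 0.
  move=> ct; rewrite /psi vG //; apply: lt_le_trans (coord_le_norm _ j).
  rewrite !mxE !eqxx /= mulr1; have := coord_le_norm x0 j; have := lerB_dist t (- x0 0 j).
  rewrite opprK normrN; move: ct; rewrite /c; lra.
have psi0 : 0 < psi 0 by rewrite /psi scale0r add0r G0.
have [th [N [N0 dth th0 th1 thb]]] := step_function c0 cpsi zpsi (fun r => Gpos _) psi0.
exists th, c.
pose L x : V := x 0 j *: unit_vec R j + x0.
pose k (i : 'I_d) : R := (i == j)%:R.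
have cL : continuous L.
  move=> x.
  apply: (@continuous_comp _ _ _ (fun x : V => x 0 j) (fun r : R => r *: unit_vec R j + x0)).
    exact: coord_continuous.
  by apply: continuousD; [exact: scalel_continuous|exact: cst_continuous].
have aL i x (r : R) : L (r *: unit_vec R i + x) = (k i * r) *: unit_vec R j + L x.
  by rewrite /L !mxE eqxx /= eq_sym addrA -scalerDl /k mulrC.
have k1 i : `|k i| <= 1 by rewrite /k; case: eqP => _; rewrite ?normr1 ?normr0.
have dX i x : isd i (coordC th j) x ((k i / N)%:C%C * G (L x)).
  have -> : G (L x) = (psi (x 0 j))%:C%C by rewrite Greal.
  rewrite -rmorphM; split; last exact: is_derive_cst.
  rewrite /= mulrAC -mulrA.
  have D := dth (x 0 j).
  apply: (is_derive_affine (L := fun x : V => x 0 j) (f := th) (w := 1)) => r.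
  by rewrite !mxE eqxx /= eq_sym /k mulrC [_ *: 1]mulr1.
have pX i : partial i (coordC th j) = ((k i / N)%:C%C : R[i]) *: (G \o L).
  by apply/funext => x; apply: partialE; exact: dX.
have cth := is_derive_cont1 dth.
have sX : smooth (coordC th j).
  apply: smooth_first; last by move=> i; rewrite pX; apply: smoothZ; exact: smooth_affine cL aL _ sG.
  split; last by move=> i x; rewrite pX; exact: dX.
  split; last exact: cst_continuous.
  by move=> x; apply: (@continuous_comp _ _ _ (fun x : V => x 0 j) th); [exact: coord_continuous|exact: cth].
split => //.
apply: good1 gG => h h0 [A HA]; have A0 := dbound_ge0 hM HA.
have HL := dbound_affine cL aL k1 sG HA.
have sL : smooth (G \o L) by exact: smooth_affine cL aL _ sG.
have M1 := weight_gt0 hM 1.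
exists (1 + A / N / h / M 1%N) => s x.
have B0 : 0 <= A / N / h / M 1%N by rewrite !divr_ge0 // ltW.
case/lastP: s => [|s i].
  have -> : cabs (partials [::] (coordC th j) x) = `|th (x 0 j)| by exact: cabsR.
  rewrite /= expr0 (weight0 hM) !mulr1; apply: le_trans (thb _) _; by rewrite lerDl.
rewrite -cats1 partials_cat [partials [:: i] _]/= pX partialsZ // size_cat addn1.
rewrite -[(_ *: _) x]/((k i / N)%:C%C * partials s (G \o L) x) cabsM cabsR.
set n := size s; have Mn := weight_gt0 hM n; have Mn1 := weight_gt0 hM n.+1.
have ratio : M n * M 1%N <= M n.+1 by rewrite -[n.+1]addn1 (weight_supermul hM).
apply: (@le_trans _ _ (N^-1 * (A * h ^+ n * M n))).
  apply: ler_pM => //; first exact: cabs_ge0.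
    rewrite normrM (gtr0_norm (_ : 0 < N^-1)) ?invr_gt0 //.
    by rewrite ler_piMl // invr_ge0 ltW.
apply: (@le_trans _ _ (A / N / h / M 1%N * h ^+ n.+1 * M n.+1)); last first.
  rewrite mulrDl mulrDl mul1r lerDr mulr_ge0 ?exprn_ge0 // ltW //.
have hn : 0 < h ^+ n by rewrite exprn_gt0.
rewrite [leRHS](_ : _ = A / N * h ^+ n * (M n.+1 / M 1%N)); last first.
  by rewrite exprS; field; rewrite !gt_eqF.
rewrite [leLHS](_ : _ = A / N * h ^+ n * M n); last by ring.
apply: ler_wpM2l; first by rewrite mulr_ge0 ?divr_ge0 // ltW.
by rewrite ler_pdivlMr.
Qed.

End StepFamily.


(** * A partition of unity *)

Section Sufficiency.
Variables (R : realType) (d : nat) (M : nat -> R).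
Hypothesis hM : weight_sequence M.
Local Notation V := 'rV[R]_d.
Local Notation F := (V -> R[i]).
Implicit Types (g : F) (a m : R) (s : seq 'I_d) (t x y tau lo hi : V) (b : star).

Lemma goodZ b (N : R) (P Q : R -> Prop) : 0 < N ->
  (forall h, 0 < h -> P h -> Q (N * h)) -> good b P -> good b Q.
Proof.
move=> N0 H; case: b => /= [HP h h0|[h h0 Ph]].
  rewrite -[h](@divfK _ N) ?gt_eqF // mulrC; apply: H; first exact: divr_gt0.
  by apply: HP; exact: divr_gt0.
by exists (N * h); [exact: mulr_gt0|exact: H].
Qed.

Lemma good_forall b (P : 'I_d -> R -> Prop) :
  (forall j h k, 0 < h -> h <= k -> P j h -> P j k) ->
  (forall j, good b (P j)) -> good b (fun h => forall j, P j h).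
Proof.
move=> mono; case: b => /= H; first by move=> h h0 j; exact: H.
have /choice[h Hh] : forall j, exists h, 0 < h /\ P j h.
  by move=> j; have [h h0 Ph] := H j; exists h.
exists (1 + \sum_j h j) => [|j]; first by rewrite ltr_pwDl // sumr_ge0 // => j _; rewrite ltW //; case: (Hh j).
have [h0 Ph] := Hh j; apply: mono Ph => //.
rewrite (bigD1 j) //= addrCA lerDl addr_ge0 // sumr_ge0 // => i _.
by rewrite ltW //; case: (Hh i).
Qed.

Lemma gevreyM b g g' : smooth g -> smooth g' -> gevrey M b g -> gevrey M b g' -> gevrey M b (g \* g').
Proof.
move=> sg sg'; apply: good2 => h k h0 k0 [A HA] [B HB]; exists (A * B).
by apply: dboundM => //; exact: ltW.
Qed.

Lemma smooth_prod (r : seq 'I_d) (G : 'I_d -> F) : (forall j, smooth (G j)) ->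
  smooth (fun x => \prod_(j <- r) G j x).
Proof.
move=> sG; elim: r => [|j r IH].
  rewrite (_ : (fun x => _) = (fun=> 1)); first exact: smooth_cst.
  by apply/funext => x; rewrite big_nil.
rewrite (_ : (fun x => _) = G j \* (fun x => \prod_(j <- r) G j x)); first exact: (smooth_mul (sG j) IH).
by apply/funext => x; rewrite big_cons.
Qed.

Lemma dbound_prod (r : seq 'I_d) (G : 'I_d -> F) (h B : R) : 0 < h -> (forall j, smooth (G j)) ->
  (forall j, dbound M h B (G j)) ->
  dbound M ((size r).+1%:R * h) (B ^+ size r) (fun x => \prod_(j <- r) G j x).
Proof.
move=> h0 sG HG; elim: r => [|j r IH].
  rewrite (_ : (fun x => _) = (fun=> 1)); last by apply/funext => x; rewrite big_nil.
  move=> s x; rewrite partials_cst /= ?mulr1n ?expr0 !mul1r; case: s => [|i s].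
    by rewrite cabs1 /= expr0 (weight0 hM) mul1r.
  by rewrite cabs0 mulr_ge0 ?exprn_ge0 ?(ltW h0) ?(ltW (weight_gt0 hM _)).
rewrite (_ : (fun x => _) = G j \* (fun x => \prod_(j <- r) G j x)); last first.
  by apply/funext => x; rewrite big_cons.
have -> : (size (j :: r)).+1%:R * h = h + (size r).+1%:R * h.
  by rewrite /= -[(size r).+2]add1n natrD mulrDl mul1r.
rewrite exprS; apply: dboundM => //.
- exact: ltW.
- by rewrite mulr_ge0 // ltW.
- exact: smooth_prod.
Qed.

Variables (b : star) (th : 'I_d -> R -> R) (c : R).
Hypothesis c0 : 0 < c.
Hypothesis th0 : forall j r, r <= - c -> th j r = 0.
Hypothesis th1 : forall j r, c <= r -> th j r = 1.
Hypothesis sth : forall j, smooth (coordC (th j) j).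
Hypothesis gth : good b (fun h => exists B, forall j, dbound M h B (coordC (th j) j)).

Definition shiftC (r : R) (j : 'I_d) : F := fun x => ((th j (x 0 j - r))%:C)%C.

Lemma shiftCE r j : shiftC r j = coordC (th j) j \o (fun x => x - r *: unit_vec R j).
Proof. by apply/funext => x; rewrite /shiftC /coordC /= !mxE !eqxx mulr1. Qed.

Lemma trans_cont y : continuous (fun x : V => x - y).
Proof. by move=> x; apply: continuousB; [exact: cvg_id|exact: cst_continuous]. Qed.

Lemma trans_aff y (i : 'I_d) x (r : R) : (r *: unit_vec R i + x) - y = (1 * r) *: unit_vec R i + (x - y).
Proof. by rewrite mul1r addrA. Qed.

Lemma smooth_shiftC r j : smooth (shiftC r j).
Proof.
rewrite shiftCE.
exact: (smooth_affine (trans_cont (y := r *: unit_vec R j)) (trans_aff (r *: unit_vec R j))).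
Qed.

Lemma dbound_shiftC h B r j : dbound M h B (coordC (th j) j) -> dbound M h B (shiftC r j).
Proof.
rewrite shiftCE => H.
apply: (dbound_affine (trans_cont (y := r *: unit_vec R j)) (trans_aff (r *: unit_vec R j))) => //.
by move=> _; rewrite normr1.
Qed.

(** A smooth version of the indicator function of r <= x_j < r'. *)
Definition bandC (r r' : R) (j : 'I_d) : F := shiftC r j - shiftC r' j.

Lemma smooth_bandC r r' j : smooth (bandC r r' j).
Proof. by apply: smoothB; exact: smooth_shiftC. Qed.

Lemma dbound_bandC h B r r' j : dbound M h B (coordC (th j) j) -> dbound M h (B + B) (bandC r r' j).
Proof.
by move=> H; apply: dboundB; try exact: smooth_shiftC; exact: dbound_shiftC.
Qed.

Lemma bandC_val r r' j x : bandC r r' j x = ((th j (x 0 j - r) - th j (x 0 j - r'))%:C)%C.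
Proof. by rewrite /bandC /shiftC rmorphB. Qed.

Definition piece (lo hi : V) : F := fun x => \prod_(j <- enum 'I_d) bandC (lo 0 j) (hi 0 j) j x.

Lemma smooth_piece lo hi : smooth (piece lo hi).
Proof. exact: (smooth_prod _ (fun j => smooth_bandC (lo 0 j) (hi 0 j) j)). Qed.

Lemma dbound_piece lo hi (h B : R) : 0 < h -> (forall j, dbound M h B (coordC (th j) j)) ->
  dbound M (d.+1%:R * h) ((B + B) ^+ d) (piece lo hi).
Proof.
move=> h0 HB.
have := dbound_prod (enum 'I_d) h0 (fun j => smooth_bandC (lo 0 j) (hi 0 j) j)
  (fun j => dbound_bandC (lo 0 j) (hi 0 j) (HB j)).
by rewrite size_enum_ord.
Qed.

Lemma gevrey_piece lo hi : gevrey M b (piece lo hi).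
Proof.
apply: (goodZ (N := d.+1%:R) _ _ gth) => // h h0 [B HB].
by exists ((B + B) ^+ d); exact: dbound_piece.
Qed.

Lemma piece_zero lo hi x j : x 0 j <= lo 0 j - c \/ hi 0 j + c <= x 0 j -> lo 0 j <= hi 0 j ->
  piece lo hi x = 0.
Proof.
move=> H lh; rewrite /piece big_enum (bigD1 j) //= bandC_val.
suff -> : th j (x 0 j - lo 0 j) - th j (x 0 j - hi 0 j) = 0 by rewrite rmorph0 mul0r.
by case: H => H; [rewrite !th0 ?subrr //; lra|rewrite !th1 ?subrr //; lra].
Qed.

Definition const_vec (r : R) : V := \row_(_ < d) r.

(** The pieces at integer points tau form a partition of unity; [box k] is the
    sum of those with tau in [-k, k)^d. *)
Definition unit_piece tau := piece tau (tau + const_vec 1).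
Definition box k := piece (const_vec (- k%:R)) (const_vec k%:R).

Lemma norm_gtP (r : R) x : 0 <= r -> r < `|x| -> exists j, r < `|x 0 j|.
Proof.
move=> r0 rx; apply: contrapT => H; move: rx; rewrite ltNge => /negP; apply.
apply/norm_leP => // j; rewrite leNgt; apply/negP => lt; by apply: H; exists j.
Qed.

Lemma unit_piece_zero tau x : c + 1 < `|x - tau| -> unit_piece tau x = 0.
Proof.
move=> /norm_gtP[|j]; first by rewrite addr_ge0 // ltW.
rewrite !mxE => H; apply: (piece_zero (j := j)); rewrite !mxE; last lra.
by have [h|h] := leP 0 (x 0 j - tau 0 j); [rewrite ger0_norm // in H; right|rewrite ltr0_norm // in H; left]; lra.
Qed.

Lemma box_zero k x : k%:R + c < `|x| -> box k x = 0.
Proof.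
have k0 : 0 <= k%:R :> R by [].
move=> /norm_gtP[|j H]; first by rewrite addr_ge0 // ltW.
apply: (piece_zero (j := j)); rewrite !mxE; last lra.
by have [h|h] := leP 0 (x 0 j); [rewrite ger0_norm // in H; right|rewrite ltr0_norm // in H; left]; lra.
Qed.

Lemma box_one k x : `|x| <= k%:R - c -> box k x = 1.
Proof.
move=> H; have kc : 0 <= k%:R - c by exact: le_trans H.
move/norm_leP : H => /(_ kc) H.
rewrite /box /piece big_enum big1 // => j _; rewrite bandC_val !mxE.
have := H j; rewrite ler_norml => /andP[h1 h2].
by rewrite th1 ?th0 ?subr0 //; lra.
Qed.

(** The integer points of [-k-1, k+1)^d; the shift by k + 1 makes indices of
    the coordinates, and [inner] selects the indices of [-k, k). *)
Definition grid k (e : {ffun 'I_d -> 'I_(k.+1.*2)}) : V := \row_j ((e j)%:R - k.+1%:R).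
Definition inner k : pred 'I_(k.+1.*2) := fun i => (0 < i <= k.*2)%N.

Lemma band_telescope j (u : nat -> R) (n n' : nat) x : (n <= n')%N ->
  \sum_(n <= i < n') bandC (u i) (u i.+1) j x = bandC (u n) (u n') j x.
Proof.
move=> nn; have E r r' : bandC r r' j x = - (shiftC r' j x - shiftC r j x) by rewrite opprB.
rewrite E -(telescope_sumr (fun i => shiftC (u i) j x) nn) -sumrN.
by apply: eq_bigr => i _; rewrite E.
Qed.

Lemma prod_grid k (P : pred 'I_(k.+1.*2)) x :
  \prod_(j <- enum 'I_d) (\sum_(i | P i) bandC (i%:R - k.+1%:R) (i.+1%:R - k.+1%:R) j x)
   = \sum_(e in ffun_on P) unit_piece (@grid k e) x.
Proof.
rewrite big_enum /= bigA_distr_big; apply: eq_bigr => e _.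
rewrite /unit_piece /piece big_enum; apply: eq_bigr => j _; rewrite !mxE.
by rewrite -[(e j).+1]addn1 natrD addrAC.
Qed.

(** In each coordinate the bands telescope, and the product of the sums is
    expanded.  The next lemma does the same with the inner bands, on the same
    index set, so that consecutive boxes differ by the outer pieces. *)
Lemma box_grid k x : box k.+1 x = \sum_e unit_piece (@grid k e) x.
Proof.
rewrite (eq_bigl (fun e => e \in ffun_on (xpredT : pred 'I_(k.+1.*2)))); last first.
  by move=> e; apply/esym/ffun_onP.
rewrite -prod_grid /box /piece; apply: eq_bigr => j _.
rewrite -(big_mkord xpredT (fun i => bandC (i%:R - k.+1%:R) (i.+1%:R - k.+1%:R) j x)).
rewrite (band_telescope j (fun i => i%:R - k.+1%:R) x (leq0n _)) !mxE sub0r.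
by congr (bandC _ _ _ _); rewrite -addnn natrD addrK.
Qed.

Lemma box_inner k x : box k x = \sum_(e in ffun_on (@inner k)) unit_piece (@grid k e) x.
Proof.
rewrite -prod_grid /box /piece; apply: eq_bigr => j _.
have -> : \sum_(i < k.+1.*2 | inner i) bandC (i%:R - k.+1%:R) (i.+1%:R - k.+1%:R) j x =
    \sum_(1 <= i < k.*2.+1) bandC (i%:R - k.+1%:R) (i.+1%:R - k.+1%:R) j x.
  rewrite (big_nat_widen _ _ k.+1.*2); last by rewrite doubleS.
  rewrite big_geq_mkord; apply: eq_bigl => i; by rewrite /inner /= ltnS andbC.
rewrite (band_telescope j (fun i => i%:R - k.+1%:R) x (ltn0Sn _)) !mxE.
congr (bandC _ _ _ _).
  by rewrite -[k.+1]addn1 natrD; ring.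
by rewrite -addnn -addSn natrD addrAC subrr add0r.
Qed.

Lemma grid_outside k (e : {ffun 'I_d -> 'I_(k.+1.*2)}) : e \notin ffun_on (@inner k) ->
  k%:R <= enorm (grid e).
Proof.
move=> en; have [j ej] : exists j, ~~ inner (e j).
  by apply/existsP; rewrite -negb_forall; apply: contra en => /forallP H; apply/ffun_onP.
apply: le_trans (coord_le_enorm _ j); rewrite mxE.
move: ej; rewrite /inner negb_and -leqNgt leqn0 -ltnNge => /orP[/eqP ->|ej].
  by rewrite sub0r normrN normr_nat ler_nat.
have ek : (k.*2.+1)%:R <= (e j)%:R :> R by rewrite ler_nat.
apply: le_trans (ler_norm _); rewrite lerBrDr; apply: le_trans ek.
by rewrite -natrD ler_nat -addnn addnS.
Qed.

(** * Extension of the functional to S *)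

Lemma sfun_gevrey g : sfun M b g -> gevrey M b g.
Proof.
move=> [sg gg]; apply: good1 gg => h h0 [A HA]; exists A => s x.
have hi : 0 < h^-1 by rewrite invr_gt0.
have hn : 0 < h^-1 ^+ size s by rewrite exprn_gt0.
have E1 : 1 <= assoc_exp M (h^-1 * enorm x).
  by apply: assoc_exp_ge1; [exact: weight_adm|rewrite mulr_ge0 ?enorm_ge0 // ltW].
rewrite mulrAC -ler_pdivrMr ?exprn_gt0 // -exprVn mulrC.
apply: le_trans (HA s x); rewrite ler_wpM2r ?cabs_ge0 // ler_peMr // ltW //.
Qed.

Lemma test_mul_piece g tau : sfun M b g -> tests M b (g \* unit_piece tau).
Proof.
move=> gg; have [sg _] := gg; exists (`|tau| + (c + 1)); split.
- exact: smooth_mul (smooth_piece _ _).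
- move=> x xt; rewrite /= unit_piece_zero ?mulr0 //.
  by apply: lt_le_trans (lerB_dist _ _); rewrite ltrBrDl.
- exact: (gevreyM sg (smooth_piece _ _) (sfun_gevrey gg) (gevrey_piece _ _)).
Qed.

Lemma test_mul_box g k : sfun M b g -> tests M b (g \* box k).
Proof.
move=> gg; have [sg _] := gg; exists (k%:R + c); split.
- exact: smooth_mul (smooth_piece _ _).
- by move=> x xt; rewrite /= box_zero ?mulr0.
- exact: (gevreyM sg (smooth_piece _ _) (sfun_gevrey gg) (gevrey_piece _ _)).
Qed.

Variable f : F -> R[i].
Hypothesis lf : linear_on (tests M b) f.

(** The values on g of the restrictions of f to growing boxes; their limit is
    the value of the extension. *)
Definition partial_value g k := f (g \* box k).

Lemma partial_value_inner g k : sfun M b g ->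
  partial_value g k = \sum_(e in ffun_on (@inner k)) f (g \* unit_piece (@grid k e)).
Proof.
move=> gg; rewrite -(linear_on_sum (tests_closed d hM b) lf); last by move=> e; exact: test_mul_piece.
congr f; apply/funext => x; rewrite fct_sumE /= box_inner mulr_sumr //.
Qed.

Lemma partial_value_grid g k : sfun M b g ->
  partial_value g k.+1 = \sum_e f (g \* unit_piece (@grid k e)).
Proof.
move=> gg; rewrite -(linear_on_sum (tests_closed d hM b) lf); last by move=> e; exact: test_mul_piece.
congr f; apply/funext => x; rewrite fct_sumE /= box_grid mulr_sumr //.
Qed.

Section Limit.
Variables (h C : R).
Hypothesis h0 : 0 < h.
Hypothesis C0 : 0 <= C.
Hypothesis est : forall g A tau, sfun M b g -> sbound M h^-1 A g ->
  cabs (f (g \* unit_piece tau)) <= C * A * ((1 + enorm tau) ^+ d.+2)^-1.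

(** The outer pieces number at most (2 (k + 1))^d and lie at distance at least
    k from the origin, which is why the decay (1 + |tau|)^(-d-2) leaves a
    summable (k + 1)^(-2). *)
Lemma partial_value_step g A k : sfun M b g -> sbound M h^-1 A g ->
  cabs (partial_value g k.+1 - partial_value g k) <= 2 ^+ d * (C * A) / k.+1%:R ^+ 2.
Proof.
move=> gg sA; have hi : 0 < h^-1 by rewrite invr_gt0.
have CA : 0 <= C * A by rewrite mulr_ge0 // (sbound_ge0 hM hi sA).
rewrite partial_value_grid // partial_value_inner //.
rewrite (bigID (fun e => e \in ffun_on (@inner k))) /= addrAC subrr add0r.
have k1 : 0 < k.+1%:R :> R by [].
apply: le_trans (cabs_sum _ _ _) _.
apply: (@le_trans _ _ (\sum_(e : {ffun 'I_d -> 'I_(k.+1.*2)} | e \notin ffun_on (@inner k))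
    C * A / k.+1%:R ^+ d.+2)).
  apply: ler_sum => e /grid_outside ke; apply: le_trans (est (grid e) gg sA) _.
  apply: ler_wpM2l => //; rewrite lef_pV2 ?posrE ?exprn_gt0 // ?ltr_pwDl ?enorm_ge0 //.
  rewrite lerXn2r ?nnegrE ?addr_ge0 ?enorm_ge0 // -[k.+1]add1n natrD lerD2l //.
apply: (@le_trans _ _ (\sum_(e : {ffun 'I_d -> 'I_(k.+1.*2)}) C * A / k.+1%:R ^+ d.+2)).
  rewrite [leRHS](bigID (fun e => e \notin ffun_on (@inner k))) /= lerDl.
  by apply: sumr_ge0 => e _; rewrite divr_ge0 // exprn_ge0.
rewrite sumr_const card_ffun !card_ord -[leLHS]mulr_natl natrX -muln2 natrM exprMn.
rewrite le_eqVlt; apply/orP; left; apply/eqP; rewrite !exprS.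
have kd : k.+1%:R ^+ d != 0 :> R by rewrite expf_neq0 // gt_eqF.
move: (k.+1%:R) k1 kd => K K0 Kd; rewrite expr0; field.
by rewrite Kd gt_eqF.
Qed.

Lemma partial_value0 g A : sfun M b g -> sbound M h^-1 A g ->
  cabs (partial_value g 0) <= 2 ^+ d * (C * A).
Proof.
move=> gg sA; have hi : 0 < h^-1 by rewrite invr_gt0.
have CA : 0 <= C * A by rewrite mulr_ge0 // (sbound_ge0 hM hi sA).
rewrite partial_value_inner //; apply: le_trans (cabs_sum _ _ _) _.
apply: (@le_trans _ _ (\sum_(e : {ffun 'I_d -> 'I_(1.*2)}) C * A)); last first.
  by rewrite sumr_const card_ffun !card_ord -[leLHS]mulr_natl natrX.
rewrite [leRHS](bigID (fun e => e \in ffun_on (@inner 0))) /= -[leLHS]addr0; apply: lerD; last exact: sumr_ge0.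
apply: ler_sum => e _; apply: le_trans (est (grid e) gg sA) _.
rewrite ler_piMr // invf_le1 ?exprn_gt0 ?ltr_pwDl ?enorm_ge0 //.
by rewrite exprn_ege1 // lerDl enorm_ge0.
Qed.

Lemma partial_value_limit g A : sfun M b g -> sbound M h^-1 A g ->
  exists2 l, tends (partial_value g) l & cabs l <= 5 * 2 ^+ d * C * A.
Proof.
move=> gg sA; have hi : 0 < h^-1 by rewrite invr_gt0.
have CA : 0 <= 2 ^+ d * (C * A) by rewrite !mulr_ge0 ?exprn_ge0 // (sbound_ge0 hM hi sA).
set K := 2 ^+ d * (C * A) in CA.
(* 1 / (n + 1)^2 <= 2 / (n + 1) - 2 / (n + 2) *)
pose W (n : nat) := 2 * K / n.+1%:R.
have W0 n : 0 <= W n by rewrite divr_ge0 // mulr_ge0.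
have [n|l Hl] := telescoping W0 (z := partial_value g).
  apply: le_trans (partial_value_step n gg sA) _; rewrite -/K /W.
  have n1 : 0 < n.+1%:R :> R by [].
  rewrite -[n.+2]addn1 natrD; have n1' : 1 <= n.+1%:R :> R by rewrite ler1n.
  move: (n.+1%:R) n1' n1 => N N1 N0.
  have N1' : 0 < N + 1 by lra.
  have -> : 2 * K / N - 2 * K / (N + 1) = K / N ^+ 2 * (2 * N / (N + 1)).
    by field; rewrite !gt_eqF.
  rewrite ler_peMr ?divr_ge0 ?exprn_ge0 ?(ltW N0) // ler_pdivlMr //; lra.
exists l.
  move=> e e0; exists (Num.trunc (4 * K / e)) => n Nn; apply: le_trans (Hl n) _; rewrite /W.
  have nb : 4 * K / e < n.+1%:R.
    by apply: lt_le_trans (truncnS_gt _) _; rewrite ler_nat ltnS.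
  move: nb; rewrite ltr_pdivrMr // mulrA ler_pdivrMr //; lra.
have -> : l = partial_value g 0 - (partial_value g 0 - l) by ring.
apply: le_trans (cabsB _ _) _.
have := partial_value0 gg sA; have := Hl 0%N; rewrite /W divr1 -/K.
rewrite (_ : 5 * 2 ^+ d * C * A = 5 * K); last by rewrite /K; ring.
lra.
Qed.

End Limit.

(** The boxes are eventually equal to 1 on the support of a test function. *)
Lemma partial_value_test g a : test M b a g -> tends (partial_value g) (f g).
Proof.
move=> [sg vg gg]; apply: (@tends_eventually _ _ _ (Num.trunc (Num.max 0 (a + c))).+1) => k kN.
rewrite /partial_value; congr f; apply/funext => x /=.
have [xa|/vg ->] := leP `|x| a; last by rewrite mul0r.
rewrite box_one ?mulr1 //; apply: le_trans xa _; rewrite lerBrDr.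
apply: (@le_trans _ _ (Num.max 0 (a + c))); first by rewrite le_max lexx orbT.
by apply: ltW; apply: lt_le_trans (truncnS_gt _) _; rewrite ler_nat.
Qed.

Definition extension g : R[i] := xget 0 [set l | tends (partial_value g) l].

Lemma extensionE g l : tends (partial_value g) l -> extension g = l.
Proof. by move=> H; apply: xget_unique => // l' H'; exact: tends_unique H' H. Qed.

Lemma extension_lin : (forall g, sfun M b g -> exists l, tends (partial_value g) l) ->
  linear_on (sfun M b) extension.
Proof.
move=> lim k g g' Tg Tg'; have [l Hl] := lim g Tg; have [l' Hl'] := lim g' Tg'.
rewrite (extensionE Hl) (extensionE Hl'); apply: extensionE.
have := tends_lin k Hl Hl'; congr tends; apply/funext => n; rewrite /partial_value.
rewrite -lf; try exact: test_mul_box.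
congr f; apply/funext => x.
change (k * (g x * box n x) + g' x * box n x = (k * g x + g' x) * box n x).
by rewrite mulrDl mulrA.
Qed.

(** The value f(g p), for the piece p at tau, is the convolution of f at tau
    with phi(t) = (g p)(tau - t), which is supported in a ball that does not
    depend on tau.  Near tau the weight in the norm of g makes phi small like
    the inverse of e^M at |tau| / (2h), because |tau| <= 2 max(|x|, r) for x in
    the support of p.  This outweighs the growth e^W of the convolution. *)
Lemma piece_estimate (h h1 B C Cw : R) (W : V -> R) : 0 < h -> 0 < h1 ->
  (forall j, dbound M h1 B (coordC (th j) j)) -> 0 <= C -> 0 <= B ->
  (forall g A, test M b (c + 1) g -> dbound M (h + d.+1%:R * h1) A g ->
     forall x, cabs (f (refl x g)) <= C * A * expR (W x)) ->
  (forall x, expR (W x) <= Cw * ((1 + enorm x) ^+ d.+2)^-1 * assoc_exp M (h^-1 / 2 * enorm x)) ->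
  forall g A tau, sfun M b g -> sbound M h^-1 A g ->
    cabs (f (g \* unit_piece tau)) <=
      C * (B + B) ^+ d * assoc_exp M (h^-1 * ((1 + d%:R) * (c + 1))) * Cw * A * ((1 + enorm tau) ^+ d.+2)^-1.
Proof.
move=> h0 h10 HB C0 B0 eq grow g A tau gg sA; have [sg _] := gg.
have hi : 0 < h^-1 by rewrite invr_gt0.
have A0 := sbound_ge0 hM hi sA; have aM := weight_adm hM.
set r := (1 + d%:R) * (c + 1); have r0 : 0 <= r by rewrite mulr_ge0 ?addr_ge0 // ltW.
set Er := assoc_exp M (h^-1 * r); set Et := assoc_exp M (h^-1 / 2 * enorm tau).
have Er0 : 0 < Er := assoc_exp_gt0 _ _; have Et0 : 0 < Et := assoc_exp_gt0 _ _.
have ErE : Er = assoc_exp M (h^-1 * r) by [].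
have EtE : Et = assoc_exp M (h^-1 / 2 * enorm tau) by [].
have growt := grow tau; rewrite -EtE in growt; clearbody Er Et.
have Q0 : 0 <= Er / Et := ltW (divr_gt0 Er0 Et0).
have AQ0 : 0 <= A * (Er / Et) := mulr_ge0 A0 Q0.
have BB0 : 0 <= (B + B) ^+ d by rewrite exprn_ge0 // addr_ge0.
set K := A * (Er / Et) * (B + B) ^+ d.
have K0 : 0 <= K := mulr_ge0 AQ0 BB0.
have sp := smooth_piece tau (tau + const_vec 1).
have sgp : smooth (g \* unit_piece tau) by exact: smooth_mul.
have local s x : cabs (partials s (g \* unit_piece tau) x)
    <= K * (h + d.+1%:R * h1) ^+ size s * M (size s).
  have [far|near] := ltP (c + 1) `|x - tau|.
    have -> : partials s (g \* unit_piece tau) x = 0.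
      apply: (@partials_vanish _ _ [set x | c + 1 < `|x - tau|]) => //.
        apply: (@open_comp _ _ (fun x : V => `|x - tau|) [set r | c + 1 < r]); last exact: open_gt.
        move=> y _; apply: (@continuous_comp _ _ _ (fun x : V => x - tau) (fun x : V => `|x|)).
          exact: trans_cont.
        exact: norm_continuous.
      by move=> y /unit_piece_zero /= ->; rewrite mulr0.
    rewrite cabs0; apply: mulr_ge0 _ (ltW (weight_gt0 hM _)); apply: mulr_ge0 K0 _.
    by rewrite exprn_ge0 // addr_ge0 ?mulr_ge0 // ltW.
  have h1d : 0 <= d.+1%:R * h1 by rewrite mulr_ge0 // ltW.
  apply: (leibniz_bound hM s (ltW h0) h1d AQ0 BB0 sg sp).
  - move=> s'; have := sA s' x.
    set n := size s'; have Mn := weight_gt0 hM n; set Ex := assoc_exp M _; set z := cabs _ => le.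
    have Ex0 : 0 < Ex := assoc_exp_gt0 _ _.
    have hn : 0 < h ^+ n by rewrite exprn_gt0.
    have EtEr : Et <= Ex * Er.
      have x0 : 0 <= h^-1 * enorm x by rewrite mulr_ge0 ?enorm_ge0 // ltW.
      have r0' : 0 <= h^-1 * r by rewrite mulr_ge0 // ltW.
      rewrite ErE EtE; apply: le_trans (assoc_exp_max aM x0 r0').
      apply: (assoc_exp_mono aM).
        by rewrite mulr_ge0 ?enorm_ge0 // divr_ge0 // ltW.
      rewrite -maxr_pMr; last exact: ltW.
      rewrite -mulrA ler_pM2l //.
      have -> : tau = x + (- (x - tau)) by rewrite opprB addrCA subrr addr0.
      have := enormD_le x (- (x - tau)); rewrite enormN.
      have : Num.max (enorm x) (enorm (x - tau)) <= Num.max (enorm x) r.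
        by rewrite ge_max !le_max lexx /= (enorm_le _ near) ?orbT // addr_ge0 // ltW.
      rewrite opprB addrCA subrr addr0.
      move: (Num.max _ (enorm _)) (Num.max _ r) => m1 m2; lra.
    have zE : z * Ex <= A * h ^+ n * M n.
      move: le; rewrite exprVn -mulrA -ler_pdivlMl ?invr_gt0 // invrK => le.
      by rewrite mulrC; apply: le_trans le _; rewrite mulrCA mulrA.
    rewrite mulrAC -mulrA mulrAC -(ler_pM2r Ex0); apply: le_trans zE _.
    rewrite [leRHS](_ : _ = A * h ^+ n * M n * ((Ex * Er) / Et)); last by ring.
    apply: ler_peMr; first by rewrite !mulr_ge0 // ltW.
    by rewrite (ler_pdivlMr _ _ Et0) mul1r.
  - by move=> s'; exact: (dbound_piece tau (tau + const_vec 1) h10 HB).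
pose phi : F := refl tau (g \* unit_piece tau).
have phiK : g \* unit_piece tau = refl tau phi.
  by apply/funext => x; rewrite /phi /refl opprB addrCA subrr addr0.
have tphi : test M b (c + 1) phi.
  split; first exact: smooth_refl.
    move=> y yc; rewrite /phi /refl /= unit_piece_zero ?mulr0 //.
    by rewrite addrAC subrr add0r normrN.
  have [a0 ta] := test_mul_piece tau gg.
  by have [_ _] := test_refl tau ta.
rewrite phiK; apply: le_trans (eq _ K tphi _ tau) _; first by apply: dbound_refl.
apply: le_trans (ler_wpM2l (mulr_ge0 C0 K0) growt) _; rewrite /K.
rewrite le_eqVlt; apply/orP; left; apply/eqP.
set P := (_ ^+ d.+2)^-1; field.
by rewrite gt_eqF.
Qed.

End Sufficiency.


(** * Growth functions and the conclusion *)

Section Assembly.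
Variables (R : realType) (d : nat) (M : nat -> R).
Hypothesis hM : weight_sequence M.
Local Notation V := 'rV[R]_d.
Local Notation F := (V -> R[i]).
Implicit Types (g : F) (a m : R) (s : seq 'I_d) (t x y tau : V) (b : star).

(** Since l_p tends to infinity, the quotient of (mu rho)^p / M_p and
    rho^p / (M_p l_1 ... l_p) is bounded below in p. *)
Lemma seq_weight_small l mu : frakR l -> 0 < mu -> exists2 C : R, 0 <= C &
  forall rho, 0 <= rho -> assoc_exp (seq_weight M l) rho <= C * assoc_exp M (mu * rho).
Proof.
move=> fl mu0; have al := frakR_adm hM fl; have [lp lm lim] := fl.
pose Q p := \prod_(1 <= j < p.+1) l j.
have Q0 p : 0 < Q p.
  by rewrite /Q big_seq prodr_gt0 // => j; rewrite mem_index_iota => /andP[/lp].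
pose q p := (Q p * mu ^+ p)^-1.
have q0 p : 0 < q p by rewrite invr_gt0 mulr_gt0 // exprn_gt0.
have [N HN] : exists N, forall p, (N <= p)%N -> mu^-1 <= l p.
  by move/cvgryPge : lim => /(_ mu^-1)[N _ HN]; exists N => p Np; exact: HN.
pose C := \sum_(i < N.+1) q i.
have C0 : 0 <= C by apply: sumr_ge0 => i _; exact: ltW.
have qC p : q p <= C.
  have [pN|/ltnW] := leqP p N.
    rewrite /C (bigD1 (Ordinal (pN : (p < N.+1)%N))) //= lerDl sumr_ge0 // => i _.
    exact: ltW.
  move=> /subnK <-; elim: (p - N)%N => [|n IH].
    by rewrite /C (bigD1 ord_max) //= lerDl sumr_ge0 // => i _; exact: ltW.
  apply: le_trans IH; rewrite addSn /q lef_pV2 ?posrE ?mulr_gt0 ?exprn_gt0 //.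
  have -> : Q (n + N).+1 = Q (n + N)%N * l (n + N).+1 by rewrite /Q big_nat_recr.
  have -> : Q (n + N)%N * l (n + N).+1 * mu ^+ (n + N).+1 = Q (n + N)%N * mu ^+ (n + N) * (l (n + N).+1 * mu).
    by rewrite (exprS mu (n + N)); ring.
  apply: ler_peMr; first by rewrite mulr_ge0 ?exprn_ge0 ?(ltW (Q0 _)) // ltW.
  by rewrite -ler_pdivrMr // div1r HN // leqW // leq_addl.
exists C => // rho r0; have mr0 : 0 <= mu * rho by rewrite mulr_ge0 // ltW.
apply: assoc_exp_le => // p; have Mp := weight_gt0 hM p.
have -> : rho ^+ p / seq_weight M l p = q p * ((mu * rho) ^+ p / M p).
  rewrite /seq_weight -/(Q p) /q exprMn; field.
  by rewrite !gt_eqF // exprn_gt0.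
apply: ler_pM; rewrite ?(ltW (q0 _)) ?qC //; first by rewrite divr_ge0 ?exprn_ge0 // ltW.
by apply: assoc_exp_ge => //; exact: weight_adm.
Qed.

(** What [piece_estimate] asks of the growth function W: the decay available in
    S at parameter 1 / h, halved as there, beats e^W with a summable factor to
    spare. *)
Definition absorbed (W : V -> R) (h : R) := exists2 Cw : R, 0 <= Cw & forall x,
  expR (W x) <= Cw * ((1 + enorm x) ^+ d.+2)^-1 * assoc_exp M (h^-1 / 2 * enorm x).

Lemma absorbed_le W h h' : 0 < h' -> h' <= h -> absorbed W h -> absorbed W h'.
Proof.
move=> h0' hh [Cw C0 HW]; exists Cw; first exact: C0.
move=> x; apply: le_trans (HW x) _.
have h0 := lt_le_trans h0' hh.
apply: ler_wpM2l; first by rewrite divr_ge0 // exprn_ge0 // addr_ge0 // enorm_ge0.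
apply: assoc_exp_mono; first exact: weight_adm.
  by rewrite mulr_ge0 ?enorm_ge0 // divr_ge0 // invr_ge0 ltW.
by rewrite ler_wpM2r ?enorm_ge0 // ler_pM2r ?invr_gt0 // lef_pV2.
Qed.

Lemma absorbed_Beurling lambda : 0 < lambda ->
  cogood Beurling (absorbed (fun x => assoc_fun M (lambda * enorm x))).
Proof.
move=> l0; have [H H1 dil] := weight_dilate hM; have H0 : 0 < H by exact: lt_le_trans H1.
have [C C0 HC] := dil d.+2 _ l0.
exists (2 * H * lambda)^-1; first by rewrite invr_gt0 !mulr_gt0.
exists C; first exact: ltW.
move=> x; have x0 := enorm_ge0 x; have := HC _ x0.
rewrite -[expR _]/(assoc_exp M (lambda * enorm x)) invrK.
have -> : 2 * H * lambda / 2 = H * lambda by field.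
have p0 : 0 < (1 + enorm x) ^+ d.+2 by rewrite exprn_gt0 // ltr_pwDl.
by move=> le; rewrite [leRHS]mulrAC ler_pdivlMr // mulrC.
Qed.

Lemma absorbed_Roumieu l : frakR l ->
  cogood Roumieu (absorbed (fun x => assoc_fun_seq M l (enorm x))).
Proof.
move=> fl h h0; have [H H1 dil] := weight_dilate hM; have H0 : 0 < H by exact: lt_le_trans H1.
pose mu := h^-1 / 2 / H; have mu0 : 0 < mu by rewrite !divr_gt0 // invr_gt0.
have [C C0 HC] := dil d.+2 _ mu0; have [C' C0' HC'] := seq_weight_small fl mu0.
exists (C' * C); first by rewrite mulr_ge0 // ltW.
move=> x; have x0 := enorm_ge0 x.
have p0 : 0 < (1 + enorm x) ^+ d.+2 by rewrite exprn_gt0 // ltr_pwDl.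
have Hmu : H * mu * enorm x = h^-1 / 2 * enorm x by rewrite /mu; field; rewrite !gt_eqF.
have step : assoc_exp M (mu * enorm x) <=
    C * ((1 + enorm x) ^+ d.+2)^-1 * assoc_exp M (h^-1 / 2 * enorm x).
  have := HC _ x0; rewrite Hmu => le.
  by rewrite [leRHS]mulrAC ler_pdivlMr // mulrC.
apply: le_trans (HC' _ x0) _; apply: le_trans (ler_wpM2l C0' step) _.
by rewrite !mulrA.
Qed.

(** Steps for all coordinates, with one width c and common bounds. *)
Lemma step_family b a g : test M b a g -> g <> 0 ->
  exists (th : 'I_d -> R -> R) (c : R), [/\ 0 < c,
    forall j r, r <= - c -> th j r = 0, forall j r, c <= r -> th j r = 1,
    forall j, smooth (coordC (th j) j) &
    good b (fun h => exists B, forall j, dbound M h B (coordC (th j) j))].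
Proof.
move=> tg gn0.
have coord : forall j : 'I_d, exists p : (R -> R) * R, [/\ 0 < p.2, forall r, r <= - p.2 -> p.1 r = 0,
    forall r, p.2 <= r -> p.1 r = 1, smooth (coordC p.1 j) &
    good b (fun h => exists A, dbound M h A (coordC p.1 j))].
  by move=> j; have [th [c H]] := step_coordinate hM j tg gn0; exists (th, c).
have [p Hp] := boolp.choice coord.
pose c := 1 + \sum_j (p j).2.
have pc j : (p j).2 <= c.
  rewrite /c (bigD1 j) //= addrCA lerDl addr_ge0 // sumr_ge0 // => i _.
  by have [/ltW] := Hp i.
exists (fun j => (p j).1), c; split.
- by rewrite ltr_pwDl // sumr_ge0 // => i _; have [/ltW] := Hp i.
- by move=> j r rc; have [_ z _ _ _] := Hp j; apply: z; apply: le_trans rc _; rewrite lerN2.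
- by move=> j r rc; have [_ _ z _ _] := Hp j; apply: z; exact: le_trans (pc j) rc.
- by move=> j; have [_ _ _ z _] := Hp j.
- have : good b (fun h => forall j, exists A, dbound M h A (coordC (p j).1 j)).
    apply: good_forall => [j h k h0 hk [A HA]|j]; last by have [_ _ _ _ z] := Hp j.
    by exists A; exact: (dbound_mono hM h0 hk (lexx A)).
  apply: good1 => h h0 /choice[A HA]; exists (\sum_j A j) => j.
  apply: (dbound_mono hM h0 (lexx h) _ (HA j)).
  rewrite (bigD1 j) //= lerDl sumr_ge0 // => i _; exact: dbound_ge0 (HA i).
Qed.

(** The nontrivial case sums f over a partition of unity.  If D is reduced to
    0, there is no partition of unity, but then f is the restriction of 0. *)
Lemma sufficiency b f (W : V -> R) : cdual (D_space d M b) f ->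
  cogood b (absorbed W) ->
  (forall phi, tests M b phi -> exists B, forall x, cabs (f (refl x phi)) <= B * expR (W x)) ->
  in_S' M b f.
Proof.
move=> cf gW bf; have [lf ctf] := D_dual hM cf.
have [[g [[a tg] gn0]]|trivial] := pselect (exists g, tests M b g /\ g <> 0); last first.
  have zero g : tests M b g -> g = 0.
    by move=> tg; apply: contrapT => gn0; apply: trivial; exists g.
  exists (fun=> 0).
    apply: (S_dual_intro hM); first by move=> k g g' _ _; rewrite mulr0 addr0.
    have bd h : 0 < h -> exists C, forall g A, sfun M b g -> sbound M h^-1 A g ->
        cabs (0 : R[i]) <= C * A.
      by move=> h0; exists 0 => g A _ _; rewrite cabs0 mul0r.
    by case: (b) bd => bd; [exists 1 => //; exact: bd|exact: bd].
  by move=> g /(D_carrierP hM) /zero ->; rewrite (linear_on0 (tests_closed d hM b) lf).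
have [th [c [c0 th0 th1 sth gth]]] := step_family tg gn0.
have eq := convolution_equicontinuity hM (c + 1) lf ctf bf.
have estimate : cogood b (fun h => exists2 C, 0 <= C & forall g A tau,
    sfun M b g -> sbound M h^-1 A g ->
    cabs (f (g \* unit_piece th tau)) <= C * A * ((1 + enorm tau) ^+ d.+2)^-1).
  have main h h1 B C Cw : 0 < h -> 0 < h1 -> (forall j, dbound M h1 B (coordC (th j) j)) ->
      0 <= Cw -> (forall x, expR (W x) <= Cw * ((1 + enorm x) ^+ d.+2)^-1 * assoc_exp M (h^-1 / 2 * enorm x)) ->
      (forall g A, test M b (c + 1) g -> dbound M (h + d.+1%:R * h1) A g ->
        forall x, cabs (f (refl x g)) <= C * A * expR (W x)) ->
      exists2 C, 0 <= C & forall g A tau, sfun M b g -> sbound M h^-1 A g ->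
        cabs (f (g \* unit_piece th tau)) <= C * A * ((1 + enorm tau) ^+ d.+2)^-1.
    move=> h0 h10 HB Cw0 HW HC.
    have HB' j : dbound M h1 `|B| (coordC (th j) j).
      by apply: (dbound_mono hM h10 (lexx _) (ler_norm B)); exact: HB.
    have HC' g' A : test M b (c + 1) g' -> dbound M (h + d.+1%:R * h1) A g' ->
        forall x, cabs (f (refl x g')) <= `|C| * A * expR (W x).
      move=> tg' dg' x; apply: le_trans (HC g' A tg' dg' x) _.
      rewrite ler_pM2r ?expR_gt0 //; apply: ler_wpM2r (ler_norm C); exact: dbound_ge0 dg'.
    exists (`|C| * (`|B| + `|B|) ^+ d * assoc_exp M (h^-1 * ((1 + d%:R) * (c + 1))) * Cw); last first.
      have E := piece_estimate hM c0 th0 th1 sth gth h0 h10 HB' (normr_ge0 C) (normr_ge0 B) HC' HW.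
      exact: E.
    by rewrite !mulr_ge0 ?exprn_ge0 ?addr_ge0 // ltW // assoc_exp_gt0.
  case: b cf gW bf lf ctf tg gth eq main => cf gW bf lf ctf tg gth eq main /=.
    have [hE hE0 [C HC]] := eq; have [hG hG0 aG] := gW.
    pose h := Num.min (hE / 2) hG; have h0 : 0 < h by rewrite lt_min divr_gt0.
    pose h1 := hE / 2 / d.+1%:R; have h10 : 0 < h1 by rewrite !divr_gt0.
    have [Cw Cw0 HW] : absorbed W h by apply: absorbed_le aG => //; rewrite ge_min lexx orbT.
    have [B HB] := gth h1 h10.
    exists h => //; apply: (main h h1 B C Cw) => // g' A tg' dg'; apply: HC => //.
    apply: (dbound_mono hM _ _ (lexx A) dg'); first by rewrite addr_gt0 // mulr_gt0.
    have -> : d.+1%:R * h1 = hE / 2 by rewrite /h1 mulrC divfK // pnatr_eq0.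
    have : h <= hE / 2 by rewrite ge_min lexx.
    lra.
  move=> h h0; have [h1 h10 [B HB]] := gth; have [Cw Cw0 HW] := gW h h0.
  have hh : 0 < h + d.+1%:R * h1 by rewrite addr_gt0 // mulr_gt0.
  by have [C HC] := eq _ hh; exact: (main h h1 B C Cw).
pose u := extension th f.
have limits h : 0 < h -> (exists2 C, 0 <= C & forall g A tau,
    sfun M b g -> sbound M h^-1 A g ->
    cabs (f (g \* unit_piece th tau)) <= C * A * ((1 + enorm tau) ^+ d.+2)^-1) ->
    exists C, forall g A, sfun M b g -> sbound M h^-1 A g ->
      (exists l, tends (partial_value th f g) l) /\ cabs (u g) <= C * A.
  move=> h0 [C C0 HC]; exists (5 * 2 ^+ d * C) => g' A sg' dg'.
  have [l Hl bl] := partial_value_limit hM c0 th0 th1 sth gth lf h0 C0 HC sg' dg'.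
  by split; [exists l|rewrite /u (extensionE Hl)].
exists u; last first.
  move=> g' /(D_carrierP hM)[a' tg']; apply: extensionE.
  exact: (partial_value_test th0 th1 f tg').
apply: (S_dual_intro hM).
  apply: (extension_lin hM c0 th0 th1 sth gth lf) => g' Tg'; have [sg' gg'] := Tg'.
  case: b cf gW bf lf ctf tg gth eq estimate limits Tg' gg' => cf gW bf lf ctf tg gth eq estimate limits Tg' /=.
    move=> gg'; have [h h0 est] := estimate; have [A HA] := gg' h h0.
    by have [C HC] := limits h h0 est; have [] := HC g' A Tg' HA.
  move=> [h h0 [A HA]].
  by have [C HC] := limits h h0 (estimate h h0); have [] := HC g' A Tg' HA.
case: b cf gW bf lf ctf tg gth eq estimate limits => cf gW bf lf ctf tg gth eq estimate limits /=.
  have [h h0 est] := estimate; exists h => //; have [C HC] := limits h h0 est.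
  by exists C => g' A sg' dg'; have [] := HC g' A sg' dg'.
move=> h h0; have [C HC] := limits h h0 (estimate h h0).
by exists C => g' A sg' dg'; have [] := HC g' A sg' dg'.
Qed.

End Assembly.

Unset Implicit Arguments.

Theorem proposition3p1 (R : realType) (d : nat) (M : nat -> R)
    (hM : weight_sequence M) :
  (forall f : ('rV[R]_d -> R[i]) -> R[i], cdual (D_space d M Beurling) f ->
     (in_S' M Beurling f <->
      exists2 lambda : R, 0 < lambda &
        forall phi, carrier (D_space d M Beurling) phi ->
          (ereal_sup [set (expR (- assoc_fun M (lambda * enorm x))
                             * cabs (convolution f phi x))%:E
                       | x in [set: 'rV[R]_d]] < +oo)%E))
  /\
  (forall f : ('rV[R]_d -> R[i]) -> R[i], cdual (D_space d M Roumieu) f ->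
     (in_S' M Roumieu f <->
      exists2 l : nat -> R, frakR l &
        forall phi, carrier (D_space d M Roumieu) phi ->
          (ereal_sup [set (expR (- assoc_fun_seq M l (enorm x))
                             * cabs (convolution f phi x))%:E
                       | x in [set: 'rV[R]_d]] < +oo)%E)).
Proof.
split=> f cf; split.
- exact: necessity_Beurling.
- move=> [lambda l0 H]; apply: (@sufficiency R d M hM Beurling f _ cf (absorbed_Beurling d hM l0)) => phi /(D_carrierP hM).
  by move=> /H; exact: growth_bound.
- exact: necessity_Roumieu.
- move=> [l fl H]; apply: (@sufficiency R d M hM Roumieu f _ cf (absorbed_Roumieu d hM fl)) => phi /(D_carrierP hM).
  by move=> /H; exact: growth_bound.
Qed.
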